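(* In the case $m=4$ (with $K(4)=-\frac32$), as identities of meromorphic functions of $(\tau,z)\in\mathbb{C}_+\times\mathbb{C}$: 1) $\widetilde{\rm ch}^{(+)}_{H(\Lambda^{[K(4),1]})}(\tau,z)=\frac i2\,\frac{1}{\eta(\frac\tau2)\eta(2\tau)}\cdot\frac{\vartheta_{10}(\tau,z)}{\vartheta_{01}(\tau,z)}\Big\{\frac{\eta(2\tau)^5}{\eta(\tau)^2\eta(4\tau)^2}\vartheta_{00}(2\tau,2z)-2\frac{\eta(4\tau)^2}{\eta(2\tau)}\vartheta_{10}(2\tau,2z)\Big\}$; 2) $\widetilde{\rm ch}^{(-)}_{H(\Lambda^{[K(4),1]})}(\tau,z)=-\frac i2\,\frac{\eta(\frac\tau2)}{\eta(\tau)^3}\cdot\frac{\vartheta_{10}(\tau,z)}{\vartheta_{00}(\tau,z)}\Big\{\frac{\eta(2\tau)^5}{\eta(\tau)^2\eta(4\tau)^2}\vartheta_{00}(2\tau,2z)+2\frac{\eta(4\tau)^2}{\eta(2\tau)}\vartheta_{10}(2\tau,2z)\Big\}$.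
   Context: Notation: $\mathbb{C}_+$ is the upper half-plane, $q^a:=e^{2\pi i a\tau}$, $\eta(\tau)=q^{1/24}\prod_{n\ge1}(1-q^n)$, and for $a,b\in\{0,1\}$ the Mumford theta functions are $\vartheta_{ab}(\tau,z)=\sum_{n\in\mathbb{Z}}e^{\pi i\tau(n+\frac a2)^2+2\pi i(n+\frac a2)(z+\frac b2)}$. For $m\in\frac12\mathbb{N}$, $s\in\frac12\mathbb{Z}$ put $\Phi_1^{[m,s]}(\tau,z_1,z_2,t)=e^{-2\pi imt}\sum_{j\in\mathbb{Z}}\frac{e^{2\pi imj(z_1+z_2)+2\pi isz_1}e^{2\pi i\tau(mj^2+sj)}}{1-e^{2\pi iz_1}e^{2\pi ij\tau}}$, $\Phi_2^{[m,s]}(\tau,z_1,z_2,t)=e^{-2\pi imt}\sum_{j\in\mathbb{Z}}\frac{e^{-2\pi imj(z_1+z_2)-2\pi isz_2}e^{2\pi i\tau(mj^2+sj)}}{1-e^{-2\pi iz_2}e^{2\pi ij\tau}}$, $\Phi^{[m,s]}=\Phi_1^{[m,s]}-\Phi_2^{[m,s]}$. Let $\theta_{k,m}(\tau,z)=\sum_{j\in\mathbb{Z}}e^{2\pi im(j+\frac{k}{2m})z}e^{2\pi i\tau m(j+\frac{k}{2m})^2}$, $E(x)=2\int_0^xe^{-\pi t^2}dt$, and $R_{j;m}(\tau,w)=\sum_{n\in j+2m\mathbb{Z}}\big\{{\rm sgn}(n-\frac12-j+2m)-E\big((n-2m\frac{{\rm Im}\,w}{{\rm Im}\,\tau})\sqrt{{\rm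 Im}(\tau)/m}\big)\big\}e^{-\frac{\pi in^2\tau}{2m}+2\pi inw}$. The correction term is $\Phi^{[m,s]}_{\rm add}(\tau,z_1,z_2,t)=-\frac12e^{-2\pi imt}\sum_{k\in s+\mathbb{Z},\,s\le k<s+2m}R_{k;m}(\tau,\frac{z_1-z_2}{2})[\theta_{k,m}-\theta_{-k,m}](\tau,z_1+z_2)$, and the modification is $\widetilde\Phi^{[m,s]}=\Phi^{[m,s]}+\Phi^{[m,s]}_{\rm add}$. N=3 denominators: $R^{(+)}(\tau,z)=\eta(\frac\tau2)\eta(2\tau)\frac{\vartheta_{11}(\tau,z)}{\vartheta_{00}(\tau,z)}$, $R^{(-)}(\tau,z)=\frac{\eta(\tau)^3}{\eta(\frac\tau2)}\frac{\vartheta_{11}(\tau,z)}{\vartheta_{01}(\tau,z)}$. For a positive integer $m$ and an integer $0\le m_2\le m$, put $K(m)=-\frac{m+2}{4}$, and let $H(\Lambda^{[K(m),m_2]})$ be the N=3 superconformal module obtained by quantum Hamiltonian reduction of the $\widehat{osp}(3|2)$-module of highest weight $K(m)\Lambda_0-\frac{m_2}2\alpha_1$. Its modified character and supercharacter are defined by $R^{(+)}\widetilde{\rm ch}^{(+)}_{H(\Lambda^{[K(m),m_2]})}=\widetilde\Phi^{[\frac m2,\frac{m_2+1}2]}(2\tau,z+\frac\tau2-\frac12,z-\frac\tau2+\frac12,\frac\tau8)$ and $R^{(-)}\widetilde{\rm ch}^{(-)}_{H(\Lambda^{[K(m),m_2]})}=\widetilde\Phi^{[\frac m2,\frac{m_2+1}2]}(2\tau,z+\frac\tau2,z-\frac\tau2,\frac\tau8)$.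 *)

(* Defs.v *)
From Stdlib Require Import Reals ZArith List.
From Coquelicot Require Import Coquelicot.

Open Scope C_scope.

Definition Cexp (z : C) : C :=
  (exp (Re z) * cos (Im z), exp (Re z) * sin (Im z))%R.

Definition CLim_seq (u : nat -> C) : C :=
  (real (Lim_seq (fun n => Re (u n))), real (Lim_seq (fun n => Im (u n)))).

Definition CSeries (a : nat -> C) : C :=
  (Series (fun n => Re (a n)), Series (fun n => Im (a n))).

(* Splits Z as {0, 1, 2, ...} and {-1, -2, ...}; every series below converges
   absolutely for Im tau > 0 away from its poles, so the order is immaterial. *)
Definition ZSeries (f : Z -> C) : C :=
  CSeries (fun n => f (Z.of_nat n)) + CSeries (fun n => f (- Z.of_nat n - 1)%Z).

Definition Csum (f : nat -> C) (n : nat) : C :=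
  fold_right Cplus 0 (map f (seq 0 n)).

(* The product runs over n >= 1. *)
Definition eta (tau : C) : C :=
  Cexp (2 * PI * Ci * tau / 24) *
  CLim_seq (fun N =>
    fold_right Cmult 1
      (map (fun n => 1 - Cexp (2 * PI * Ci * INR n * tau)) (seq 1 N))).

Definition vartheta (a b : nat) (tau z : C) : C :=
  ZSeries (fun n =>
    Cexp (PI * Ci * tau * (IZR n + INR a / 2) ^ 2
          + 2 * PI * Ci * (IZR n + INR a / 2) * (z + INR b / 2))).

Definition Phi1 (m s : R) (tau z1 z2 t : C) : C :=
  Cexp (- (2 * PI * Ci * m * t)) *
  ZSeries (fun j =>
    Cexp (2 * PI * Ci * m * IZR j * (z1 + z2) + 2 * PI * Ci * s * z1)
    * Cexp (2 * PI * Ci * tau * (m * IZR j ^ 2 + s * IZR j))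
    / (1 - Cexp (2 * PI * Ci * z1) * Cexp (2 * PI * Ci * IZR j * tau))).

Definition Phi2 (m s : R) (tau z1 z2 t : C) : C :=
  Cexp (- (2 * PI * Ci * m * t)) *
  ZSeries (fun j =>
    Cexp (- (2 * PI * Ci * m * IZR j * (z1 + z2)) - 2 * PI * Ci * s * z2)
    * Cexp (2 * PI * Ci * tau * (m * IZR j ^ 2 + s * IZR j))
    / (1 - Cexp (- (2 * PI * Ci * z2)) * Cexp (2 * PI * Ci * IZR j * tau))).

Definition Phi (m s : R) (tau z1 z2 t : C) : C :=
  Phi1 m s tau z1 z2 t - Phi2 m s tau z1 z2 t.

Definition theta (k m : R) (tau z : C) : C :=
  ZSeries (fun j =>
    Cexp (2 * PI * Ci * m * (IZR j + k / (2 * m)) * z)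
    * Cexp (2 * PI * Ci * tau * m * (IZR j + k / (2 * m)) ^ 2)).

Definition E (x : R) : R := (2 * RInt (fun t => exp (- PI * t ^ 2)) 0 x)%R.

(* The summation variable n in j + 2m Z is written n = j + 2 m l. *)
Definition Rfun (j m : R) (tau w : C) : C :=
  ZSeries (fun l =>
    let n := (j + 2 * m * IZR l)%R in
    RtoC (sign (n - 1 / 2 - j + 2 * m)
          - E ((n - 2 * m * (Im w / Im tau)) * sqrt (Im tau / m)))%R
    * Cexp (- (PI * Ci * n ^ 2 * tau / (2 * m)) + 2 * PI * Ci * n * w)).

(* Half-integral indices are passed doubled: m = M / 2 and s = S / 2.
   The k in s + Z with s <= k < s + 2m are k = s + i for 0 <= i < M = 2m. *)
Definition Phi_add (M : nat) (S : Z) (tau z1 z2 t : C) : C :=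
  let m := (INR M / 2)%R in
  let s := (IZR S / 2)%R in
  - (1 / 2) * Cexp (- (2 * PI * Ci * m * t)) *
  Csum (fun i =>
    let k := (s + INR i)%R in
    Rfun k m tau ((z1 - z2) / 2)
    * (theta k m tau (z1 + z2) - theta (- k) m tau (z1 + z2))) M.

(* The modification of Phi^[M/2, S/2]. *)
Definition Phi_mod (M : nat) (S : Z) (tau z1 z2 t : C) : C :=
  Phi (INR M / 2) (IZR S / 2) tau z1 z2 t + Phi_add M S tau z1 z2 t.

Definition denom_plus (tau z : C) : C :=
  eta (tau / 2) * eta (2 * tau) * (vartheta 1 1 tau z / vartheta 0 0 tau z).

Definition denom_minus (tau z : C) : C :=
  eta tau ^ 3 / eta (tau / 2) * (vartheta 1 1 tau z / vartheta 0 1 tau z).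

(* Modified character and supercharacter of H(Lambda^[K(m), m2]) with
   K(m) = -(m+2)/4, for m > 0 and 0 <= m2 <= m. They are defined by
   denom * ch = Phi_mod, i.e. as quotients, at the points (tau, z) where the
   denominator is defined and nonzero. The poles of the terms of Phi_mod are
   zeros of vartheta_00(tau, .) in the first case and of vartheta_01(tau, .)
   in the second, where the denominator itself is undefined. *)
Definition ch_plus (m m2 : nat) (tau z : C) : C :=
  Phi_mod m (Z.of_nat m2 + 1) (2 * tau)
    (z + tau / 2 - 1 / 2) (z - tau / 2 + 1 / 2) (tau / 8)
  / denom_plus tau z.

Definition ch_minus (m m2 : nat) (tau z : C) : C :=
  Phi_mod m (Z.of_nat m2 + 1) (2 * tau)
    (z + tau / 2) (z - tau / 2) (tau / 8)
  / denom_minus tau z.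

(* Main.v *)
(* Write q = e(tau), a = n + 1/2 and x_a = q^a e(z). At m = 4, m2 = 1 the series
   defining R_{3;2} is odd and the one defining R_{1;2} cancels in pairs up to a
   single term, so the correction term is half a difference of two theta series;
   added to Phi it gives (1/2) Sum_a q^{a^2} e(2 a z) (x_a - 1) / (x_a + 1), at z
   for ch^+ and at z + 1/2 for ch^-. The key identity is
     vartheta_00 Sum_a q^{a^2} e(2 a z) (x_a - 1) / (x_a + 1)
       = i vartheta_11 vartheta_10 vartheta_01.
   Since vartheta_00 / (1 + x_a) has an explicit Laurent expansion, both sides
   expand as Sum_N W_N q^{N^2/6} e(N z) with W odd and 3-periodic in N, so they are
   proportional. At z = (1 + tau) / 2 only the term a = -1/2 survives on the left
   and both sides equal -2 q^{-1/4} prod (1 - q^n)^3, by the Jacobi triple product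
   and Jacobi's formula for Sum (-1)^n (2n+1) q^{n(n+1)/2}. Finally the braces in
   the theorem are vartheta_01(tau, z)^2 and vartheta_00(tau, z)^2. *)

Require Import Defs.
From Stdlib Require Import Reals ZArith List.
From Coquelicot Require Import Coquelicot.
From Stdlib Require Import Lra Lia Permutation Classical ClassicalEpsilon.
From mathcomp Require Import ssreflect.

(** * The Gaussian integral and the bound on E *)

Open Scope R_scope.

(** Each quotient vartheta_00 / (1 + x_a) is entire in z, so the double series obtained by expanding
    all of them converges for every z, also at the zeros of vartheta_00, where the Appell sum has
    poles. Hence two multiples of one theta series can be compared at such a zero, and vartheta_00
    is divided out only afterwards. The exponent N^2/6 comes from completing a square: the monomials
    are q^{3a^2/2 + a c} e((3a + c) z), and N = 3a + c turns the form into N^2/6 - c^2/6. Only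
    coefficients of absolutely convergent series are compared; no theory of holomorphic functions
    enters. Two analytic points shape the rest. Rearrangements over Z and Z x Z call for a sum
    independent of order and of the index type, to which [ZSeries] is reduced by absolute
    convergence. And the series R_{1;2} contains the growing factor q^{-4 l^2}, so its summability
    rests on the Gaussian decay of 1 - E, hence on the value of the Gaussian integral. *)

Definition gauss (t : R) : R := exp (- PI * t ^ 2).
Definition gaussF (x : R) : R := RInt gauss 0 x.
(** Kernel of the classical proof of the Gaussian integral by differentiation under the integral
    sign: the x-derivative cancels the denominator 1 + t^2, and the substitution u = x t then
    produces [gauss x] times [gaussF x]. *)
Definition gaussk (x t : R) : R := exp (- PI * x ^ 2 * (1 + t ^ 2)) / (1 + t ^ 2).

Lemma gauss_continuous x : continuous gauss x.
Proof. apply: ex_derive_continuous. rewrite /gauss. by auto_derive. Qed.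

Lemma gauss_ex_RInt a b : ex_RInt gauss a b.
Proof. apply: ex_RInt_continuous => x _. exact: gauss_continuous. Qed.

Lemma gaussF_derive x : is_derive gaussF x (gauss x).
Proof.
apply: is_derive_RInt; last exact: gauss_continuous.
apply: filter_forall => y. apply: RInt_correct. exact: gauss_ex_RInt.
Qed.

Lemma one_sqr_pos t : 0 < 1 + t ^ 2.
Proof. have := pow2_ge_0 t. lra. Qed.

Lemma gaussk_derive x t :
  is_derive (fun u => gaussk u t) x (- 2 * PI * x * exp (- PI * x ^ 2 * (1 + t ^ 2))).
Proof.
rewrite /gaussk. have H := one_sqr_pos t. auto_derive; first lra. cbn [pow] in H |- *. field. lra.
Qed.

Lemma gaussk_continuous x t : continuous (gaussk x) t.
Proof.
apply: ex_derive_continuous. rewrite /gaussk. have H := one_sqr_pos t. auto_derive. lra.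
Qed.

Lemma gaussk_RInt_derive x :
  is_derive (fun u => RInt (gaussk u) 0 1) x (- 2 * PI * gauss x * gaussF x).
Proof.
have -> : - 2 * PI * gauss x * gaussF x = RInt (fun t => Derive (fun u => gaussk u t) x) 0 1.
  rewrite (RInt_ext _ (fun t => scal (- 2 * PI * gauss x) (scal x (gauss (x * t + 0))))); last first.
    move=> t _. rewrite (is_derive_unique _ _ _ (gaussk_derive x t)) /scal /= /mult /= /gauss.
    have -> : exp (- PI * (x * (x * 1)) * (1 + t * (t * 1))) = exp (- PI * x ^ 2) * exp (- PI * (x * t + 0) ^ 2).
      rewrite -exp_plus. congr exp. ring.
    rewrite /=. ring.
  rewrite RInt_scal; last first.
    apply: ex_RInt_continuous => t _. apply: ex_derive_continuous. rewrite /scal /= /mult /= /gauss. by auto_derive.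
  rewrite RInt_comp_lin; last exact: gauss_ex_RInt.
  by rewrite /scal /= /mult /= /gaussF Rmult_0_r Rmult_1_r !Rplus_0_r.
apply: is_derive_RInt_param.
- apply: filter_forall => y t _. eexists. exact: gaussk_derive.
- move=> t _.
  apply: (continuity_2d_pt_ext (fun u v => - 2 * PI * u * exp (- PI * (u * u) * (1 + v * v)))).
    move=> u v. rewrite (is_derive_unique _ _ _ (gaussk_derive u v)). congr (_ * exp _). ring.
  apply: continuity_2d_pt_mult.
    apply: continuity_2d_pt_mult; [exact: continuity_2d_pt_const | exact: continuity_2d_pt_id1].
  apply: (continuity_1d_2d_pt_comp exp (fun u v => - PI * (u * u) * (1 + v * v))).
    apply: derivable_continuous_pt. exact: derivable_pt_exp.
  repeat first [exact: continuity_2d_pt_const | exact: continuity_2d_pt_id1 | exact: continuity_2d_pt_id2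
    | apply: continuity_2d_pt_mult | apply: continuity_2d_pt_plus].
- apply: filter_forall => y. apply: ex_RInt_continuous => t _. exact: gaussk_continuous.
Qed.

(* gaussF^2 + (1/pi) RInt gaussk has derivative zero. *)
Lemma gaussF_sqr x : 0 <= x -> gaussF x ^ 2 + RInt (gaussk x) 0 1 / PI = 1 / 4.
Proof.
have HP := PI_RGT_0.
have H0 : gaussF 0 ^ 2 + RInt (gaussk 0) 0 1 / PI = 1 / 4.
  have -> : gaussF 0 = 0 by exact: RInt_point.
  have -> : RInt (gaussk 0) 0 1 = PI / 4.
    rewrite -atan_1. have -> : atan 1 = minus (atan 1) (atan 0) by rewrite atan_0 /minus /= /plus /opp /=; ring.
    apply: is_RInt_unique. apply: (is_RInt_ext (fun t => / (1 + t ^ 2))).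
      move=> t _. rewrite /gaussk. have -> : - PI * 0 ^ 2 * (1 + t ^ 2) = 0 by ring. rewrite exp_0. 
      rewrite /Rdiv Rmult_1_l. by [].
    apply: is_RInt_derive.
      move=> t _. apply/is_derive_Reals. have := derivable_pt_lim_atan t. by rewrite /Rsqr /= Rmult_1_r.
    move=> t _. apply: ex_derive_continuous. have H := one_sqr_pos t. auto_derive. lra.
  field. lra.
case=> [Hx|<-] //. rewrite -{}H0. symmetry.
apply: (eq_is_derive (fun u => gaussF u ^ 2 + RInt (gaussk u) 0 1 / PI)) => // t _.
have D1 := gaussF_derive t. have D2 := gaussk_RInt_derive t.
have -> : @zero R_AbelianMonoid = plus (2 * gauss t * gaussF t) (- 2 * PI * gauss t * gaussF t * / PI).
  rewrite /plus /zero /=. field. lra.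
apply: is_derive_plus.
  have -> : 2 * gauss t * gaussF t = INR 2 * gauss t * gaussF t ^ 1 by rewrite /=; ring.
  exact: is_derive_pow.
exact: (is_derive_scal_l (fun u => RInt (gaussk u) 0 1) t _ (/ PI) D2).
Qed.

Lemma gaussk_RInt_bounds x : 0 <= RInt (gaussk x) 0 1 <= exp (- PI * x ^ 2) * (PI / 4).
Proof.
have ex y : ex_RInt (gaussk y) 0 1 by apply: ex_RInt_continuous => t _; exact: gaussk_continuous.
have HP := PI_RGT_0.
split.
  apply: RInt_ge_0; [lra | exact: ex | move=> t _].
  rewrite /gaussk. have H := one_sqr_pos t. apply: Rlt_le. apply: Rdiv_lt_0_compat => //. exact: exp_pos.
have E0 : RInt (gaussk 0) 0 1 = PI / 4.
  have := gaussF_sqr 0 (Rle_refl 0). have -> : gaussF 0 = 0 by exact: RInt_point. 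
  set I : R := RInt (gaussk 0) 0 1. move=> E. have -> : I = (0 ^ 2 + I / PI) * PI by field; lra.
  rewrite E. change (@eq R (1 / 4 * PI) (PI / 4)). field.
rewrite -E0.
have -> : exp (- PI * x ^ 2) * RInt (gaussk 0) 0 1 = RInt (fun t => scal (exp (- PI * x ^ 2)) (gaussk 0 t)) 0 1.
  symmetry. apply: (RInt_scal (gaussk 0) 0 1 (exp (- PI * x ^ 2))). exact: ex.
apply: RInt_le; [lra | exact: ex | | move=> t _].
  apply: ex_RInt_scal. exact: ex.
rewrite /scal /= /mult /= /gaussk. have H := one_sqr_pos t.
rewrite /Rdiv -Rmult_assoc. apply: Rmult_le_compat_r; first by left; apply: Rinv_0_lt_compat.
rewrite -exp_plus.
have K : 0 <= PI * x ^ 2 * t ^ 2 by apply: Rmult_le_pos; [apply: Rmult_le_pos; [lra | exact: pow2_ge_0] | exact: pow2_ge_0].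
have : - PI * x ^ 2 * (1 + t ^ 2) <= - PI * (x * (x * 1)) + - PI * 0 ^ 2 * (1 + t ^ 2) by lra.
case=> [K2|->]; [left; exact: exp_increasing | lra].
Qed.

(** With F = [gaussF x] and I the integral of [gaussk x] divided by pi, F^2 + I = 1/4 reads (1 -
    2F)(1 + 2F) = 4 I. As F >= 0, this gives 0 <= 1 - 2F <= 4 I, and 4 I <= exp(- pi x^2). *)
Lemma E_bounds x : 0 <= x -> 0 <= 1 - E x <= exp (- PI * x ^ 2).
Proof.
move=> Hx. have HP := PI_RGT_0. have [B1 B2] := gaussk_RInt_bounds x. have S := gaussF_sqr x Hx.
have HE : E x = 2 * gaussF x by [].
have HF : 0 <= gaussF x.
  apply: RInt_ge_0 => //; first exact: gauss_ex_RInt. move=> t _. left; exact: exp_pos.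
have C1 : 0 <= RInt (gaussk x) 0 1 / PI by apply: Rmult_le_pos => //; left; apply: Rinv_0_lt_compat.
have C2 : RInt (gaussk x) 0 1 / PI <= exp (- PI * x ^ 2) / 4.
  have -> : exp (- PI * x ^ 2) / 4 = exp (- PI * x ^ 2) * (PI / 4) * / PI by field; lra.
  apply: Rmult_le_compat_r => //. left; apply: Rinv_0_lt_compat; lra.
rewrite HE. set F := gaussF x in HF S *. set I := RInt _ _ _ / PI in S C1 C2.
have : F <= 1 / 2 by nra. nra.
Qed.

Lemma E_opp x : E (- x) = - E x.
Proof.
rewrite /E. have -> : RInt (fun t => exp (- PI * t ^ 2)) 0 (- x) = - gaussF x; last by rewrite /gaussF /gauss; ring.
have K := RInt_comp_lin gauss (-1) 0 0 x (gauss_ex_RInt _ _).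
have E1 : -1 * 0 + 0 = 0 by ring. have E2 : -1 * x + 0 = - x by ring. rewrite E1 E2 in K.
change (RInt gauss 0 (- x) = - gaussF x). rewrite -K RInt_scal.
  rewrite /scal /= /mult /= /gaussF -Ropp_mult_distr_l Rmult_1_l. congr (- _).
  apply: RInt_ext => t _. rewrite /gauss. congr exp. ring.
apply: ex_RInt_continuous => t _. apply: ex_derive_continuous. rewrite /gauss. by auto_derive.
Qed.

Open Scope C_scope.
Open Scope general_if_scope.

(** * Unconditional summation *)

Definition rsum {T : Type} (g : T -> R) (L : list T) : R :=
  fold_right (fun t s => (g t + s)%R) 0%R L.

Definition csum {T : Type} (f : T -> C) (L : list T) : C :=
  fold_right (fun t s => f t + s) 0 L.

(** Convergence along the net of finite subsets, represented by duplicate-free lists. It depends on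
    no enumeration, so Z, Z x Z and nat are treated alike. *)
Definition has_sum {T : Type} (f : T -> C) (S : C) : Prop :=
  forall eps : R, (0 < eps)%R -> exists L0, forall L, NoDup L -> incl L0 L ->
    (Cmod (csum f L - S) < eps)%R.

Definition absum {T : Type} (f : T -> C) : Prop :=
  exists M : R, forall L, NoDup L -> (rsum (fun t => Cmod (f t)) L <= M)%R.

(** A total function by choice; its value is meaningful only for families that have a sum. *)
Definition Sum {T : Type} (f : T -> C) : C := epsilon (inhabits (RtoC 0)) (has_sum f).

Definition dec_eq {T : Type} (x y : T) : {x = y} + {x <> y} :=
  excluded_middle_informative (x = y).

Lemma csum_app {T} (f : T -> C) L1 L2 : csum f (L1 ++ L2) = csum f L1 + csum f L2.
Proof. elim: L1 => [|a L1 IH] /=; [ring | rewrite IH; ring]. Qed.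

Lemma rsum_app {T} (g : T -> R) L1 L2 : rsum g (L1 ++ L2) = (rsum g L1 + rsum g L2)%R.
Proof. elim: L1 => [|a L1 IH] /=; [ring | rewrite IH; ring]. Qed.

Lemma csum_perm {T} (f : T -> C) L1 L2 : Permutation L1 L2 -> csum f L1 = csum f L2.
Proof.
move=> H; induction H as [|x l l' _ IH|x y l|l l' l'' _ IH1 _ IH2] => /=; rewrite ?IH ?IH1 ?IH2 //; ring.
Qed.

Lemma rsum_perm {T} (g : T -> R) L1 L2 : Permutation L1 L2 -> rsum g L1 = rsum g L2.
Proof.
move=> H; induction H as [|x l l' _ IH|x y l|l l' l'' _ IH1 _ IH2] => /=; rewrite ?IH ?IH1 ?IH2 //; ring.
Qed.

Lemma csum_map {A B} (f : B -> C) (phi : A -> B) L :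
  csum f (map phi L) = csum (fun a => f (phi a)) L.
Proof. by elim: L => //= a L ->. Qed.

Lemma rsum_map {A B} (g : B -> R) (phi : A -> B) L :
  rsum g (map phi L) = rsum (fun a => g (phi a)) L.
Proof. by elim: L => //= a L ->. Qed.

Lemma csum_ext {T} (f g : T -> C) L : (forall t, In t L -> f t = g t) -> csum f L = csum g L.
Proof.
elim: L => //= a L IH H. rewrite H; last by left. rewrite IH // => t Ht; apply: H; by right.
Qed.

Lemma csum_plus {T} (f g : T -> C) L : csum (fun t => f t + g t) L = csum f L + csum g L.
Proof. elim: L => [|a L IH] /=; [ring | rewrite IH; ring]. Qed.

Lemma csum_scal {T} (c : C) (f : T -> C) L : csum (fun t => c * f t) L = c * csum f L.
Proof. elim: L => [|a L IH] /=; [ring | rewrite IH; ring]. Qed.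

Lemma rsum_scal {T} (c : R) (f : T -> R) L : rsum (fun t => c * f t)%R L = (c * rsum f L)%R.
Proof. elim: L => [|a L IH] /=; [ring | rewrite IH; ring]. Qed.

Lemma rsum_plus {T} (f g : T -> R) L : rsum (fun t => f t + g t)%R L = (rsum f L + rsum g L)%R.
Proof. elim: L => [|a L IH] /=; [ring | rewrite IH; ring]. Qed.

Lemma rsum_le {T} (f g : T -> R) L : (forall t, f t <= g t)%R -> (rsum f L <= rsum g L)%R.
Proof. move=> H; elim: L => [|a L IH] /=; [lra | move: (H a); lra]. Qed.

Lemma rsum_ge0 {T} (g : T -> R) L : (forall t, 0 <= g t)%R -> (0 <= rsum g L)%R.
Proof. move=> H; elim: L => [|a L IH] /=; [lra | move: (H a); lra]. Qed.

Lemma Cmod_csum {T} (f : T -> C) L : (Cmod (csum f L) <= rsum (fun t => Cmod (f t)) L)%R.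
Proof.
elim: L => [|a L IH] /=; first by rewrite Cmod_0; lra.
apply: Rle_trans (Cmod_triangle _ _) _; lra.
Qed.

Lemma csum_RtoC {T} (g : T -> R) L : csum (fun t => RtoC (g t)) L = RtoC (rsum g L).
Proof. elim: L => //= a L ->. by rewrite RtoC_plus. Qed.

Lemma NoDup_incl_perm {T} (L0 L : list T) :
  NoDup L0 -> incl L0 L -> exists L1, Permutation L (L0 ++ L1).
Proof.
move=> H; revert L; induction H as [|a L0' Ha _ IH] => L Hi; first by exists L.
have [l1 [l2 El]] : exists l1 l2, L = l1 ++ a :: l2 by apply: in_split; apply: Hi; left.
have [|L1 HL1] := IH (l1 ++ l2).
  move=> x Hx. have : In x L by apply: Hi; right.
  rewrite El => Hx'. apply: in_or_app. case: (in_app_or _ _ _ Hx') => [|[E|]]; auto.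
  by subst x.
exists L1. rewrite El /=.
apply: Permutation_trans (Permutation_sym (Permutation_middle l1 l2 a)) _.
by apply: perm_skip.
Qed.

Lemma rsum_incl {T} (g : T -> R) L0 L : (forall t, 0 <= g t)%R ->
  NoDup L0 -> incl L0 L -> (rsum g L0 <= rsum g L)%R.
Proof.
move=> Hg H Hi. have [L1 P] := NoDup_incl_perm _ _ H Hi.
rewrite (rsum_perm _ _ _ P) rsum_app. move: (rsum_ge0 g L1 Hg); lra.
Qed.

Lemma incl_nodup_app_l {T} (L1 L2 : list T) : incl L1 (nodup dec_eq (L1 ++ L2)).
Proof. move=> x Hx. apply/nodup_In. apply: in_or_app; by left. Qed.

Lemma incl_nodup_app_r {T} (L1 L2 : list T) : incl L2 (nodup dec_eq (L1 ++ L2)).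
Proof. move=> x Hx. apply/nodup_In. apply: in_or_app; by right. Qed.

Lemma C_small_eq (x y : C) : (forall eps, 0 < eps -> Cmod (x - y) < eps)%R -> x = y.
Proof.
move=> H. have E : x - y = 0.
  apply: Cmod_eq_0. case: (Rle_lt_or_eq_dec _ _ (Cmod_ge_0 (x - y))) => // K.
  move: (H _ K); lra.
replace x with ((x - y) + y) by ring. rewrite E; ring.
Qed.

Lemma Cmod_sub_triangle (x y z : C) : (Cmod (x - z) <= Cmod (x - y) + Cmod (y - z))%R.
Proof. replace (x - z) with ((x - y) + (y - z)) by ring. exact: Cmod_triangle. Qed.

Lemma Cmod_sub_sym (x y : C) : Cmod (x - y) = Cmod (y - x).
Proof. rewrite -Cmod_opp; f_equal; ring. Qed.

Lemma has_sum_unique {T} (f : T -> C) S S' : has_sum f S -> has_sum f S' -> S = S'.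
Proof.
move=> H H'. apply: C_small_eq => eps He.
have [L0 H0] := H (eps / 2)%R ltac:(lra). have [L1 H1] := H' (eps / 2)%R ltac:(lra).
have K := H0 _ (NoDup_nodup dec_eq (L0 ++ L1)) (incl_nodup_app_l _ _).
have K' := H1 _ (NoDup_nodup dec_eq (L0 ++ L1)) (incl_nodup_app_r _ _).
move: (Cmod_sub_triangle S (csum f (nodup dec_eq (L0 ++ L1))) S').
rewrite (Cmod_sub_sym S (csum _ _)); lra.
Qed.

Lemma Sum_unique {T} (f : T -> C) S : has_sum f S -> Sum f = S.
Proof.
move=> H. apply: (has_sum_unique f) => //. apply: epsilon_spec. by exists S.
Qed.

Lemma has_sum_ext {T} (f g : T -> C) S : (forall t, f t = g t) -> has_sum f S -> has_sum g S.
Proof.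
move=> E H eps He. have [L0 H0] := H eps He. exists L0 => L HL HI.
rewrite -(csum_ext f) //. by apply: H0.
Qed.

Lemma Sum_ext {T} (f g : T -> C) : (forall t, f t = g t) -> Sum f = Sum g.
Proof.
move=> E. by have -> : f = g by apply: FunctionalExtensionality.functional_extensionality.
Qed.

Lemma has_sum_plus {T} (f g : T -> C) S S' :
  has_sum f S -> has_sum g S' -> has_sum (fun t => f t + g t) (S + S').
Proof.
move=> H H' eps He.
have [L0 H0] := H (eps / 2)%R ltac:(lra). have [L1 H1] := H' (eps / 2)%R ltac:(lra).
exists (L0 ++ L1) => L HL /incl_app_inv [I1 I2]. rewrite csum_plus.
replace (csum f L + csum g L - (S + S')) with ((csum f L - S) + (csum g L - S')) by ring.
apply: Rle_lt_trans (Cmod_triangle _ _) _.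
move: (H0 _ HL I1) (H1 _ HL I2); lra.
Qed.

Lemma has_sum_scal {T} (c : C) (f : T -> C) S : has_sum f S -> has_sum (fun t => c * f t) (c * S).
Proof.
move=> H eps He. have Hc := Cmod_ge_0 c.
have [L0 H0] := H (eps / (Cmod c + 1))%R ltac:(apply: Rdiv_lt_0_compat; lra).
exists L0 => L HL HI. rewrite csum_scal.
replace (c * csum f L - c * S) with (c * (csum f L - S)) by ring.
rewrite Cmod_mult. move: (H0 _ HL HI) => K.
have K2 := Cmod_ge_0 (csum f L - S).
apply: (Rle_lt_trans _ ((Cmod c) * (eps / (Cmod c + 1)))); first by apply: Rmult_le_compat_l; lra.
apply: (Rlt_le_trans _ ((Cmod c + 1) * (eps / (Cmod c + 1)))); last by right; field; lra.
apply: Rmult_lt_compat_r; last lra. apply: Rdiv_lt_0_compat; lra.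
Qed.

(** A list is cut down to its part in the image of [phi]; the discarded terms vanish by the second
    hypothesis, so injectivity suffices for a reindexing. *)
Lemma preimage_list {A B} (phi : A -> B) (f : B -> C) :
  (forall x y, phi x = phi y -> x = y) ->
  (forall b, (forall a, phi a <> b) -> f b = 0) ->
  forall L, NoDup L -> exists LA, NoDup LA /\ csum f L = csum (fun a => f (phi a)) LA /\
    forall a, In a LA <-> In (phi a) L.
Proof.
move=> inj H0 L H; induction H as [|b L' Hb _ [LA [N [E I]]]].
  exists nil; split; first by constructor. by split.
case: (classic (exists a, phi a = b)) => [[a Ea]|Hn].
- exists (a :: LA); split.
    constructor => //. rewrite I Ea. by [].
  split; first by rewrite /= E Ea.
  move=> a' /=. rewrite I -Ea. split=> [[->|]|[/inj|]]; auto.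
- exists LA; split=> //; split.
    rewrite /= -E H0; first ring. move=> a Ea; apply: Hn; by exists a.
  move=> a /=. rewrite I. split; auto => -[E2|] //. case: Hn. by exists a.
Qed.

Lemma has_sum_inj {A B} (phi : A -> B) (f : B -> C) S :
  (forall x y, phi x = phi y -> x = y) ->
  (forall b, (forall a, phi a <> b) -> f b = 0) ->
  has_sum (fun a => f (phi a)) S -> has_sum f S.
Proof.
move=> inj H0 H eps He. have [L0 HL0] := H eps He.
exists (map phi L0) => L N I. have [LA [NA [-> IA]]] := preimage_list phi f inj H0 L N.
apply: HL0 => // a Ha. rewrite IA. apply: I. by apply: in_map.
Qed.

Lemma absum_inj {A B} (phi : A -> B) (f : B -> C) :
  (forall x y, phi x = phi y -> x = y) -> absum f -> absum (fun a => f (phi a)).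
Proof.
move=> inj [M HM]. exists M => L N.
rewrite -(rsum_map (fun b => Cmod (f b)) phi). apply: HM.
by apply: FinFun.Injective_map_NoDup => // x y; apply: inj.
Qed.

Lemma absum_dom {T} (f : T -> C) (g : T -> R) (K : R) :
  (0 <= K)%R -> (exists M, forall L, NoDup L -> rsum g L <= M)%R ->
  (forall t, Cmod (f t) <= K * g t)%R -> absum f.
Proof.
move=> HK [M HM] H. exists (K * M)%R => L N.
apply: Rle_trans (rsum_le _ _ L H) _. rewrite rsum_scal. apply: Rmult_le_compat_l => //. exact: HM.
Qed.

Lemma absum_le {T} (f g : T -> C) (K : R) :
  (0 <= K)%R -> absum g -> (forall t, Cmod (f t) <= K * Cmod (g t))%R -> absum f.
Proof. move=> HK Hg H. by apply: (absum_dom f (fun t => Cmod (g t)) K). Qed.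

Lemma absum_ext {T} (f g : T -> C) : (forall t, f t = g t) -> absum f -> absum g.
Proof. move=> E H. apply: (absum_le g f 1) => // [|t]; [lra | rewrite E; lra]. Qed.

Lemma absum_plus {T} (f g : T -> C) : absum f -> absum g -> absum (fun t => f t + g t).
Proof.
move=> [M HM] [M' HM']. exists (M + M')%R => L N.
apply: Rle_trans (rsum_le _ (fun t => Cmod (f t) + Cmod (g t))%R L _) _.
  move=> t; exact: Cmod_triangle.
rewrite rsum_plus. move: (HM _ N) (HM' _ N); lra.
Qed.

Lemma absum_scal {T} (c : C) (f : T -> C) : absum f -> absum (fun t => c * f t).
Proof.
move=> H. apply: (absum_le _ f (Cmod c)) => // [|t]; first exact: Cmod_ge_0.
rewrite Cmod_mult; lra.
Qed.

(** The value is the supremum of the finite sums: by monotonicity every list containing a nearly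
    optimal one is within eps of it. *)
Lemma has_sum_nonneg {T} (g : T -> R) :
  (forall t, 0 <= g t)%R -> (exists M, forall L, NoDup L -> rsum g L <= M)%R ->
  exists S, has_sum (fun t => RtoC (g t)) S.
Proof.
move=> Hg [M HM].
set P := fun x => exists L, NoDup L /\ x = rsum g L.
have [||s [Hub Hlub]] := completeness P.
- exists M => x [L [N ->]]. exact: HM.
- exists 0%R. exists nil. split => //. by constructor.
exists (RtoC s) => eps He.
have [L0 [N0 H0]] : exists L, NoDup L /\ (s - eps < rsum g L)%R.
  apply: NNPP => Hn. have: (s <= s - eps)%R.
    apply: Hlub => x [L [N ->]]. case: (Rle_lt_dec (rsum g L) (s - eps)) => // K.
    case: Hn. by exists L.
  lra.
exists L0 => L N I. rewrite csum_RtoC -RtoC_minus Cmod_R.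
have := rsum_incl g L0 L Hg N0 I. have : (rsum g L <= s)%R by apply: Hub; exists L.
move=> K1 K2. apply: Rabs_def1; lra.
Qed.

(* Real and imaginary parts are differences of the nonnegative families
   [|f| + Re f] and [|f|], [|f| + Im f] and [|f|]. *)
Lemma absum_has_sum {T} (f : T -> C) : absum f -> exists S, has_sum f S.
Proof.
move=> [M HM].
have B t : (Rabs (Re (f t)) <= Cmod (f t) /\ Rabs (Im (f t)) <= Cmod (f t))%R.
  move: (Rmax_Cmod (f t)) => /= K. split; apply: Rle_trans K; [exact: Rmax_l|exact: Rmax_r].
have [||S0 H0] := has_sum_nonneg (fun t => Cmod (f t)).
- move=> t; exact: Cmod_ge_0.
- by exists M.
have aux (r : T -> R) : (forall t, Rabs (r t) <= Cmod (f t))%R ->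
    exists S, has_sum (fun t => RtoC (Cmod (f t) + r t)%R) S.
  move=> Hr. apply: has_sum_nonneg => [t|].
    move: (Hr t). rewrite -Rabs_Ropp. move: (Rle_abs (- r t)); lra.
  exists (2 * M)%R => L N. apply: Rle_trans (rsum_le _ (fun t => 2 * Cmod (f t))%R L _) _.
    move=> t. move: (Hr t) (Rle_abs (r t)); lra.
  rewrite rsum_scal. move: (HM _ N); lra.
have [S1 H1] := aux _ (fun t => proj1 (B t)).
have [S2 H2] := aux _ (fun t => proj2 (B t)).
exists (S1 + (-1) * S0 + Ci * (S2 + (-1) * S0)).
apply: has_sum_ext (has_sum_plus _ _ _ _ (has_sum_plus _ _ _ _ H1 (has_sum_scal (-1) _ _ H0))
  (has_sum_scal Ci _ _ (has_sum_plus _ _ _ _ H2 (has_sum_scal (-1) _ _ H0)))) => t.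
rewrite !RtoC_plus /=. case: (f t) => x y. rewrite /Re /Im /=.
apply: injective_projections => /=; ring.
Qed.

Lemma Sum_has {T} (f : T -> C) : absum f -> has_sum f (Sum f).
Proof. move=> /absum_has_sum H. exact: epsilon_spec. Qed.

Lemma Sum_plus {T} (f g : T -> C) : absum f -> absum g ->
  Sum (fun t => f t + g t) = Sum f + Sum g.
Proof. move=> Hf Hg. apply: Sum_unique. by apply: has_sum_plus; apply: Sum_has. Qed.

Lemma Sum_scal {T} (c : C) (f : T -> C) : absum f -> Sum (fun t => c * f t) = c * Sum f.
Proof. move=> Hf. apply: Sum_unique. by apply: has_sum_scal; apply: Sum_has. Qed.

Lemma Sum_inj {A B} (phi : A -> B) (f : B -> C) :
  absum f -> (forall x y, phi x = phi y -> x = y) ->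
  (forall b, (forall a, phi a <> b) -> f b = 0) ->
  Sum f = Sum (fun a => f (phi a)).
Proof.
move=> H inj H0. apply: Sum_unique. apply: (has_sum_inj phi) => //.
apply: Sum_has. by apply: absum_inj.
Qed.

Lemma Sum_reindex {A B} (phi : A -> B) (psi : B -> A) (f : B -> C) :
  absum f -> (forall a, psi (phi a) = a) -> (forall b, phi (psi b) = b) ->
  Sum f = Sum (fun a => f (phi a)).
Proof.
move=> H K1 K2. apply: Sum_inj => // [x y E|b Hb]; first by rewrite -(K1 x) -(K1 y) E.
by case: (Hb (psi b)).
Qed.

Lemma Sum_finsupp {T} (f : T -> C) L : NoDup L -> (forall t, ~ In t L -> f t = 0) ->
  Sum f = csum f L.
Proof.
move=> N H. apply: Sum_unique => eps He. exists L => L' N' I.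
have [L1 P] := NoDup_incl_perm _ _ N I.
rewrite (csum_perm _ _ _ P) csum_app.
have -> : csum f L1 = 0.
  have N2 := Permutation_NoDup P N'.
  have : forall t, In t L1 -> f t = 0.
    move=> t Ht. apply: H => Ht2.
    have [l1 [l2 E]] := in_split _ _ Ht. rewrite E app_assoc in N2.
    move: (NoDup_remove_2 _ _ _ N2) => K. apply: K. apply/in_or_app; left. apply/in_or_app; by left.
  elim: L1 {P N2} => //= a l IH Hl. rewrite IH; last by move=> t Ht; apply: Hl; right.
  rewrite Hl; last by left. ring.
replace (csum f L + 0 - csum f L) with (RtoC 0) by ring. by rewrite Cmod_0.
Qed.

Lemma Cmod_Sum_le {T} (f : T -> C) M :
  absum f -> (forall L, NoDup L -> rsum (fun t => Cmod (f t)) L <= M)%R -> (Cmod (Sum f) <= M)%R.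
Proof.
move=> H HM. apply: Rnot_lt_le => K.
have [L0 HL] := Sum_has f H (Cmod (Sum f) - M)%R ltac:(lra).
have I : incl L0 (nodup dec_eq L0) by move=> x; rewrite nodup_In.
have N := NoDup_nodup dec_eq L0. move: (HL _ N I) (HM _ N) (Cmod_csum f (nodup dec_eq L0)).
set c := csum _ _. move=> K1 K2 K3.
move: (Cmod_triangle (Sum f - c) c). rewrite Cmod_sub_sym.
replace (Sum f - c + c) with (Sum f) by ring. lra.
Qed.

Lemma fibre_lists {A B} (f : A * B -> C) (g : A -> C) (LB : list B) eps :
  (0 < eps)%R -> (forall a, has_sum (fun b => f (a, b)) (g a)) -> forall LA, NoDup LA ->
  exists P, NoDup P /\ (forall p, In p P -> In (fst p) LA) /\
    (forall a b, In a LA -> In b LB -> In (a, b) P) /\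
    (Cmod (csum f P - csum g LA) <= INR (length LA) * eps)%R /\
    (rsum (fun a => Cmod (g a)) LA <= rsum (fun p => Cmod (f p)) P + INR (length LA) * eps)%R.
Proof.
move=> He H LA HN; induction HN as [|a LA' Ha N [P [NP [P1 [P2 [P3 P4]]]]]].
  exists nil. split; first by constructor. split => //. split=> //=.
  rewrite !Rmult_0_l. split; last lra. replace (0 - 0) with (RtoC 0) by ring. rewrite Cmod_0; lra.
have [L0 HL0] := H a eps He.
set L := nodup dec_eq (L0 ++ LB).
have NL : NoDup L by apply: NoDup_nodup.
have K := HL0 L NL (incl_nodup_app_l _ _).
exists (map (pair a) L ++ P). split.
  apply: NoDup_app => //.
    apply: FinFun.Injective_map_NoDup => // x y E. by case: E.
  move=> p Hp Hp2. have [b [E _]] := proj1 (in_map_iff _ _ _) Hp. subst p. by apply: Ha (P1 _ Hp2).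
split.
  move=> p Hp. case: (in_app_or _ _ _ Hp) => [Hp1|/P1]; last by right.
  have [b [<- _]] := proj1 (in_map_iff _ _ _) Hp1. by left.
split.
  move=> a' b [<-|Ia] Ib; apply: in_or_app; [left | right; exact: P2].
  apply: in_map. by apply: incl_nodup_app_r.
have E : (INR (length (a :: LA')) = INR (length LA') + 1)%R by rewrite [length _]/= S_INR.
rewrite E csum_app rsum_app csum_map rsum_map /=.
split.
  replace (csum (fun b => f (a, b)) L + csum f P - (g a + csum g LA')) with
   ((csum (fun b => f (a, b)) L - g a) + (csum f P - csum g LA')) by ring.
  apply: Rle_trans (Cmod_triangle _ _) _. lra.
have := Cmod_csum (fun b => f (a, b)) L.
set c := csum _ _ in K *. move=> K2.
move: (Cmod_triangle (g a - c) c). rewrite Cmod_sub_sym.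
replace (g a - c + c) with (g a) by ring. lra.
Qed.

Lemma small_div n eps : (0 < eps)%R -> (0 < eps / (INR n + 1) /\ INR n * (eps / (INR n + 1)) < eps)%R.
Proof.
move=> He. have Hn := pos_INR n. have K : (0 < eps / (INR n + 1))%R by apply: Rdiv_lt_0_compat; lra.
split=> //. have E : ((INR n + 1) * (eps / (INR n + 1)) = eps)%R by field; lra. lra.
Qed.

Lemma has_sum_fubini {A B} (f : A * B -> C) (g : A -> C) S :
  has_sum f S -> (forall a, has_sum (fun b => f (a, b)) (g a)) -> has_sum g S.
Proof.
move=> HS H eps He. have [L0 HL0] := HS (eps / 2)%R ltac:(lra).
exists (map fst L0) => LA N I.
have [E1 E2] := small_div (length LA) (eps / 2)%R ltac:(lra).
have [P [NP [P1 [P2 [P3 _]]]]] := fibre_lists f g (map snd L0) _ E1 H LA N.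
have I2 : incl L0 P.
  move=> [a b] Hp. apply: P2; first (apply: I); by apply: (in_map _ _ (a, b)).
move: (HL0 P NP I2) => K. move: (Cmod_sub_triangle (csum g LA) (csum f P) S).
rewrite (Cmod_sub_sym (csum g LA) (csum f P)); lra.
Qed.

Lemma absum_fibre {A B} (f : A * B -> C) : absum f -> forall a, absum (fun b => f (a, b)).
Proof. move=> H a. apply: (absum_inj (pair a) f) => // x y E. by case: E. Qed.

(** If a finite sum of moduli of fibre totals exceeded [M], the excess could be spread over the
    fibres as approximation error, and [fibre_lists] would give a finite list of pairs whose moduli
    sum to more than [M]. *)
Lemma absum_fibre_Sum {A B} (f : A * B -> C) : absum f -> absum (fun a => Sum (fun b => f (a, b))).
Proof.
move=> H. have [M HM] := H. exists M => L N. apply: Rnot_lt_le => K.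
pose g a := Sum (fun b => f (a, b)).
change (M < rsum (fun t => Cmod (g t)) L)%R in K.
have [E1 E2] := small_div (length L) (rsum (fun t => Cmod (g t)) L - M)%R ltac:(lra).
have [P [NP [P1 [P2 [_ P4]]]]] := fibre_lists f g nil _ E1 (fun a => Sum_has _ (absum_fibre f H a)) L N.
move: (HM P NP); change (rsum (fun t => Cmod (g t)) L <= rsum (fun p => Cmod (f p)) P +
  INR (length L) * ((rsum (fun t => Cmod (g t)) L - M) / (INR (length L) + 1)))%R in P4; lra.
Qed.

Lemma Sum_fubini {A B} (f : A * B -> C) : absum f ->
  Sum f = Sum (fun a => Sum (fun b => f (a, b))).
Proof.
move=> H. symmetry. apply: Sum_unique. apply: (has_sum_fubini f); first exact: Sum_has.
move=> a. apply: Sum_has. exact: absum_fibre.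
Qed.

(** A finite set of pairs lies in the product of its two projections, over which the sum of moduli
    factors. *)
Lemma absum_prod {A B} (f : A -> C) (g : B -> C) : absum f -> absum g ->
  absum (fun p => f (fst p) * g (snd p)).
Proof.
move=> [M HM] [M' HM']. exists (M * M')%R => L N.
set LA := nodup dec_eq (map fst L). set LB := nodup dec_eq (map snd L).
have I : incl L (list_prod LA LB).
  move=> [a b] Hp. apply: in_prod; apply/nodup_In.
    by apply: (in_map fst _ (a, b)). by apply: (in_map snd _ (a, b)).
apply: Rle_trans (rsum_incl _ _ _ _ N I) _; first by move=> t; apply: Cmod_ge_0.
have -> : rsum (fun p => Cmod (f (fst p) * g (snd p))) (list_prod LA LB) =
   (rsum (fun a => Cmod (f a)) LA * rsum (fun b => Cmod (g b)) LB)%R.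
  elim: LA {I} => [|a LA IH] /=; first ring.
  rewrite rsum_app IH rsum_map /= Rmult_plus_distr_r. congr Rplus.
  rewrite -rsum_scal. congr (fold_right _ _ _). apply: FunctionalExtensionality.functional_extensionality => b.
  by rewrite Cmod_mult.
apply: Rmult_le_compat; try by apply: rsum_ge0 => t; apply: Cmod_ge_0.
  by apply: HM; apply: NoDup_nodup. by apply: HM'; apply: NoDup_nodup.
Qed.

Lemma Sum_prod {A B} (f : A -> C) (g : B -> C) : absum f -> absum g ->
  Sum f * Sum g = Sum (fun p => f (fst p) * g (snd p)).
Proof.
move=> Hf Hg. rewrite Sum_fubini; last exact: absum_prod. symmetry.
rewrite (Sum_ext _ (fun a => Sum g * f a)); last first.
  move=> a /=. rewrite Sum_scal //; ring.
rewrite Sum_scal //; ring.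
Qed.

(** Tannery's theorem. One finite list carries almost all of the dominating family, so the tails are
    small for all N at once and only finitely many pointwise limits remain. *)
Lemma Sum_tannery {T} (F : nat -> T -> C) (f : T -> C) (g : T -> R) :
  (exists M, forall L, NoDup L -> rsum g L <= M)%R ->
  (forall N t, Cmod (F N t) <= g t)%R ->
  (forall t eps, 0 < eps -> exists N0, forall N, (N0 <= N)%nat -> Cmod (F N t - f t) < eps)%R ->
  absum f /\
  forall eps, (0 < eps)%R -> exists N0, forall N, (N0 <= N)%nat -> (Cmod (Sum (F N) - Sum f) < eps)%R.
Proof.
move=> Hg HF Hf.
have Hg0 t : (0 <= g t)%R by apply: Rle_trans (HF 0%nat t); apply: Cmod_ge_0.
have Bf t : (Cmod (f t) <= g t)%R.
  apply: Rnot_lt_le => K. have [N0 H0] := Hf t (Cmod (f t) - g t)%R ltac:(lra).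
  move: (H0 N0 (le_n _)) (HF N0 t) (Cmod_triangle (f t - F N0 t) (F N0 t)).
  rewrite (Cmod_sub_sym (f t) (F N0 t)). replace (f t - F N0 t + F N0 t) with (f t) by ring. lra.
have Af : absum f by apply: (absum_dom _ g 1) => // [|t]; [lra | move: (Bf t); lra].
have AF N : absum (F N) by apply: (absum_dom _ g 1) => // [|t]; [lra | move: (HF N t); lra].
split=> // eps He.
have [S HS] := has_sum_nonneg g Hg0 Hg.
have [L0 HL0] := HS (eps / 10)%R ltac:(lra).
set L := nodup dec_eq L0.
have N : NoDup L by apply: NoDup_nodup.
have I : incl L0 L by move=> x; rewrite nodup_In.
(* [L] and any larger list both have g-sums within eps / 10 of the total, so g contributes less than
   eps / 5 between them; this holds for every [h] dominated by g. *)
have tail (h : T -> C) : absum h -> (forall t, Cmod (h t) <= g t)%R ->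
    (Cmod (Sum h - csum h L) <= eps / 5)%R.
  move=> Ah Hh. apply: Rnot_lt_le => K.
  have [L1 HL1] := Sum_has h Ah (Cmod (Sum h - csum h L) - eps / 5)%R ltac:(lra).
  set L2 := nodup dec_eq (L ++ L1).
  have N2 : NoDup L2 by apply: NoDup_nodup.
  have IL : incl L L2 by apply: incl_nodup_app_l.
  have K1 := HL1 L2 N2 (incl_nodup_app_r _ _).
  have [L3 P] := NoDup_incl_perm _ _ N IL.
  have Q1 := HL0 _ N I. have Q2 := HL0 _ N2 (incl_tran I IL).
  have Q3 : (rsum g L3 < eps / 5)%R.
    have : RtoC (rsum g L3) = (csum (fun t => RtoC (g t)) L2 - S) + (S - csum (fun t => RtoC (g t)) L).
      rewrite (csum_perm _ _ _ P) csum_app !csum_RtoC; ring.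
    move=> E. apply: Rle_lt_trans (Rle_abs _) _. rewrite -Cmod_R E.
    apply: Rle_lt_trans (Cmod_triangle _ _) _. rewrite (Cmod_sub_sym S (csum _ _)); lra.
  have Q4 : (Cmod (csum h L3) <= rsum g L3)%R.
    apply: Rle_trans (Cmod_csum _ _) _. by apply: rsum_le.
  move: (Cmod_sub_triangle (Sum h) (csum h L2) (csum h L)).
  rewrite (csum_perm _ _ _ P) csum_app (Cmod_sub_sym (Sum h) (_ + _)).
  replace (csum h L + csum h L3 - csum h L) with (csum h L3) by ring.
  rewrite (csum_perm _ _ _ P) csum_app in K1. lra.
have [N0 HN0] : exists N0, forall N, (N0 <= N)%nat -> (Cmod (csum (F N) L - csum f L) < eps / 5)%R.
  have [E1 E2] := small_div (length L) (eps / 5)%R ltac:(lra).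
  set d := (eps / 5 / _)%R in E1 E2.
  have : exists N0, forall N, (N0 <= N)%nat -> (Cmod (csum (F N) L - csum f L) <= INR (length L) * d)%R.
    elim: (L) => [|t l [N0 IH]].
      exists 0%nat => k _ /=. replace (0 - 0) with (RtoC 0) by ring. rewrite Cmod_0; lra.
    have [N1 H1] := Hf t d E1. exists (N0 + N1)%nat => k Hk.
    have E : (INR (length (t :: l)) = INR (length l) + 1)%R by rewrite [length _]/= S_INR.
    rewrite E /=.
    replace (F k t + csum (F k) l - (f t + csum f l)) with
      ((F k t - f t) + (csum (F k) l - csum f l)) by ring.
    apply: Rle_trans (Cmod_triangle _ _) _.
    move: (IH k ltac:(lia)) (H1 k ltac:(lia)); lra.
  move=> [N0 H0]. exists N0 => k Hk. move: (H0 k Hk); lra.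
exists N0 => k Hk. move: (tail _ (AF k) (HF k)) (tail _ Af Bf) (HN0 k Hk).
move: (Cmod_sub_triangle (Sum (F k)) (csum (F k) L) (Sum f)).
move: (Cmod_sub_triangle (csum (F k) L) (csum f L) (Sum f)).
rewrite (Cmod_sub_sym (csum f L) (Sum f)). lra.
Qed.

(** * Sums over the integers *)

Lemma Sum_split {A1 A2 B} (phi1 : A1 -> B) (phi2 : A2 -> B) (f : B -> C) :
  absum f ->
  (forall x y, phi1 x = phi1 y -> x = y) -> (forall x y, phi2 x = phi2 y -> x = y) ->
  (forall x y, phi1 x <> phi2 y) -> (forall b, (exists a, phi1 a = b) \/ (exists a, phi2 a = b)) ->
  Sum f = Sum (fun a => f (phi1 a)) + Sum (fun a => f (phi2 a)).
Proof.
move=> H i1 i2 dis cov.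
pose f1 b := if excluded_middle_informative (exists a, phi1 a = b) then f b else 0.
pose f2 b := if excluded_middle_informative (exists a, phi1 a = b) then RtoC 0 else f b.
have H1 : absum f1.
  apply: (absum_le _ f 1) => // [|b]; first lra. rewrite /f1.
  case: excluded_middle_informative => _; rewrite ?Cmod_0; move: (Cmod_ge_0 (f b)); lra.
have H2 : absum f2.
  apply: (absum_le _ f 1) => // [|b]; first lra. rewrite /f2.
  case: excluded_middle_informative => _; rewrite ?Cmod_0; move: (Cmod_ge_0 (f b)); lra.
rewrite (Sum_ext f (fun b => f1 b + f2 b)); last first.
  move=> b; rewrite /f1 /f2. case: excluded_middle_informative => _; ring.
rewrite Sum_plus // (Sum_inj phi1 f1) // 1?(Sum_inj phi2 f2) //.
- congr (_ + _); apply: Sum_ext => a; rewrite /f1 /f2; case: excluded_middle_informative => //.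
  + move=> K; case: K; by exists a.
  + move=> [b E]; by case: (dis b a).
- move=> b Hb. rewrite /f2; case: excluded_middle_informative => // K.
  case: (cov b) => // [[a E]]; by case: (Hb a).
- move=> b Hb. rewrite /f1; case: excluded_middle_informative => // [[a E]].
  by case: (Hb a).
Qed.

(** Initial segments eventually contain any given finite list, so the real and imaginary [Series]
    converge to the parts of the unconditional sum. *)
Lemma CSeries_Sum (a : nat -> C) : absum a -> CSeries a = Sum a.
Proof.
move=> H. have HS := Sum_has a H.
have key eps : (0 < eps)%R -> exists N0, forall N, (N0 <= N)%nat ->
    (Cmod (csum a (seq 0 (S N)) - Sum a) < eps)%R.
  move=> He. have [L0 HL0] := HS eps He. exists (list_max L0) => N HN.
  apply: HL0; first exact: seq_NoDup.
  move=> x Hx. apply/in_seq. split; first lia.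
  have := proj1 (list_max_le L0 (list_max L0)) (le_n _).
  move/(proj1 (Forall_forall _ _)) => K. move: (K x Hx); lia.
have E : forall N, sum_n (fun n => Re (a n)) N = Re (csum a (seq 0 (S N))) /\
  sum_n (fun n => Im (a n)) N = Im (csum a (seq 0 (S N))).
  elim=> [|N [IH1 IH2]].
    rewrite !sum_O /=. split; symmetry; exact: Rplus_0_r.
  rewrite !sum_Sn IH1 IH2 (seq_S (S N)) csum_app. split; congr Rplus; symmetry; exact: Rplus_0_r.
rewrite /CSeries. have -> : Sum a = (Re (Sum a), Im (Sum a)) by case: (Sum a).
congr pair; apply: is_series_unique.
- change (is_lim_seq (sum_n (fun n => Re (a n))) (Re (Sum a))). apply/is_lim_seq_spec => eps.
  have [N0 HN0] := key eps (cond_pos eps); exists N0 => N HN; move: (HN0 N HN).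
  rewrite (proj1 (E N)) => K. apply: Rle_lt_trans K.
  apply: Rle_trans (re_le_Cmod _). right; congr Rabs.
- change (is_lim_seq (sum_n (fun n => Im (a n))) (Im (Sum a))). apply/is_lim_seq_spec => eps.
  have [N0 HN0] := key eps (cond_pos eps); exists N0 => N HN; move: (HN0 N HN).
  rewrite (proj2 (E N)) => K. apply: Rle_lt_trans K.
  apply: Rle_trans (Rmax_Cmod _). apply: Rle_trans (Rmax_r _ _). right; congr Rabs.
Qed.

Lemma ZSeries_Sum (f : Z -> C) : absum f -> ZSeries f = Sum f.
Proof.
move=> H. rewrite /ZSeries.
rewrite (Sum_split (fun n => Z.of_nat n) (fun n => (- Z.of_nat n - 1)%Z) f) //; try lia.
- rewrite !CSeries_Sum //.
    apply: (absum_inj (fun n => (- Z.of_nat n - 1)%Z) f) => //; lia.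
  apply: (absum_inj (fun n => Z.of_nat n) f) => //; lia.
- move=> b. case: (Z_lt_le_dec b 0) => K; [right; exists (Z.to_nat (- b - 1)) | left; exists (Z.to_nat b)]; lia.
Qed.

Lemma ZSeries_ext (f g : Z -> C) : (forall n, f n = g n) -> ZSeries f = ZSeries g.
Proof.
move=> E. by have -> : f = g by apply: FunctionalExtensionality.functional_extensionality.
Qed.

Fixpoint zint (N : nat) : list Z :=
  match N with
  | O => 0%Z :: (-1)%Z :: nil
  | S M => Z.of_nat N :: (- Z.of_nat N - 1)%Z :: zint M
  end.

Lemma in_zint N n : (- Z.of_nat N - 1 <= n <= Z.of_nat N)%Z -> In n (zint N).
Proof.
elim: N => [|N IH] H; first by simpl in *; lia.
change (zint (S N)) with (Z.of_nat (S N) :: (- Z.of_nat (S N) - 1)%Z :: zint N).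
case: (Z.eq_dec n (Z.of_nat (S N))) => [->|K]; first by left.
case: (Z.eq_dec n (- Z.of_nat (S N) - 1)) => [->|K2]; first by right; left.
right; right. apply: IH; lia.
Qed.

Lemma summable_half_pow :
  exists M, forall L, NoDup L -> (rsum (fun n => (/ 2) ^ Z.abs_nat n) L <= M)%R.
Proof.
exists 3%R => L N.
have [K HK] : exists K, forall n, In n L -> (- Z.of_nat K - 1 <= n <= Z.of_nat K)%Z.
  elim: L {N} => [|x L [K HK]]; first by exists 0%nat.
  exists (K + Z.abs_nat x)%nat => n [<-|/HK]; lia.
have I : incl L (zint K) by move=> n /HK; apply: in_zint.
apply: Rle_trans (rsum_incl _ _ _ _ N I) _ => [t|]; first by apply: pow_le; lra.
(* The exact value of the sum over [zint K]: each step adds (1/2)^(K+1) + (1/2)^(K+2) = (3/4)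
   (1/2)^K. *)
apply: (Rle_trans _ (3 - 3 / 2 * (/ 2) ^ K)).
  elim: K {HK I} => [|K IH]; first by rewrite /= ; lra.
  change (zint (S K)) with (Z.of_nat (S K) :: (- Z.of_nat (S K) - 1)%Z :: zint K).
  cbn [rsum fold_right]. change (fold_right _ _ _) with (rsum (fun n => (/ 2) ^ Z.abs_nat n)%R (zint K)).
  have -> : Z.abs_nat (Z.of_nat (S K)) = S K by lia.
  have -> : Z.abs_nat (- Z.of_nat (S K) - 1) = S (S K) by lia.
  simpl pow. lra.
have : (0 < (/ 2) ^ K)%R by apply: pow_lt; lra. lra.
Qed.

Lemma exp_m_abs_le (n : Z) : (exp (- Rabs (IZR n)) <= (/ 2) ^ Z.abs_nat n)%R.
Proof.
have -> : Rabs (IZR n) = INR (Z.abs_nat n) by rewrite INR_IZR_INZ -abs_IZR; f_equal; lia.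
elim: (Z.abs_nat n) => [|k IH]; first by rewrite /= Ropp_0 exp_0; lra.
rewrite S_INR Ropp_plus_distr exp_plus /= Rmult_comm.
apply: Rmult_le_compat => //; try (left; apply: exp_pos).
rewrite exp_Ropp. apply: Rinv_le_contravar; first lra. move: (exp_ineq1 1); lra.
Qed.

Lemma exp_le_compat (x y : R) : (x <= y)%R -> (exp x <= exp y)%R.
Proof. case=> [K|->]; [left; exact: exp_increasing | lra]. Qed.

(** The linear weight is at most exp |n|, and a further exp |n| is spent to keep a geometric factor.
    The weight is allowed for the sake of Jacobi's series with coefficients 2n + 1. *)
Lemma absum_gauss (f : Z -> C) (al be ga : R) : (0 < al)%R ->
  (forall n, Cmod (f n) <= (Rabs (IZR n) + 1) * exp (- al * IZR n ^ 2 + be * Rabs (IZR n) + ga))%R ->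
  absum f.
Proof.
move=> Hal H.
(* (be + 2)^2 / (4 al) is the maximum of - al x^2 + (be + 2) x. *)
apply: (absum_dom f (fun n => (/ 2) ^ Z.abs_nat n)%R (exp (ga + (be + 2) ^ 2 / (4 * al)))).
- left; apply: exp_pos.
- exact: summable_half_pow.
move=> n. apply: Rle_trans (H n) _. set x := Rabs (IZR n).
have -> : (IZR n ^ 2 = x ^ 2)%R by rewrite /x pow2_abs.
have Hx : (x + 1 <= exp x)%R.
  case: (Req_dec x 0) => [->|K]; first by rewrite exp_0; lra. move: (exp_ineq1 x K); lra.
apply: (Rle_trans _ (exp (ga + (be + 2) ^ 2 / (4 * al)) * exp (- x))); last first.
  apply: Rmult_le_compat_l; [left; apply: exp_pos | exact: exp_m_abs_le].
apply: (Rle_trans _ (exp x * exp (- al * x ^ 2 + be * x + ga))).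
  apply: Rmult_le_compat_r => //. left; apply: exp_pos.
rewrite -!exp_plus. apply: exp_le_compat.
have E : ((be + 2) ^ 2 / (4 * al) = al * (x - (be + 2) / (2 * al)) ^ 2 - al * x ^ 2 + (be + 2) * x)%R.
  field; lra.
have : (0 <= al * (x - (be + 2) / (2 * al)) ^ 2)%R.
  apply: Rmult_le_pos; [lra | apply: pow2_ge_0].
lra.
Qed.

(** * Monomials q^A e(B z) e(D) *)

Lemma Cexp_plus (u v : C) : Cexp (u + v) = Cexp u * Cexp v.
Proof.
case: u => a b; case: v => c d. rewrite /Cexp /=.
rewrite exp_plus cos_plus sin_plus. apply: injective_projections => /=; ring.
Qed.

Lemma Cexp_0 : Cexp 0 = 1.
Proof. by rewrite /Cexp /= exp_0 cos_0 sin_0 !Rmult_1_l. Qed.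

Lemma Cmod_Cexp (w : C) : Cmod (Cexp w) = exp (Re w).
Proof.
rewrite /Cexp /Cmod /=.
have -> : (exp (Re w) * cos (Im w) * (exp (Re w) * cos (Im w) * 1) +
  exp (Re w) * sin (Im w) * (exp (Re w) * sin (Im w) * 1) =
  exp (Re w) * exp (Re w) * (Rsqr (sin (Im w)) + Rsqr (cos (Im w))))%R by rewrite /Rsqr; ring.
rewrite sin2_cos2 Rmult_1_r. apply: sqrt_square. left; apply: exp_pos.
Qed.

(** Real exponents reduce every identity between monomials to three equations in R, the last one,
    for the phase [D], being a congruence modulo 1. *)
Definition Q (tau z : C) (A B D : R) : C := Cexp (2 * PI * Ci * (A * tau + B * z + D)).

Lemma Q_mult tau z A B D A' B' D' :
  Q tau z A B D * Q tau z A' B' D' = Q tau z (A + A') (B + B') (D + D').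
Proof. rewrite /Q -Cexp_plus. congr Cexp. rewrite !RtoC_plus. ring. Qed.

Lemma Q_0 tau z : Q tau z 0 0 0 = 1.
Proof. rewrite /Q -Cexp_0. congr Cexp. ring. Qed.

Lemma Cexp_real_phase (D : R) : Cexp (2 * PI * Ci * D) = (cos (2 * PI * D), sin (2 * PI * D)).
Proof.
have -> : 2 * PI * Ci * D = (0, 2 * PI * D)%R.
  apply: injective_projections => /=; ring.
by rewrite /Cexp /= exp_0 !Rmult_1_l.
Qed.

Lemma Q_phase_eq tau z D : Q tau z 0 0 D = (cos (2 * PI * D), sin (2 * PI * D)).
Proof. rewrite -Cexp_real_phase /Q. congr Cexp. ring. Qed.

Lemma cos_sin_2PI_IZR (k : Z) : cos (2 * PI * IZR k) = 1%R /\ sin (2 * PI * IZR k) = 0%R.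
Proof.
have E : sin (2 * PI * IZR k) = 0%R.
  apply: sin_eq_0_1. exists (2 * k)%Z. rewrite mult_IZR; ring.
split=> //. have -> : (2 * PI * IZR k = 2 * (IZR k * PI))%R by ring.
rewrite cos_2a_sin (sin_eq_0_1 (IZR k * PI)); first by ring. by exists k.
Qed.

Lemma Q_int_phase tau z (k : Z) : Q tau z 0 0 (IZR k) = 1.
Proof. rewrite Q_phase_eq. have [-> ->] := cos_sin_2PI_IZR k. by []. Qed.

Lemma Q_half_phase tau z : Q tau z 0 0 (1 / 2) = - (1).
Proof.
rewrite Q_phase_eq. have -> : (2 * PI * (1 / 2) = PI)%R by field.
rewrite cos_PI sin_PI. apply: injective_projections => /=; ring.
Qed.

Lemma Q_quarter_phase tau z : Q tau z 0 0 (1 / 4) = Ci.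
Proof.
rewrite Q_phase_eq. have -> : (2 * PI * (1 / 4) = PI / 2)%R by field.
by rewrite cos_PI2 sin_PI2.
Qed.

(** [k] is the witness for the congruence of the phases; [Q_opp] is the analogue for phases
    differing by an odd multiple of 1/2, which costs a sign. *)
Lemma Q_eq (k : Z) tau z A B D A' B' D' : A = A' -> B = B' -> D = (D' + IZR k)%R ->
  Q tau z A B D = Q tau z A' B' D'.
Proof.
move=> -> -> ->. rewrite -(Cmult_1_r (Q tau z A' B' D')) -(Q_int_phase tau z k) Q_mult.
congr Q; ring.
Qed.

Lemma Q_opp (k : Z) tau z A B D A' B' D' : A = A' -> B = B' -> D = (D' + IZR k + 1 / 2)%R ->
  Q tau z A B D = - Q tau z A' B' D'.
Proof.
move=> -> -> ->.
have -> : - Q tau z A' B' D' = Q tau z A' B' D' * Q tau z 0 0 (IZR k) * Q tau z 0 0 (1 / 2).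
  rewrite Q_int_phase Q_half_phase; ring.
rewrite !Q_mult. congr Q; ring.
Qed.

Lemma Q_nz tau z A B D : Q tau z A B D <> 0.
Proof.
move=> E. have : Q tau z A B D * Q tau z (- A) (- B) (- D) = 1.
  rewrite Q_mult -(Q_0 tau z). congr Q; ring.
rewrite E Cmult_0_l => K. by case: C1_nz.
Qed.

Lemma Q_inv tau z A B D : / Q tau z A B D = Q tau z (- A) (- B) (- D).
Proof.
have K := Q_nz tau z A B D.
have E : Q tau z A B D * Q tau z (- A) (- B) (- D) = 1.
  rewrite Q_mult -(Q_0 tau z). congr Q; ring.
transitivity (/ Q tau z A B D * (Q tau z A B D * Q tau z (- A) (- B) (- D))); first by rewrite E; ring.
by field.
Qed.

Lemma Q_pow tau z A B D n : Q tau z A B D ^ n = Q tau z (INR n * A) (INR n * B) (INR n * D).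
Proof.
elim: n => [|n IH]; first by rewrite /= -(Q_0 tau z); congr Q; ring.
rewrite Cpow_S IH Q_mult S_INR. congr Q; ring.
Qed.

Lemma Cmod_Q tau z A B D : Cmod (Q tau z A B D) = exp (- (2 * PI) * (A * Im tau + B * Im z)).
Proof.
rewrite /Q Cmod_Cexp. congr exp. case: tau => a b; case: z => c d. rewrite /Re /Im /=. ring.
Qed.

(** The phase may be any function of n, since moduli do not see it; [z] only contributes to the
    linear part of the exponent. *)
Lemma absum_lin_Q tau z (a b c d e : R) (D : Z -> R) : (0 < Im tau)%R -> (0 < a)%R ->
  absum (fun n => IZR n * Q tau z (a * IZR n ^ 2 + b * IZR n + c) (d * IZR n + e) (D n)) /\
  absum (fun n => Q tau z (a * IZR n ^ 2 + b * IZR n + c) (d * IZR n + e) (D n)).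
Proof.
move=> Ht Ha.
set y := Im tau. set v := Im z.
have HP := PI_RGT_0.
have key n : (Cmod (Q tau z (a * IZR n ^ 2 + b * IZR n + c) (d * IZR n + e) (D n)) <=
   exp (- (2 * PI * a * y) * IZR n ^ 2 + 2 * PI * (Rabs (b * y + d * v)) * Rabs (IZR n) +
     - (2 * PI) * (c * y + e * v)))%R.
  rewrite Cmod_Q. apply: exp_le_compat.
  have := Rle_abs (- ((b * y + d * v) * IZR n)). rewrite Rabs_Ropp Rabs_mult => K.
  have := Rmult_le_compat_l (2 * PI) _ _ ltac:(lra) K. rewrite -/y -/v. lra.
have Hal : (0 < 2 * PI * a * y)%R by repeat apply: Rmult_lt_0_compat => //; lra.
split; apply: (absum_gauss _ _ (2 * PI * Rabs (b * y + d * v)) (- (2 * PI) * (c * y + e * v)) Hal) => n.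
  rewrite Cmod_mult Cmod_R.
  apply: Rmult_le_compat; [exact: Rabs_pos | exact: Cmod_ge_0 | move: (Rabs_pos (IZR n)); lra | exact: key].
apply: Rle_trans (key n) _. set x := exp _.
have Hx : (0 < x)%R by apply: exp_pos. have := Rmult_le_pos _ _ (Rabs_pos (IZR n)) (Rlt_le _ _ Hx). lra.
Qed.

Definition absum_Q tau z a b c d e D Ht Ha := proj2 (absum_lin_Q tau z a b c d e D Ht Ha).

(** * Infinite products *)

Definition clim (u : nat -> C) (l : C) : Prop :=
  forall eps, (0 < eps)%R -> exists N0, forall N, (N0 <= N)%nat -> (Cmod (u N - l) < eps)%R.

Lemma clim_unique u l l' : clim u l -> clim u l' -> l = l'.
Proof.
move=> H H'. apply: C_small_eq => eps He.
have [N0 H0] := H (eps / 2)%R ltac:(lra). have [N1 H1] := H' (eps / 2)%R ltac:(lra).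
move: (H0 (N0 + N1)%nat ltac:(lia)) (H1 (N0 + N1)%nat ltac:(lia)).
move: (Cmod_sub_triangle l (u (N0 + N1)%nat) l'). rewrite (Cmod_sub_sym l (u _)). lra.
Qed.

Lemma clim_ext u v l : (forall N, u N = v N) -> clim u l -> clim v l.
Proof.
move=> E H eps He. have [N0 H0] := H eps He. exists N0 => N HN. rewrite -E. exact: H0.
Qed.

Lemma clim_const c : clim (fun _ => c) c.
Proof. move=> eps He. exists 0%nat => N _. replace (c - c) with (RtoC 0) by ring. by rewrite Cmod_0. Qed.

Lemma clim_sub u l (phi : nat -> nat) : clim u l -> (forall N, (N <= phi N)%nat) ->
  clim (fun N => u (phi N)) l.
Proof.
move=> H Hp eps He. have [N0 H0] := H eps He. exists N0 => N HN. apply: H0. move: (Hp N); lia.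
Qed.

Lemma clim_bounded u l : clim u l -> exists N0, forall N, (N0 <= N)%nat -> (Cmod (u N) <= Cmod l + 1)%R.
Proof.
move=> H. have [N0 H0] := H 1%R ltac:(lra). exists N0 => N HN. move: (H0 N HN).
move: (Cmod_triangle (u N - l) l). replace (u N - l + l) with (u N) by ring. lra.
Qed.

Lemma clim_mult u v l l' : clim u l -> clim v l' -> clim (fun N => u N * v N) (l * l').
Proof.
move=> H H' eps He. have [N0 H0] := clim_bounded u l H.
have P1 := Cmod_ge_0 l. have P2 := Cmod_ge_0 l'.
set a := (Cmod l + 1)%R in H0. set b := (Cmod l' + 1)%R.
have Ha : (0 < a)%R by rewrite /a; lra. have Hb : (0 < b)%R by rewrite /b; lra.
have [N1 H1] := H (eps / 2 / b)%R ltac:(by repeat apply: Rdiv_lt_0_compat => //; lra).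
have [N2 H2] := H' (eps / 2 / a)%R ltac:(by repeat apply: Rdiv_lt_0_compat => //; lra).
exists (N0 + N1 + N2)%nat => N HN.
replace (u N * v N - l * l') with (u N * (v N - l') + l' * (u N - l)) by ring.
apply: Rle_lt_trans (Cmod_triangle _ _) _. rewrite !Cmod_mult.
have K0 := H0 N ltac:(lia). have K1 := H1 N ltac:(lia). have K2 := H2 N ltac:(lia).
have L1 : (Cmod (u N) * Cmod (v N - l') <= a * Cmod (v N - l'))%R.
  apply: Rmult_le_compat_r => //. exact: Cmod_ge_0.
have L2 : (Cmod l' * Cmod (u N - l) <= b * Cmod (u N - l))%R.
  apply: Rmult_le_compat_r; [exact: Cmod_ge_0 | rewrite /b; lra].
have L3 := Rmult_lt_compat_l a _ _ Ha K2. have L4 := Rmult_lt_compat_l b _ _ Hb K1.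
have E1 : (a * (eps / 2 / a) = eps / 2)%R by field; lra.
have E2 : (b * (eps / 2 / b) = eps / 2)%R by field; lra.
lra.
Qed.

Lemma CLim_seq_clim u l : clim u l -> CLim_seq u = l.
Proof.
move=> H. rewrite /CLim_seq. have -> : l = (Re l, Im l) by case: l {H}.
congr pair.
- have -> : Lim_seq (fun n => Re (u n)) = Re l => //.
  apply: is_lim_seq_unique. apply/is_lim_seq_spec => eps.
  have [N0 HN0] := H eps (cond_pos eps); exists N0 => N HN; move: (HN0 N HN) => K.
  apply: Rle_lt_trans K. apply: Rle_trans (re_le_Cmod _). right; congr Rabs.
- have -> : Lim_seq (fun n => Im (u n)) = Im l => //.
  apply: is_lim_seq_unique. apply/is_lim_seq_spec => eps.
  have [N0 HN0] := H eps (cond_pos eps); exists N0 => N HN; move: (HN0 N HN) => K.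
  apply: Rle_lt_trans K. apply: Rle_trans (Rmax_Cmod _). apply: Rle_trans (Rmax_r _ _). right; congr Rabs.
Qed.

Lemma clim_csum_seq (a : nat -> C) : absum a -> clim (fun N => csum a (seq 0 N)) (Sum a).
Proof.
move=> H eps He. have [L0 HL0] := Sum_has a H eps He. exists (S (list_max L0)) => N HN.
apply: HL0; first exact: seq_NoDup.
move=> x Hx. apply/in_seq. split; first lia.
have := proj1 (list_max_le L0 (list_max L0)) (le_n _).
move/(proj1 (Forall_forall _ _)) => K. move: (K x Hx); lia.
Qed.

Fixpoint cprod (a : nat -> C) (N : nat) : C :=
  match N with O => 1 | S M => cprod a M * a N end.

Lemma cprod_mult a b N : cprod (fun k => a k * b k) N = cprod a N * cprod b N.
Proof. elim: N => [|N IH] /=; [ring | rewrite IH; ring]. Qed.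

Lemma cprod_ext a b N : (forall k, (1 <= k)%nat -> a k = b k) -> cprod a N = cprod b N.
Proof. move=> E. elim: N => [|N IH] //=. rewrite IH E //; lia. Qed.

(** 1 + |a_k| <= exp |a_k| bounds the partial products P_k, and P_{k+1} - P_k = P_k a_{k+1} makes
    them partial sums of an absolutely convergent series. *)
Lemma cprod_cv (a : nat -> C) (M : R) :
  (forall L, NoDup L -> rsum (fun k => Cmod (a k)) L <= M)%R ->
  (forall N, (Cmod (cprod (fun k => (1 + a k)%C) N) <= exp M)%R) /\
  exists l, clim (cprod (fun k => (1 + a k))) l.
Proof.
move=> HM. set P := cprod _.
have B N : (Cmod (P N) <= exp (rsum (fun k => Cmod (a k)) (seq 1 N)))%R.
  elim: N => [|N IH]; first by rewrite /= Cmod_1 exp_0; lra.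
  rewrite seq_S rsum_app exp_plus /P /= Cmod_mult Rplus_0_r.
  apply: Rmult_le_compat => //; try exact: Cmod_ge_0.
  apply: Rle_trans (Cmod_triangle _ _) _. rewrite Cmod_1.
  have [->|K] := Req_dec (Cmod (a (S N))) 0; first by rewrite exp_0; lra.
  move: (exp_ineq1 _ K); lra.
have B' N : (Cmod (P N) <= exp M)%R.
  apply: Rle_trans (B N) _. apply: exp_le_compat. apply: HM. exact: seq_NoDup.
split=> //.
have A : absum (fun k => P k * a (S k)).
  apply: (absum_le _ (fun k => a (S k)) (exp M)).
  - left; apply: exp_pos.
  - apply: (absum_inj S a); [by move=> x y [] | by exists M].
  - move=> k. rewrite Cmod_mult. apply: Rmult_le_compat_r => //. exact: Cmod_ge_0.
exists (1 + Sum (fun k => P k * a (S k))) => eps He.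
have [N0 H0] := clim_csum_seq _ A eps He. exists N0 => N HN.
have -> : P N = 1 + csum (fun k => P k * a (S k)) (seq 0 N).
  elim: (N) => [|k IH]; first by rewrite /P /=; ring.
  rewrite seq_S csum_app /= {1}/P /= -/(P k) {1}IH.
  replace (csum (fun k => P k * a (S k)) (seq 0 k)) with (P k - 1) by (rewrite IH; ring). ring.
replace (1 + csum (fun k => P k * a (S k)) (seq 0 N) - (1 + Sum (fun k => P k * a (S k)))) with
 (csum (fun k => P k * a (S k)) (seq 0 N) - Sum (fun k => P k * a (S k))) by ring.
exact: H0.
Qed.

Lemma summable_geom (r : R) : (0 <= r < 1)%R ->
  forall L, NoDup L -> (rsum (fun k => r ^ k) L <= / (1 - r))%R.
Proof.
move=> Hr L N.
have I : incl L (seq 0 (S (list_max L))).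
  move=> x Hx. apply/in_seq. split; first lia.
  have := proj1 (list_max_le L (list_max L)) (le_n _).
  move/(proj1 (Forall_forall _ _)) => K. move: (K x Hx); lia.
apply: Rle_trans (rsum_incl _ _ _ _ N I) _ => [k|]; first by apply: pow_le; lra.
set n := S _.
have -> : (rsum (fun k => r ^ k) (seq 0 n) = (1 - r ^ n) * / (1 - r))%R.
  elim: n {I} => [|n IH]; first by rewrite /=; ring.
  rewrite seq_S rsum_app IH /=. field; lra.
rewrite -{2}(Rmult_1_l (/ (1 - r))). apply: Rmult_le_compat_r.
  left; apply: Rinv_0_lt_compat; lra.
have : (0 <= r ^ n)%R by apply: pow_le; lra. lra.
Qed.

(** The q-Pochhammer symbol (q;q)_N; its limit [qinf] is the Euler product. *)
Definition poch (q : C) : nat -> C := cprod (fun k => 1 - q ^ k).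
Definition qinf (q : C) : C := CLim_seq (poch q).

Lemma one_minus_pow_bound q k : (Cmod q < 1)%R -> (1 <= k)%nat -> (1 - Cmod q <= Cmod (1 - q ^ k))%R.
Proof.
move=> H Hk. have H0 := Cmod_ge_0 q.
have : (Cmod (q ^ k) <= Cmod q)%R.
  rewrite Cmod_pow. case: k Hk => [|k] Hk; first lia. simpl pow.
  rewrite -{3}(Rmult_1_r (Cmod q)). apply: Rmult_le_compat_l => //.
  rewrite -(pow1 k). apply: pow_incr; lra.
move: (Cmod_triangle (1 - q ^ k) (q ^ k)). replace (1 - q ^ k + q ^ k) with (RtoC 1) by ring.
rewrite Cmod_1; lra.
Qed.

Lemma one_minus_pow_nz q k : (Cmod q < 1)%R -> (1 <= k)%nat -> 1 - q ^ k <> 0.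
Proof. move=> H Hk. apply/Cmod_gt_0. move: (one_minus_pow_bound q k H Hk); lra. Qed.

Lemma poch_nz q N : (Cmod q < 1)%R -> poch q N <> 0.
Proof.
move=> H. elim: N => [|N IH]; first exact: C1_nz.
apply: Cmult_neq_0 => //. apply: one_minus_pow_nz => //; lia.
Qed.

(** 1 / (1 - q^k) = 1 + q^k / (1 - q^k), so the inverse products fall under [cprod_cv] too. Their
    limit shows that the Euler product is nonzero, and their uniform bound is the dominating
    constant in the triple product. *)
Lemma poch_inv_cv q : (Cmod q < 1)%R ->
  exists K l, (forall N, (Cmod (/ poch q N) <= K)%R) /\ clim (fun N => / poch q N) l.
Proof.
move=> H. have H0 := Cmod_ge_0 q.
(* Index 0 lies outside the product, but the summability bound ranges over all of nat and 1 - q^0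
   vanishes. *)
pose b k := match k with O => RtoC 0 | _ => q ^ k / (1 - q ^ k) end.
have [|B [l Hl]] := cprod_cv b (/ (1 - Cmod q) * / (1 - Cmod q)).
  move=> L N. apply: Rle_trans (rsum_le _ (fun k => / (1 - Cmod q) * (Cmod q) ^ k)%R L _) _.
    move=> [|k]; rewrite /b.
      rewrite Cmod_0 /= Rmult_1_r. left; apply: Rinv_0_lt_compat; lra.
    rewrite Cmod_div; last by apply: one_minus_pow_nz => //; lia.
    rewrite -Cmod_pow /Rdiv Rmult_comm. apply: Rmult_le_compat_r; first exact: Cmod_ge_0.
    apply: Rinv_le_contravar; first lra. apply: one_minus_pow_bound => //; lia.
  rewrite rsum_scal. apply: Rmult_le_compat_l; first by left; apply: Rinv_0_lt_compat; lra.
  by apply: summable_geom; first lra.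
have E N : cprod (fun k => 1 + b k) N = / poch q N.
  elim: N => [|N IH]; first by rewrite /poch /=; field; exact: C1_nz.
  have K1 := poch_nz q N H. have K2 := one_minus_pow_nz q (S N) H ltac:(lia).
  rewrite /poch; cbn [cprod]; rewrite -/(poch q N) IH /b. by field.
exists (exp (/ (1 - Cmod q) * / (1 - Cmod q))), l. split=> [N|].
  by rewrite -E.
by apply: clim_ext Hl.
Qed.

Lemma poch_cv q : (Cmod q < 1)%R -> clim (poch q) (qinf q) /\ qinf q <> 0.
Proof.
move=> H. have H0 := Cmod_ge_0 q.
have [|_ [l Hl]] := cprod_cv (fun k => - q ^ k) (/ (1 - Cmod q)).
  move=> L N. apply: Rle_trans (rsum_le _ (fun k => (Cmod q) ^ k)%R L _) _.
    move=> k. rewrite Cmod_opp Cmod_pow; lra.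
  by apply: summable_geom; first lra.
have Hl' : clim (poch q) l by apply: clim_ext Hl.
have E : qinf q = l by exact: CLim_seq_clim.
rewrite E. split=> // E0. have [K [l' [_ Hi]]] := poch_inv_cv q H.
have : l * l' = 1.
  apply: (clim_unique (fun _ => 1)); last exact: clim_const.
  apply: clim_ext (clim_mult _ _ _ _ Hl' Hi) => N. apply: Cinv_r. exact: poch_nz.
rewrite E0 Cmult_0_l => K1. by case: C1_nz.
Qed.

Lemma poch_inv_lim q : (Cmod q < 1)%R ->
  exists K, (forall N, (Cmod (/ poch q N) <= K)%R) /\ clim (fun N => / poch q N) (/ qinf q).
Proof.
move=> H. have [K [l [B Hl]]] := poch_inv_cv q H. have [Hq Hn] := poch_cv q H.
exists K; split=> //. have E : qinf q * l = 1.
  apply: (clim_unique (fun _ => 1)); last exact: clim_const.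
  apply: clim_ext (clim_mult _ _ _ _ Hq Hl) => N. apply: Cinv_r. exact: poch_nz.
have -> : / qinf q = l => //. rewrite -(Cmult_1_r (/ qinf q)) -E. by field.
Qed.

(** * The Jacobi triple product *)

Lemma absum_finsupp {T} (f : T -> C) L : NoDup L -> (forall t, ~ In t L -> f t = 0) -> absum f.
Proof.
move=> N H. exists (rsum (fun t => Cmod (f t)) L) => L' N'.
have -> : rsum (fun t => Cmod (f t)) L' =
    rsum (fun t => Cmod (f t)) (filter (fun t => if excluded_middle_informative (In t L) then true else false) L').
  elim: L' {N'} => //= a l ->. case: excluded_middle_informative => K //=.
  rewrite H // Cmod_0; ring.
apply: rsum_incl; first by move=> t; apply: Cmod_ge_0.
  exact: NoDup_filter.
move=> x Hx. have [_] := proj1 (filter_In _ _ _) Hx. by case: excluded_middle_informative.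
Qed.

Lemma Sum_shift (f : Z -> C) (k : Z) : absum f -> Sum f = Sum (fun n => f (n + k)%Z).
Proof. move=> H. apply: (Sum_reindex (fun n => n + k)%Z (fun n => n - k)%Z) => // n; lia. Qed.

Lemma Sum_neg (f : Z -> C) (k : Z) : absum f -> Sum f = Sum (fun n => f (k - n)%Z).
Proof. move=> H. apply: (Sum_reindex (fun n => k - n)%Z (fun n => k - n)%Z) => // n; lia. Qed.

Lemma absum_shift (f : Z -> C) (k : Z) : absum f -> absum (fun n => f (n + k)%Z).
Proof. move=> H. apply: (absum_inj (fun n => n + k)%Z f) => // x y; lia. Qed.

Lemma absum_neg (f : Z -> C) (k : Z) : absum f -> absum (fun n => f (k - n)%Z).
Proof. move=> H. apply: (absum_inj (fun n => k - n)%Z f) => // x y; lia. Qed.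

(** This is q = e(tau), the square of what is usually called the nome. *)
Definition nome (tau : C) : C := Q tau 0 1 0 0.

Lemma nome_pow tau n : nome tau ^ n = Q tau 0 (INR n) 0 0.
Proof. rewrite /nome Q_pow. congr Q; ring. Qed.

Lemma Cmod_nome tau : (0 < Im tau)%R -> (Cmod (nome tau) < 1)%R.
Proof.
move=> H. rewrite /nome Cmod_Q. apply: (Rlt_le_trans _ (exp 0)); last by rewrite exp_0; lra.
apply: exp_increasing.
have HP := PI_RGT_0. have K : (0 < 2 * PI * Im tau)%R by repeat apply: Rmult_lt_0_compat => //; lra.
have -> : (1 * Im tau + 0 * Im 0 = Im tau)%R by ring. lra.
Qed.

(** 1 / (q;q)_k, extended by 0 to negative k. The recursion of [ipoch_pred] then holds on all of Z,
    the factor 1 - q^0 producing the zero at k = -1, and finite sums can be written as sums over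
    Z. *)
Definition ipoch (q : C) (k : Z) : C := if (k <? 0)%Z then 0 else / poch q (Z.to_nat k).

Lemma ipoch_pred tau k : (0 < Im tau)%R ->
  ipoch (nome tau) (k - 1) = (1 - Q tau 0 (IZR k) 0 0) * ipoch (nome tau) k.
Proof.
move=> H. have H1 := Cmod_nome tau H. rewrite /ipoch.
case: Z.ltb_spec => K1; case: Z.ltb_spec => K2; try lia.
- ring.
- have -> : k = 0%Z by lia. rewrite Q_0. ring.
- have [n ->] : exists n, k = Z.of_nat (S n) by exists (Z.to_nat (k - 1)); lia.
  have -> : Z.to_nat (Z.of_nat (S n) - 1) = n by lia.
  rewrite Nat2Z.id /poch; cbn [cprod]. rewrite -/(poch (nome tau) n).
  rewrite -INR_IZR_INZ -nome_pow. have N1 := poch_nz _ n H1.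
  have N2 := one_minus_pow_nz _ (S n) H1 ltac:(lia). by field.
Qed.

Definition jacobi_coef (tau : C) (n : Z) : C := Q tau 0 (IZR n * (IZR n + 1) / 2) 0 (IZR n / 2).

(** Up to the factor (q;q)_{2N+1} the two inverse symbols form a Gaussian binomial coefficient; the
    support is -N-1 <= n <= N. *)
Definition jacobi_fin (tau : C) (u : Z -> C) (N : nat) (n : Z) : C :=
  jacobi_coef tau n * ipoch (nome tau) (Z.of_nat N - n) * ipoch (nome tau) (Z.of_nat N + n + 1) * u n.

Fixpoint zlist (a : Z) (n : nat) : list Z :=
  match n with O => nil | S m => a :: zlist (a + 1) m end.

Lemma in_zlist a n x : In x (zlist a n) <-> (a <= x < a + Z.of_nat n)%Z.
Proof. elim: n a => [|n IH] a /=; first lia. rewrite IH. lia. Qed.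

Lemma NoDup_zlist a n : NoDup (zlist a n).
Proof. elim: n a => [|n IH] a /=; constructor; rewrite ?in_zlist; [lia | done]. Qed.

Lemma jacobi_fin_supp tau u N n : ~ In n (zlist (- Z.of_nat N - 1) (2 * N + 2)) -> jacobi_fin tau u N n = 0.
Proof.
rewrite in_zlist /jacobi_fin /ipoch => H.
case: Z.ltb_spec => K1; case: Z.ltb_spec => K2; try ring. lia.
Qed.

Lemma absum_jacobi_fin tau u N : absum (jacobi_fin tau u N).
Proof. by apply: (absum_finsupp _ _ (NoDup_zlist _ _)) (jacobi_fin_supp tau u N). Qed.

(* A finite Jacobi triple product. Only the three-term recursion of [u] is used,
   so it covers [u n = x ^ n] as well as [u n = 2 n + 1]. *)
Lemma finite_triple_product tau (s : C) (u : Z -> C) N : (0 < Im tau)%R ->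
  (forall n, u (n + 1)%Z + u (n - 1)%Z = s * u n) ->
  poch (nome tau) (2 * N + 1) * Sum (jacobi_fin tau u N) =
  cprod (fun k => 1 - s * nome tau ^ k + nome tau ^ (2 * k)) N * (u 0%Z - u (-1)%Z).
Proof.
move=> H Hu. have H1 := Cmod_nome tau H.
elim: N => [|N IH].
  rewrite (Sum_finsupp _ _ (NoDup_zlist _ _) (jacobi_fin_supp tau u 0)) /= /jacobi_fin /ipoch /jacobi_coef /=.
  rewrite /poch /=.
  have -> : Q tau 0 (-1 * (-1 + 1) / 2) 0 (-1 / 2) = - Q tau 0 0 0 0.
    apply: (Q_opp (-1)); field.
  have -> : Q tau 0 (0 * (0 + 1) / 2) 0 (0 / 2) = Q tau 0 0 0 0 by congr Q; field.
  rewrite Q_0. have := one_minus_pow_nz _ 1 H1 ltac:(lia). rewrite /= => K. field.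
  by rewrite Cmult_1_r in K.
set X := Q tau 0 (INR (S N)) 0 0.
set q := nome tau in IH *.
(* The factor s acts by s u(n) = u(n+1) + u(n-1). Shifting the summation index moves these
   translations onto the coefficients, and what remains is a termwise rational identity in q, X =
   q^(N+1) and q^n. *)
have step : (1 - X * X) * (1 - X * X * q) * Sum (jacobi_fin tau u (S N)) =
   (1 - s * X + X * X) * Sum (jacobi_fin tau u N).
  rewrite -Sum_scal; last exact: absum_jacobi_fin.
  pose g n := jacobi_fin tau (fun n => u (n + 1)%Z) N n. pose g' n := jacobi_fin tau (fun n => u (n - 1)%Z) N n.
  have E : (1 - s * X + X * X) * Sum (jacobi_fin tau u N) =
     Sum (fun n => (1 + X * X) * jacobi_fin tau u N n + (- X) * (g (n + (-1))%Z + g' (n + 1)%Z)).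
    rewrite Sum_plus; first last.
    - apply: absum_scal. apply: absum_plus; [apply: (absum_shift g) | apply: (absum_shift g')]; exact: absum_jacobi_fin.
    - apply: absum_scal; exact: absum_jacobi_fin.
    rewrite Sum_scal; last exact: absum_jacobi_fin.
    rewrite Sum_scal; last first.
      apply: absum_plus; [apply: (absum_shift g) | apply: (absum_shift g')]; exact: absum_jacobi_fin.
    rewrite Sum_plus; first last.
    - apply: (absum_shift g'); exact: absum_jacobi_fin.
    - apply: (absum_shift g); exact: absum_jacobi_fin.
    rewrite -(Sum_shift g); last exact: absum_jacobi_fin.
    rewrite -(Sum_shift g'); last exact: absum_jacobi_fin.
    rewrite -Sum_plus; try exact: absum_jacobi_fin.
    rewrite (Sum_ext (fun t => g t + g' t) (fun t => s * jacobi_fin tau u N t)); last first.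
      move=> t. rewrite /g /g' /jacobi_fin.
      replace (s * (jacobi_coef tau t * ipoch (nome tau) (Z.of_nat N - t) * ipoch (nome tau) (Z.of_nat N + t + 1) * u t))
       with (jacobi_coef tau t * ipoch (nome tau) (Z.of_nat N - t) * ipoch (nome tau) (Z.of_nat N + t + 1) * (s * u t)) by ring.
      rewrite -Hu; ring.
    rewrite Sum_scal; last exact: absum_jacobi_fin. ring.
  rewrite {}E. apply: Sum_ext => n. rewrite /g /g' /jacobi_fin.
  have -> : (n + -1 + 1)%Z = n by lia. have -> : (n + 1 - 1)%Z = n by lia.
  have -> : jacobi_coef tau (n + -1) = - (Q tau 0 (- IZR n) 0 0 * jacobi_coef tau n).
    rewrite /jacobi_coef Q_mult plus_IZR. apply: (Q_opp (-1)); field.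
  have -> : jacobi_coef tau (n + 1) = - (Q tau 0 (IZR n) 0 0 * q * jacobi_coef tau n).
    rewrite /jacobi_coef /q /nome !Q_mult plus_IZR. apply: (Q_opp 0); field.
  rewrite Nat2Z.inj_succ.
  have E1 : ipoch q (Z.of_nat N - n) = (1 - X * Q tau 0 (- IZR n) 0 0) * ipoch q (Z.succ (Z.of_nat N) - n).
    have -> : (Z.of_nat N - n = (Z.succ (Z.of_nat N) - n) - 1)%Z by lia.
    rewrite ipoch_pred // /X Q_mult minus_IZR succ_IZR -INR_IZR_INZ S_INR. congr (_ * _). congr (1 - _). congr Q; ring.
  have E2 : ipoch q (Z.of_nat N - (n + 1)) = (1 - X * Q tau 0 (- IZR n) 0 0 / q) * ipoch q (Z.of_nat N - n).
    have -> : (Z.of_nat N - (n + 1) = (Z.of_nat N - n) - 1)%Z by lia.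
    rewrite ipoch_pred // /X. congr (_ * _). congr (1 - _).
    rewrite /Cdiv. have -> : / q = Q tau 0 (-1) 0 0.
      rewrite -(Cmult_1_r (/ q)). have -> : RtoC 1 = q * Q tau 0 (-1) 0 0.
        rewrite /q /nome Q_mult -(Q_0 tau 0). congr Q; ring.
      have := Q_nz tau 0 1 0 0. rewrite -/(nome tau) -/q => K. by field.
    rewrite !Q_mult minus_IZR -INR_IZR_INZ S_INR. congr Q; ring.
  have E3 : ipoch q (Z.of_nat N + n + 1) = (1 - X * Q tau 0 (IZR n) 0 0 * q) * ipoch q (Z.succ (Z.of_nat N) + n + 1).
    have -> : (Z.of_nat N + n + 1 = (Z.succ (Z.of_nat N) + n + 1) - 1)%Z by lia.
    rewrite ipoch_pred // /X /q /nome !Q_mult !plus_IZR ?succ_IZR -INR_IZR_INZ S_INR. congr (_ * _). congr (1 - _). congr Q; ring.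
  have E4 : ipoch q (Z.of_nat N + (n + -1) + 1) = (1 - X * Q tau 0 (IZR n) 0 0) * ipoch q (Z.of_nat N + n + 1).
    have -> : (Z.of_nat N + (n + -1) + 1 = (Z.of_nat N + n + 1) - 1)%Z by lia.
    rewrite ipoch_pred // /X !Q_mult !plus_IZR -INR_IZR_INZ S_INR. congr (_ * _). congr (1 - _). congr Q; ring.
  have E5 : (Z.of_nat N - (n + -1) = Z.succ (Z.of_nat N) - n)%Z by lia.
  have E6 : (Z.of_nat N + (n + 1) + 1 = Z.succ (Z.of_nat N) + n + 1)%Z by lia.
  rewrite -/q E2 E4 E1 E3 E5 E6.
  have Hq : q <> 0 by exact: Q_nz.
  have Hy : Q tau 0 (- IZR n) 0 0 = / Q tau 0 (IZR n) 0 0.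
    have -> : / Q tau 0 (IZR n) 0 0 = / Q tau 0 (IZR n) 0 0 * (Q tau 0 (IZR n) 0 0 * Q tau 0 (- IZR n) 0 0).
      rewrite Q_mult Rplus_opp_r !Rplus_0_r Q_0. ring.
    have K := Q_nz tau 0 (IZR n) 0 0. by field.
  rewrite Hy. have K := Q_nz tau 0 (IZR n) 0 0.
  field. by split.
have -> : (2 * S N + 1 = S (S (2 * N + 1)))%nat by lia.
rewrite /poch; cbn [cprod]. rewrite -/(poch q (2 * N + 1)).
have -> : q ^ S (2 * N + 1) = X * X.
  rewrite /q nome_pow /X Q_mult. congr Q; try ring. rewrite !S_INR plus_INR mult_INR /=; ring.
have -> : q ^ S (S (2 * N + 1)) = X * X * q.
  rewrite /q nome_pow /X /nome !Q_mult. congr Q; try ring. rewrite !S_INR plus_INR mult_INR /=; ring.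
have -> : q ^ S N = X by rewrite /q nome_pow.
have -> : q ^ (2 * S N) = X * X.
  rewrite /q nome_pow /X !Q_mult. congr Q; try ring. rewrite mult_INR /=; ring.
transitivity (poch q (2 * N + 1) * ((1 - X * X) * (1 - X * X * q) * Sum (jacobi_fin tau u (S N)))); first ring.
rewrite step.
transitivity ((1 - s * X + X * X) * (poch q (2 * N + 1) * Sum (jacobi_fin tau u N))); first ring.
rewrite IH. ring.
Qed.

(** The limit of the finite product by Tannery's theorem: one factor (q;q)_{2N+1} against two
    inverse symbols leaves 1 / (q;q)_infinity. The product side stays a limit, to be identified for
    each choice of s. *)
Lemma triple_product tau (s : C) (u : Z -> C) : (0 < Im tau)%R ->
  (forall n, u (n + 1)%Z + u (n - 1)%Z = s * u n) -> absum (fun n => jacobi_coef tau n * u n) ->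
  clim (fun N => cprod (fun k => 1 - s * nome tau ^ k + nome tau ^ (2 * k)) N * (u 0%Z - u (-1)%Z))
    (Sum (fun n => jacobi_coef tau n * u n) / qinf (nome tau)).
Proof.
move=> H Hu A. have H1 := Cmod_nome tau H. set q := nome tau in H1 *.
have [K [BK LK]] := poch_inv_lim q H1. have [Lq Nq] := poch_cv q H1.
have K0 : (0 <= K)%R by apply: Rle_trans (Cmod_ge_0 _) (BK 0%nat).
have BI k : (Cmod (ipoch q k) <= K)%R.
  rewrite /ipoch. case: Z.ltb_spec => _ //. by rewrite Cmod_0.
have LI (phi : nat -> Z) (d : Z) : (forall N, Z.of_nat N + d <= phi N)%Z ->
    clim (fun N => ipoch q (phi N)) (/ qinf q).
  move=> Hphi eps He. have [N0 H0] := LK eps He.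
  exists (N0 + Z.to_nat (- d))%nat => N HN. rewrite /ipoch.
  move: (Hphi N) => K1. case: Z.ltb_spec => K2; first lia. apply: H0. lia.
have [|||_ L] := Sum_tannery (fun N => jacobi_fin tau u N)
   (fun n => jacobi_coef tau n * u n * (/ qinf q * / qinf q)) (fun n => K * K * Cmod (jacobi_coef tau n * u n))%R.
- have [M HM] := A. exists (K * K * M)%R => L N. rewrite rsum_scal.
  apply: Rmult_le_compat_l; [nra | exact: HM].
- move=> N n. rewrite /jacobi_fin -/q.
  replace (jacobi_coef tau n * ipoch q (Z.of_nat N - n) * ipoch q (Z.of_nat N + n + 1) * u n) with
    (ipoch q (Z.of_nat N - n) * ipoch q (Z.of_nat N + n + 1) * (jacobi_coef tau n * u n)) by ring.
  rewrite 2!Cmod_mult. apply: Rmult_le_compat_r; first exact: Cmod_ge_0.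
  apply: Rmult_le_compat => //; exact: Cmod_ge_0.
- move=> n. change (clim (fun N => jacobi_fin tau u N n) (jacobi_coef tau n * u n * (/ qinf q * / qinf q))).
  apply: (clim_ext (fun N => (jacobi_coef tau n * u n) * (ipoch q (Z.of_nat N - n) * ipoch q (Z.of_nat N + n + 1)))).
    move=> N; rewrite /jacobi_fin -/q; ring.
  apply: clim_mult; first exact: clim_const.
  apply: clim_mult; [apply: (LI _ (- n)%Z) | apply: (LI _ (n + 1)%Z)] => N; lia.
apply: (clim_ext (fun N => poch q (2 * N + 1) * Sum (jacobi_fin tau u N))).
  move=> N. exact: finite_triple_product.
have -> : Sum (fun n => jacobi_coef tau n * u n) / qinf q =
   qinf q * Sum (fun n => jacobi_coef tau n * u n * (/ qinf q * / qinf q)).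
  rewrite (Sum_ext (fun n => jacobi_coef tau n * u n * (/ qinf q * / qinf q)) (fun n => (/ qinf q * / qinf q) * (jacobi_coef tau n * u n))); last by move=> n /=; ring.
  rewrite Sum_scal //. by field.
apply: clim_mult => //. apply: (clim_sub _ _ (fun N => 2 * N + 1)%nat) => // N. lia.
Qed.

(** * Theta constants as products *)

Lemma absum_jacobi_coef tau (al be : R) : (0 < Im tau)%R ->
  absum (fun n => jacobi_coef tau n * Q tau 0 (al * IZR n) 0 (be * IZR n)).
Proof.
move=> H.
apply: absum_ext (absum_Q tau 0 (1 / 2) (1 / 2 + al) 0 0 0 (fun n => IZR n / 2 + be * IZR n)%R H ltac:(lra)) => n.
rewrite /jacobi_coef Q_mult. congr Q; field.
Qed.

(** The triple product at s = 2, where u may be the arithmetic progression 2n + 1: the factors are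
    (1 - q^k)^2 and u(0) - u(-1) = 2. This replaces the usual differentiation in z. *)
Lemma jacobi_identity tau : (0 < Im tau)%R ->
  Sum (fun n => jacobi_coef tau n * (2 * IZR n + 1)) = 2 * qinf (nome tau) ^ 3.
Proof.
move=> H. have H1 := Cmod_nome tau H. have [Lq Nq] := poch_cv _ H1.
have A : absum (fun n => jacobi_coef tau n * (2 * IZR n + 1)).
  have [A1 A2] := absum_lin_Q tau 0 (1 / 2) (1 / 2) 0 0 0 (fun n => IZR n / 2)%R H ltac:(lra).
  apply: absum_ext (absum_plus _ _ (absum_scal 2 _ A1) A2) => n.
  have -> : jacobi_coef tau n = Q tau 0 (1 / 2 * IZR n ^ 2 + 1 / 2 * IZR n + 0) (0 * IZR n + 0) (IZR n / 2).
    rewrite /jacobi_coef. congr Q; field.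
  ring.
have L := triple_product tau 2 (fun n => 2 * IZR n + 1) H _ A.
have L' := L ltac:(move=> n; rewrite minus_IZR !plus_IZR RtoC_plus RtoC_minus; ring).
have E : 2 * (qinf (nome tau) * qinf (nome tau)) =
  Sum (fun n => jacobi_coef tau n * (2 * IZR n + 1)) / qinf (nome tau).
  apply: clim_unique L'.
  apply: (clim_ext (fun N => 2 * (poch (nome tau) N * poch (nome tau) N))).
    move=> N. rewrite /poch -cprod_mult.
    rewrite (cprod_ext (fun k => 1 - 2 * nome tau ^ k + nome tau ^ (2 * k))
      (fun k => (1 - nome tau ^ k) * (1 - nome tau ^ k))); first by rewrite /=; ring.
    move=> k _. have -> : (2 * k = k + k)%nat by lia. rewrite Cpow_add_r; ring.
  apply: clim_mult; first exact: clim_const. by apply: clim_mult.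
have -> : Sum (fun n => jacobi_coef tau n * (2 * IZR n + 1)) =
  Sum (fun n => jacobi_coef tau n * (2 * IZR n + 1)) / qinf (nome tau) * qinf (nome tau) by field.
rewrite -E. ring.
Qed.

Lemma nome_double tau : nome (2 * tau) = nome tau ^ 2.
Proof. rewrite nome_pow /nome /Q /=. congr Cexp. rewrite RtoC_plus. ring. Qed.

Lemma nome_half_sqr tau : nome (tau / 2) ^ 2 = nome tau.
Proof. rewrite -nome_double. congr nome. field. Qed.

Lemma Im_double tau : Im (2 * tau) = (2 * Im tau)%R.
Proof. exact: im_scal_l. Qed.

Lemma Im_half tau : Im (tau / 2) = (Im tau / 2)%R.
Proof. case: tau => a b. rewrite /= . field. Qed.

(** The triple product at s = -2 with u(n) = (-1)^n: the factors are (1 + q^k)^2, and the product of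
    the 1 + q^k is (q^2;q^2)_infinity / (q;q)_infinity. *)
Lemma theta10_null_sum tau : (0 < Im tau)%R ->
  Sum (fun n => Q tau 0 ((IZR n + 1 / 2) ^ 2 / 2) 0 0) =
  2 * Q tau 0 (1 / 8) 0 0 * qinf (nome (2 * tau)) ^ 2 / qinf (nome tau).
Proof.
move=> H. have H1 := Cmod_nome tau H. have [Lq Nq] := poch_cv _ H1.
have H2 : (Cmod (nome (2 * tau)) < 1)%R by apply: Cmod_nome; rewrite Im_double; lra.
have [Lq2 Nq2] := poch_cv _ H2.
set E1 := qinf (nome tau) in Lq Nq *. set E2 := qinf (nome (2 * tau)) in Lq2 Nq2 *.
have A := absum_jacobi_coef tau 0 (1 / 2) H.
have Hu n : Q tau 0 (0 * IZR (n + 1)) 0 (1 / 2 * IZR (n + 1)) + Q tau 0 (0 * IZR (n - 1)) 0 (1 / 2 * IZR (n - 1)) =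
    - (2) * Q tau 0 (0 * IZR n) 0 (1 / 2 * IZR n).
  have -> : Q tau 0 (0 * IZR (n + 1)) 0 (1 / 2 * IZR (n + 1)) = - Q tau 0 (0 * IZR n) 0 (1 / 2 * IZR n).
    apply: (Q_opp 0); rewrite ?plus_IZR; field.
  have -> : Q tau 0 (0 * IZR (n - 1)) 0 (1 / 2 * IZR (n - 1)) = - Q tau 0 (0 * IZR n) 0 (1 / 2 * IZR n).
    apply: (Q_opp (-1)); rewrite ?minus_IZR; field.
  ring.
have L' := triple_product tau (- (2)) _ H Hu A.
have [K [_ Li]] := poch_inv_lim _ H1.
have P : clim (cprod (fun k => 1 + nome tau ^ k)) (E2 * / E1).
  apply: clim_ext (clim_mult _ _ _ _ Lq2 Li) => N.
  have E : cprod (fun k => 1 + nome tau ^ k) N * poch (nome tau) N = poch (nome (2 * tau)) N.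
    rewrite /poch -cprod_mult. apply: cprod_ext => k _.
    rewrite nome_double -Cpow_mult_r. have -> : (2 * k = k + k)%nat by lia. rewrite Cpow_add_r; ring.
  rewrite -E. field. exact: poch_nz.
have E : (E2 * / E1) * (E2 * / E1) * 2 =
  Sum (fun n => jacobi_coef tau n * Q tau 0 (0 * IZR n) 0 (1 / 2 * IZR n)) / E1.
  apply: clim_unique L'.
  apply: clim_ext (clim_mult _ _ _ _ (clim_mult _ _ _ _ P P) (clim_const 2)) => N.
  rewrite -cprod_mult (cprod_ext (fun k => (1 + nome tau ^ k) * (1 + nome tau ^ k))
     (fun k => 1 - - (2) * nome tau ^ k + nome tau ^ (2 * k))); last first.
    move=> k _. have -> : (2 * k = k + k)%nat by lia. rewrite Cpow_add_r; ring.
  congr (_ * _).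
  rewrite (Q_opp (-1) tau 0 (0 * IZR (-1)) 0 _ 0 0 0); try field.
  rewrite (Q_eq 0 tau 0 _ _ _ 0 0 0); try field. rewrite Q_0; ring.
have -> : Sum (fun n => Q tau 0 ((IZR n + 1 / 2) ^ 2 / 2) 0 0) =
   Q tau 0 (1 / 8) 0 0 * Sum (fun n => jacobi_coef tau n * Q tau 0 (0 * IZR n) 0 (1 / 2 * IZR n)).
  rewrite -Sum_scal //. apply: Sum_ext => n. rewrite /jacobi_coef !Q_mult.
  apply: (Q_eq (- n)); rewrite ?opp_IZR; field.
have -> : Sum (fun n => jacobi_coef tau n * Q tau 0 (0 * IZR n) 0 (1 / 2 * IZR n)) =
  Sum (fun n => jacobi_coef tau n * Q tau 0 (0 * IZR n) 0 (1 / 2 * IZR n)) / E1 * E1 by field.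
rewrite -E. by field.
Qed.

(** With r = q^{1/2} or - q^{1/2}, the factors 1 - q^{k-1/2} or 1 + q^{k-1/2} of the even theta
    constants. *)
Definition oddprod (r : C) : nat -> C := cprod (fun k => 1 - r ^ (2 * k - 1)).

Lemma oddprod_poch r N : oddprod r N * poch (r ^ 2) N = poch r (2 * N).
Proof.
elim: N => [|N IH]; first by rewrite /oddprod /poch /=; ring.
have -> : (2 * S N = S (S (2 * N)))%nat by lia.
rewrite /oddprod /poch; cbn [cprod]. rewrite -/(oddprod r N) -/(poch (r ^ 2) N) -/(poch r (2 * N)) -IH.
have -> : (2 * S N - 1 = S (2 * N))%nat by lia. rewrite -Cpow_mult_r.
have -> : (2 * S N = S (S (2 * N)))%nat by lia. ring.
Qed.

Lemma oddprod_opp r N : oddprod (- r) N * oddprod r N = oddprod (r ^ 2) N.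
Proof.
rewrite /oddprod -cprod_mult. apply: cprod_ext => k Hk.
have -> : (2 * k - 1 = S (2 * (k - 1)))%nat by lia.
rewrite !Cpow_S !Cpow_mult_r. have -> : (- r) ^ 2 = r ^ 2 by ring.
set w := (r ^ 2) ^ (k - 1). have -> : ((r ^ 2) ^ 2) ^ (k - 1) = w * w.
  rewrite /w -Cpow_mult_l. congr Cpow. ring.
ring.
Qed.

Lemma oddprod_lim tau : (0 < Im tau)%R ->
  clim (oddprod (nome tau)) (qinf (nome tau) * / qinf (nome (2 * tau))).
Proof.
move=> H. have [Lq Nq] := poch_cv _ (Cmod_nome tau H).
have H2 : (Cmod (nome (2 * tau)) < 1)%R by apply: Cmod_nome; rewrite Im_double; lra.
have [K [_ Li]] := poch_inv_lim _ H2.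
apply: clim_ext (clim_mult _ _ _ _ (clim_sub _ _ (fun N => 2 * N)%nat Lq _) Li); last by move=> N; lia.
move=> N. rewrite -oddprod_poch -nome_double. field. exact: poch_nz.
Qed.

(** b = 0 is the constant of vartheta_01, b = 1 that of vartheta_00. With r^2 = q, u(n) = r^{-n} and
    s = r + 1/r, the k-th factor splits as (1 - r^{2k-1})(1 - r^{2k+1}), and u(0) - u(-1) = 1 - r
    supplies the factor missing from the second product. *)
Lemma even_theta_null tau (b : Z) l : (0 < Im tau)%R ->
  clim (oddprod (Q tau 0 (1 / 2) 0 (- IZR b / 2))) l ->
  Sum (fun n => Q tau 0 (IZR n ^ 2 / 2) 0 ((IZR b + 1) * IZR n / 2)) = qinf (nome tau) * l ^ 2.
Proof.
move=> H Lo. have [Lq Nq] := poch_cv _ (Cmod_nome tau H).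
set r := Q tau 0 (1 / 2) 0 (- IZR b / 2) in Lo. set ri := Q tau 0 (- 1 / 2) 0 (IZR b / 2).
have Er : r * ri = 1 by rewrite /r /ri Q_mult -(Q_0 tau 0); congr Q; field.
have Eq : nome tau = r ^ 2.
  rewrite /r Q_pow /nome. apply: (Q_eq b) => /=; field.
have A := absum_jacobi_coef tau (- 1 / 2) (IZR b / 2) H.
have Hu : forall n, Q tau 0 (- 1 / 2 * IZR (n + 1)) 0 (IZR b / 2 * IZR (n + 1)) +
   Q tau 0 (- 1 / 2 * IZR (n - 1)) 0 (IZR b / 2 * IZR (n - 1)) =
   (r + ri) * Q tau 0 (- 1 / 2 * IZR n) 0 (IZR b / 2 * IZR n).
  move=> n. rewrite Cmult_plus_distr_r /r /ri !Q_mult Cplus_comm.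
  congr (_ + _); congr Q; rewrite ?minus_IZR ?plus_IZR; field.
have L := triple_product tau (r + ri) (fun n => Q tau 0 (- 1 / 2 * IZR n) 0 (IZR b / 2 * IZR n)) H Hu A.
have E : l * l = Sum (fun n => jacobi_coef tau n * Q tau 0 (- 1 / 2 * IZR n) 0 (IZR b / 2 * IZR n)) / qinf (nome tau).
  apply: clim_unique L.
  have LoS : clim (fun N => oddprod r (S N)) l by apply: clim_sub => // N; lia.
  apply: clim_ext (clim_mult _ _ _ _ Lo LoS) => N.
  have -> : Q tau 0 (- 1 / 2 * 0) 0 (IZR b / 2 * 0) = 1 by rewrite -(Q_0 tau 0); congr Q; field.
  have -> : Q tau 0 (- 1 / 2 * -1) 0 (IZR b / 2 * -1) = r by rewrite /r; congr Q; field.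
  have Es : oddprod r (S N) = cprod (fun k => 1 - r ^ (2 * k + 1)) N * (1 - r).
    elim: (N) => [|M IH]; first by rewrite /oddprod /=; ring.
    rewrite {1}/oddprod; cbn [cprod]. rewrite /oddprod in IH; cbn [cprod] in IH. rewrite IH.
    have -> : (2 * S (S M) - 1 = 2 * S M + 1)%nat by lia. ring.
  rewrite Es /oddprod Cmult_assoc -cprod_mult. congr (_ * _). apply: cprod_ext => k Hk.
  rewrite Eq -!Cpow_mult_r.
  have -> : (2 * (2 * k) = (2 * k - 1) + (2 * k + 1))%nat by lia.
  have -> : (r + ri) * r ^ (2 * k) = r ^ (2 * k + 1) + r ^ (2 * k - 1).
    have -> : (2 * k + 1 = S (S (2 * k - 1)))%nat by lia.
    have {1}-> : (2 * k = S (2 * k - 1))%nat by lia. rewrite !Cpow_S.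
    replace ((r + ri) * (r * r ^ (2 * k - 1))) with (r * r * r ^ (2 * k - 1) + (r * ri) * r ^ (2 * k - 1)) by ring.
    rewrite Er; ring.
  rewrite (Cpow_add_r r (2 * k - 1)). ring.
rewrite (Sum_ext _ (fun n => jacobi_coef tau n * Q tau 0 (- 1 / 2 * IZR n) 0 (IZR b / 2 * IZR n))); last first.
  move=> n. rewrite /jacobi_coef Q_mult. congr Q; field.
have -> : Sum (fun n => jacobi_coef tau n * Q tau 0 (- 1 / 2 * IZR n) 0 (IZR b / 2 * IZR n)) =
  Sum (fun n => jacobi_coef tau n * Q tau 0 (- 1 / 2 * IZR n) 0 (IZR b / 2 * IZR n)) / qinf (nome tau) * qinf (nome tau) by field.
rewrite -E. ring.
Qed.

Lemma nome_half_Q tau : nome (tau / 2) = Q tau 0 (1 / 2) 0 0.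
Proof. rewrite /nome /Q. congr Cexp. rewrite RtoC_div; last lra. field. Qed.

Lemma theta01_null_sum tau : (0 < Im tau)%R ->
  Sum (fun n => Q tau 0 (IZR n ^ 2 / 2) 0 (IZR n / 2)) =
  qinf (nome (tau / 2)) ^ 2 / qinf (nome tau).
Proof.
move=> H. have [Lq Nq] := poch_cv _ (Cmod_nome tau H).
have K := oddprod_lim (tau / 2) ltac:(rewrite Im_half; lra).
rewrite (_ : 2 * (tau / 2) = tau) in K; last by field.
rewrite (Sum_ext _ (fun n => Q tau 0 (IZR n ^ 2 / 2) 0 ((0 + 1) * IZR n / 2))); last first.
  move=> n; congr Q; field.
rewrite (even_theta_null tau 0 (qinf (nome (tau / 2)) * / qinf (nome tau)) H).
  by field.
rewrite nome_half_Q in K *. have -> : (- 0 / 2 = 0)%R by field. exact: K.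
Qed.

(** The product at - q^{1/2} comes from the one at q^{1/2} through (1 + r^k)(1 - r^k) = 1 - r^{2k}
    for odd k. *)
Lemma theta00_null_sum tau : (0 < Im tau)%R ->
  Sum (fun n => Q tau 0 (IZR n ^ 2 / 2) 0 0) =
  qinf (nome tau) ^ 5 / (qinf (nome (tau / 2)) ^ 2 * qinf (nome (2 * tau)) ^ 2).
Proof.
move=> H. have [Lq Nq] := poch_cv _ (Cmod_nome tau H).
have Hh : (0 < Im (tau / 2))%R by rewrite Im_half; lra.
have H2 : (0 < Im (2 * tau))%R by rewrite Im_double; lra.
have [Lh Nh] := poch_cv _ (Cmod_nome _ Hh). have [L2 N2] := poch_cv _ (Cmod_nome _ H2).
have K := oddprod_lim _ Hh. rewrite (_ : 2 * (tau / 2) = tau) in K; last by field.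
have K2 := oddprod_lim _ H.
set Eh := qinf (nome (tau / 2)) in Nh Lh K *. set E1 := qinf (nome tau) in Nq Lq K K2 *.
set E2 := qinf (nome (2 * tau)) in N2 L2 K2 *.
have [Kb [_ Li]] := poch_inv_lim _ (Cmod_nome _ Hh).
have Ki : clim (fun N => poch (nome tau) N * / poch (nome (tau / 2)) (2 * N)) (E1 * / Eh).
  apply: clim_mult => //. apply: (clim_sub _ _ (fun N => 2 * N)%nat Li) => N; lia.
rewrite (Sum_ext _ (fun n => Q tau 0 (IZR n ^ 2 / 2) 0 ((1 + 1) * IZR n / 2))); last first.
  move=> n; apply: (Q_eq (- n)); rewrite ?opp_IZR; field.
rewrite (even_theta_null tau 1 ((E1 * / E2) * (E1 * / Eh)) H); first by rewrite -/E1; field.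
have -> : Q tau 0 (1 / 2) 0 (- (1) / 2) = - nome (tau / 2).
  rewrite nome_half_Q. apply: (Q_opp (-1)); field.
apply: clim_ext (clim_mult _ _ _ _ K2 Ki) => N.
rewrite -oddprod_poch nome_half_sqr -{1}(nome_half_sqr tau) -oddprod_opp.
have N1 : oddprod (nome (tau / 2)) N <> 0.
  move=> E. have := oddprod_poch (nome (tau / 2)) N. rewrite E Cmult_0_l => E0.
  by case: (poch_nz _ (2 * N) (Cmod_nome _ Hh)).
have N3 := poch_nz _ N (Cmod_nome _ H). by field.
Qed.

(** Jacobi's relation: the product of the three even theta constants is 2 eta^3. *)
Lemma theta_null_product tau : (0 < Im tau)%R ->
  Sum (fun n => Q tau 0 (IZR n ^ 2 / 2) 0 0) * Sum (fun n => Q tau 0 (IZR n ^ 2 / 2) 0 (IZR n / 2)) *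
  Sum (fun n => Q tau 0 ((IZR n + 1 / 2) ^ 2 / 2) 0 0) = 2 * Q tau 0 (1 / 8) 0 0 * qinf (nome tau) ^ 3.
Proof.
move=> H. have [Lq Nq] := poch_cv _ (Cmod_nome tau H).
have Hh : (0 < Im (tau / 2))%R by rewrite Im_half; lra.
have H2 : (0 < Im (2 * tau))%R by rewrite Im_double; lra.
have [Lh Nh] := poch_cv _ (Cmod_nome _ Hh). have [L2 N2] := poch_cv _ (Cmod_nome _ H2).
rewrite theta00_null_sum // theta01_null_sum // theta10_null_sum //. by field.
Qed.

(** * Theta functions *)

Lemma absum_theta tau z (al : R) (D : Z -> R) : (0 < Im tau)%R ->
  absum (fun n => Q tau z ((IZR n + al) ^ 2 / 2) (IZR n + al) (D n)).
Proof.
move=> H. apply: absum_ext (absum_Q tau z (1 / 2) al (al ^ 2 / 2) 1 al D H ltac:(lra)) => n.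
congr Q; field.
Qed.

Lemma vartheta_Sum tau z (a b : nat) : (0 < Im tau)%R ->
  vartheta a b tau z =
  Sum (fun n => Q tau z ((IZR n + INR a / 2) ^ 2 / 2) (IZR n + INR a / 2) ((IZR n + INR a / 2) * (INR b / 2))).
Proof.
move=> H. rewrite -ZSeries_Sum; last exact: absum_theta.
apply: ZSeries_ext => n. rewrite /Q. congr Cexp.
rewrite RtoC_mult !RtoC_div; try lra. rewrite RtoC_pow RtoC_plus RtoC_div; last lra. field.
Qed.

Lemma vartheta00 tau z : (0 < Im tau)%R ->
  vartheta 0 0 tau z = Sum (fun n => Q tau z (IZR n ^ 2 / 2) (IZR n) 0).
Proof. move=> H. rewrite vartheta_Sum //=. apply: Sum_ext => n. congr Q; field. Qed.

Lemma vartheta01 tau z : (0 < Im tau)%R ->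
  vartheta 0 1 tau z = Sum (fun n => Q tau z (IZR n ^ 2 / 2) (IZR n) (IZR n / 2)).
Proof. move=> H. rewrite vartheta_Sum //=. apply: Sum_ext => n. congr Q; field. Qed.

Lemma vartheta10 tau z : (0 < Im tau)%R ->
  vartheta 1 0 tau z = Sum (fun n => Q tau z ((IZR n + 1 / 2) ^ 2 / 2) (IZR n + 1 / 2) 0).
Proof. move=> H. rewrite vartheta_Sum //=. apply: Sum_ext => n. congr Q; field. Qed.

Lemma vartheta11 tau z : (0 < Im tau)%R ->
  vartheta 1 1 tau z = Sum (fun n => Q tau z ((IZR n + 1 / 2) ^ 2 / 2) (IZR n + 1 / 2) ((IZR n + 1 / 2) / 2)).
Proof. move=> H. rewrite vartheta_Sum //=. apply: Sum_ext => n. congr Q; field. Qed.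

Lemma absum_theta0 tau z (D : Z -> R) : (0 < Im tau)%R ->
  absum (fun n => Q tau z (IZR n ^ 2 / 2) (IZR n) (D n)).
Proof. move=> H. apply: absum_ext (absum_theta tau z 0 D H) => n. by rewrite Rplus_0_r. Qed.

(** * Products of theta series *)

(** Pairs of integers are split by the parity of their sum; half sum and half difference diagonalise
    the form, a^2 + b^2 = 2 p^2 + 2 r^2. *)
Lemma Sum_parity (f g : Z -> C) : absum f -> absum g ->
  Sum f * Sum g = Sum (fun p : Z * Z => f (fst p + snd p)%Z * g (fst p - snd p)%Z)
     + Sum (fun p : Z * Z => f (fst p + snd p + 1)%Z * g (fst p - snd p)%Z).
Proof.
move=> Hf Hg. rewrite Sum_prod //.
rewrite (Sum_split (fun p : Z * Z => (fst p + snd p, fst p - snd p)%Z)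
  (fun p : Z * Z => (fst p + snd p + 1, fst p - snd p)%Z)) //.
- exact: absum_prod.
- move=> [x1 x2] [y1 y2] /= [E1 E2]. congr pair; lia.
- move=> [x1 x2] [y1 y2] /= [E1 E2]. congr pair; lia.
- move=> [x1 x2] [y1 y2] /= [E1 E2]. lia.
- move=> [a b]. have [k [E|E]] : exists k, (a + b = 2 * k \/ a + b = 2 * k + 1)%Z.
    exists ((a + b) / 2)%Z. have := Z.div_mod (a + b) 2 ltac:(lia). have := Z.mod_pos_bound (a + b) 2 ltac:(lia). lia.
  + left. exists (k, a - k)%Z => /=. congr pair; lia.
  + right. exists (k, a - k - 1)%Z => /=. congr pair; lia.
Qed.

Lemma Sum_odd (f : Z -> C) (k : Z) : absum f -> (forall n, f (k - n)%Z = - f n) -> Sum f = 0.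
Proof.
move=> A H. have E : Sum f = - Sum f.
  rewrite {1}(Sum_neg f k) // (Sum_ext _ (fun n => (-1) * f n)); last by move=> n; rewrite H; ring.
  rewrite Sum_scal //; ring.
have E2 : Sum f + Sum f = 0 by rewrite {1}E; ring.
have -> : Sum f = / 2 * (Sum f + Sum f) by field. rewrite E2; ring.
Qed.

Lemma absum_sq tau z (al : R) (c d : R) (D : Z -> R) : (0 < Im tau)%R ->
  absum (fun n => Q tau z ((IZR n + al) ^ 2) (c * IZR n + d) (D n)).
Proof.
move=> H. apply: absum_ext (absum_Q tau z 1 (2 * al) (al ^ 2) c d D H ltac:(lra)) => n.
congr Q; field.
Qed.

(** The duplication formula for vartheta_00 (b = 0) and vartheta_01 (b = 1); the phase b/2 is the
    sign of the term from the odd sublattice. *)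
Lemma theta_square tau z (b : Z) : (0 < Im tau)%R ->
  Sum (fun n => Q tau z (IZR n ^ 2 / 2) (IZR n) (IZR b * IZR n / 2)) ^ 2 =
  Sum (fun n => Q (2 * tau) 0 (IZR n ^ 2 / 2) 0 0) * vartheta 0 0 (2 * tau) (2 * z)
  + Q tau z 0 0 (IZR b / 2) *
    (Sum (fun n => Q (2 * tau) 0 ((IZR n + 1 / 2) ^ 2 / 2) 0 0) * vartheta 1 0 (2 * tau) (2 * z)).
Proof.
move=> H. have H2 : (0 < Im (2 * tau))%R by rewrite Im_double; lra.
rewrite vartheta00 // vartheta10 //.
have -> (f : C) : f ^ 2 = f * f by ring.
have A := absum_theta0 tau z (fun n => IZR b * IZR n / 2)%R H.
have D1 A' B D : Q (2 * tau) 0 A' 0 0 = Q tau z (2 * A') 0 0 /\ Q (2 * tau) (2 * z) A' B D = Q tau z (2 * A') (2 * B) D.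
  rewrite /Q; split; congr Cexp; rewrite !RtoC_mult; ring.
rewrite Sum_parity //. congr (_ + _).
- rewrite (Cmult_comm (Sum _)) Sum_prod; [|exact: absum_theta0|].
    apply: Sum_ext => -[p r] /=. rewrite (proj1 (D1 _ 0%R 0%R)) (proj2 (D1 _ _ _)) !Q_mult.
    apply: (Q_eq (b * p)); rewrite ?mult_IZR ?minus_IZR ?plus_IZR; field.
  apply: absum_ext (absum_sq tau z 0 0 0 (fun _ => 0%R) H) => n.
  rewrite (proj1 (D1 _ 0%R 0%R)). congr Q; field.
- rewrite (Cmult_comm (Sum _)) Sum_prod; [|exact: absum_theta|].
    rewrite -Sum_scal; last first.
      apply: (absum_prod (fun n => Q (2 * tau) (2 * z) ((IZR n + 1 / 2) ^ 2 / 2) (IZR n + 1 / 2) 0)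
        (fun n => Q (2 * tau) 0 ((IZR n + 1 / 2) ^ 2 / 2) 0 0)); first exact: absum_theta.
      apply: absum_ext (absum_sq tau z (1 / 2) 0 0 (fun _ => 0%R) H) => n.
      rewrite (proj1 (D1 _ 0%R 0%R)). congr Q; field.
    apply: Sum_ext => -[p r] /=. rewrite (proj1 (D1 _ 0%R 0%R)) (proj2 (D1 _ _ _)) !Q_mult.
    apply: (Q_eq (b * p)); rewrite ?mult_IZR ?minus_IZR ?plus_IZR; field.
  apply: absum_ext (absum_sq tau z (1 / 2) 0 0 (fun _ => 0%R) H) => n.
  rewrite (proj1 (D1 _ 0%R 0%R)). congr Q; field.
Qed.

(* With e = [ecoef], h = [hcoef] and c = m + 1/2, the recursion
   h_(m-1) + h_m = e_(m-1) - e_m makes Sum_m h_m x^c the Laurent expansion of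
   (x - 1) / (x + 1) * Sum_m e_m x^c. *)
Definition ecoef (tau : C) (n : Z) : C := Q tau 0 ((IZR n + 1 / 2) ^ 2 / 2) 0 0.
(** The tail t_n = e_n - e_{n+1} + e_{n+2} - ... solves t_n + t_{n+1} = e_n, so h = 2t - e satisfies
    the required recursion; among its solutions, which differ by multiples of (-1)^n, it is the one
    decaying at +infinity. *)
Definition tail_term (tau : C) (n k : Z) : C :=
  if (k <? 0)%Z then 0 else Q tau 0 ((IZR (n + k) + 1 / 2) ^ 2 / 2) 0 (IZR k / 2).
Definition tail_sum (tau : C) (n : Z) : C := Sum (tail_term tau n).
Definition hcoef (tau : C) (n : Z) : C := 2 * tail_sum tau n - ecoef tau n.

Lemma Q_z0 tau z A D : Q tau 0 A 0 D = Q tau z A 0 D.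
Proof. rewrite /Q. congr Cexp. ring. Qed.

Lemma absum_tail_term tau n : (0 < Im tau)%R -> absum (tail_term tau n).
Proof.
move=> H. apply: (absum_le _ (fun k => Q tau 0 ((IZR k + (IZR n + 1 / 2)) ^ 2 / 2) 0 (IZR k / 2)) 1); first lra.
  apply: absum_ext (absum_Q tau 0 (1 / 2) (IZR n + 1 / 2) ((IZR n + 1 / 2) ^ 2 / 2) 0 0 (fun k => IZR k / 2)%R H ltac:(lra)) => k.
  congr Q; field.
move=> k. rewrite /tail_term. case: Z.ltb_spec => _; first by rewrite Cmod_0 Rmult_1_l; exact: Cmod_ge_0.
rewrite Rmult_1_l. right. congr Cmod. congr Q. rewrite plus_IZR. field.
Qed.

Lemma tail_sum_rec tau n : (0 < Im tau)%R -> tail_sum tau n + tail_sum tau (n + 1) = ecoef tau n.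
Proof.
move=> H. rewrite /tail_sum (Sum_shift (tail_term tau (n + 1)) (-1)); last exact: absum_tail_term.
rewrite -Sum_plus; [|exact: absum_tail_term|apply: (absum_shift (tail_term tau (n + 1))); exact: absum_tail_term].
rewrite (Sum_finsupp _ (0%Z :: nil)).
- have E1 : tail_term tau n 0 = ecoef tau n.
    rewrite /tail_term /ecoef Z.add_0_r. cbn [Z.ltb Z.compare]. congr Q; field.
  have E2 : tail_term tau (n + 1) (0 + -1) = 0 by [].
  rewrite /csum; cbn [fold_right]. rewrite E1 E2. ring.
- constructor => //. by constructor.
move=> k Hk. rewrite /tail_term. case: Z.ltb_spec => K1; case: Z.ltb_spec => K2; try lia; first ring.
  case: Hk. left. lia.
rewrite (Q_opp (-1) tau 0 ((IZR (n + 1 + (k + -1)) + 1 / 2) ^ 2 / 2) 0 (IZR (k + -1) / 2)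
   ((IZR (n + k) + 1 / 2) ^ 2 / 2) 0 (IZR k / 2)) //; rewrite ?plus_IZR; [ring | field | field].
Qed.

Lemma hcoef_rec tau n : (0 < Im tau)%R ->
  hcoef tau (n - 1) + hcoef tau n = ecoef tau (n - 1) - ecoef tau n.
Proof.
move=> H. have := tail_sum_rec tau (n - 1) H. rewrite Z.sub_add => E.
rewrite /hcoef -E. ring.
Qed.

Lemma ecoef_sym tau n : ecoef tau (- n - 1) = ecoef tau n.
Proof. rewrite /ecoef. congr Q. rewrite minus_IZR opp_IZR. field. Qed.

(** Induction from h_{-1} + h_0 = e_{-1} - e_0 = 0. This gives the decay of h at -infinity, which
    the tails do not show, and later the oddness of W. *)
Lemma hcoef_odd tau n : (0 < Im tau)%R -> hcoef tau (- n - 1) = - hcoef tau n.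
Proof.
move=> H.
have key k : hcoef tau (- Z.of_nat k - 1) + hcoef tau (Z.of_nat k) = 0.
  elim: k => [|k IH].
    have := hcoef_rec tau 0 H. rewrite -(ecoef_sym tau 0) /= => ->. ring.
  have E1 := hcoef_rec tau (- Z.of_nat k - 1) H. have E2 := hcoef_rec tau (Z.of_nat (S k)) H.
  have E3 : (Z.of_nat (S k) - 1 = Z.of_nat k)%Z by lia. rewrite E3 in E2.
  have E4 : (- Z.of_nat k - 1 - 1 = - Z.of_nat (S k) - 1)%Z by lia. rewrite E4 !ecoef_sym in E1.
  have -> : hcoef tau (- Z.of_nat (S k) - 1) + hcoef tau (Z.of_nat (S k)) =
    (hcoef tau (- Z.of_nat (S k) - 1) + hcoef tau (- Z.of_nat k - 1)) +
    (hcoef tau (Z.of_nat k) + hcoef tau (Z.of_nat (S k))) -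
    (hcoef tau (- Z.of_nat k - 1) + hcoef tau (Z.of_nat k)) by ring.
  rewrite E1 E2 IH. ring.
have key2 m : (0 <= m)%Z -> hcoef tau (- m - 1) = - hcoef tau m.
  move=> Hm. have := key (Z.to_nat m). rewrite Z2Nat.id // => E.
  have -> : hcoef tau (- m - 1) = hcoef tau (- m - 1) + hcoef tau m - hcoef tau m by ring.
  rewrite E. ring.
case: (Z_lt_le_dec n 0) => K; last exact: key2.
have := key2 (- n - 1)%Z ltac:(lia). have -> : (- (- n - 1) - 1 = n)%Z by lia. move=> ->. ring.
Qed.

(** For n, k >= 0, (n + k + 1/2)^2 >= (n + 1/2)^2 + k^2, so the tail is at most e_n times a
    convergent theta series; oddness covers n < 0. *)
Lemma hcoef_bound tau : (0 < Im tau)%R ->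
  exists K, (0 <= K)%R /\ forall n, (Cmod (hcoef tau n) <= K * Cmod (ecoef tau n))%R.
Proof.
move=> H. have HP := PI_RGT_0.
have A : absum (fun k => Q tau 0 (IZR k ^ 2 / 2) 0 0).
  apply: absum_ext (absum_Q tau 0 (1 / 2) 0 0 0 0 (fun _ => 0%R) H ltac:(lra)) => k. congr Q; field.
have [M HM] := A.
have HM0 : (0 <= M)%R by apply: Rle_trans (HM nil (NoDup_nil _)); rewrite /=; lra.
have key n : (0 <= n)%Z -> (Cmod (hcoef tau n) <= (2 * M + 1) * Cmod (ecoef tau n))%R.
  move=> Hn. have T : (Cmod (tail_sum tau n) <= Cmod (ecoef tau n) * M)%R.
    apply: Cmod_Sum_le; first exact: absum_tail_term. move=> L N.
    apply: Rle_trans (rsum_le _ (fun k => Cmod (ecoef tau n) * Cmod (Q tau 0 (IZR k ^ 2 / 2) 0 0))%R L _) _.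
      move=> k. rewrite /tail_term. case: Z.ltb_spec => Hk.
        rewrite Cmod_0. apply: Rmult_le_pos; exact: Cmod_ge_0.
      rewrite /ecoef !Cmod_Q -exp_plus. apply: exp_le_compat. rewrite plus_IZR.
      have P1 : (0 <= IZR n)%R by apply: IZR_le. have P2 : (0 <= IZR k)%R by apply: IZR_le.
      have P3 := Rmult_le_pos _ _ P1 P2.
      have P4 : (0 <= PI * Im tau * (2 * (IZR n * IZR k) + IZR k))%R.
        apply: Rmult_le_pos; last lra. apply: Rmult_le_pos; lra.
      move: P4. rewrite !Rmult_0_l. lra.
    rewrite rsum_scal. apply: Rmult_le_compat_l; [exact: Cmod_ge_0 | exact: HM].
  rewrite /hcoef. apply: Rle_trans (Cmod_triangle _ _) _.
  rewrite Cmod_mult Cmod_opp Cmod_R Rabs_pos_eq; lra.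
exists (2 * M + 1)%R. split; first lra. move=> n.
case: (Z_lt_le_dec n 0) => K; last exact: key.
have := key (- n - 1)%Z ltac:(lia). by rewrite hcoef_odd // Cmod_opp ecoef_sym.
Qed.

(** * The Appell-Lerch sum times vartheta_00 *)

Definition half (n : Z) : R := (IZR n + 1 / 2)%R.

Definition Hterm (tau z : C) (n m : Z) : C :=
  hcoef tau m * Q tau z (half m * half n) (half m) 0.

Lemma absum_Eterm tau z n : (0 < Im tau)%R ->
  absum (fun m => ecoef tau m * Q tau z (half m * half n) (half m) 0).
Proof.
move=> H. apply: absum_ext (absum_Q tau z (1 / 2) (half n + 1 / 2) (1 / 2 * half n + 1 / 8) 1 (1 / 2) (fun _ => 0%R) H ltac:(lra)) => m.
rewrite /ecoef (Q_z0 tau z) Q_mult /half. congr Q; field.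
Qed.

Lemma absum_Hterm tau z n : (0 < Im tau)%R -> absum (Hterm tau z n).
Proof.
move=> H. have [K [K0 HK]] := hcoef_bound tau H.
apply: (absum_le _ _ K K0 (absum_Eterm tau z n H)) => m.
rewrite /Hterm !Cmod_mult -Rmult_assoc. apply: Rmult_le_compat_r; [exact: Cmod_ge_0 | exact: HK].
Qed.

(** Completing the square with c = [half m] and a = [half n]: c^2/2 + a c = (a + c)^2/2 - a^2/2, and
    a + c = m + n + 1 is an integer. *)
Lemma Sum_Eterm tau z n : (0 < Im tau)%R ->
  Sum (fun m => ecoef tau m * Q tau z (half m * half n) (half m) 0) =
  Q tau z (- half n ^ 2 / 2) (- half n) 0 * vartheta 0 0 tau z.
Proof.
move=> H. rewrite vartheta00 // (Sum_shift (fun n => Q tau z (IZR n ^ 2 / 2) (IZR n) 0) (n + 1)); last exact: absum_theta0.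
rewrite -Sum_scal; last by apply: (absum_shift (fun n => Q tau z (IZR n ^ 2 / 2) (IZR n) 0)); exact: absum_theta0.
apply: Sum_ext => m. rewrite /ecoef (Q_z0 tau z) !Q_mult /half. congr Q; rewrite ?plus_IZR; field.
Qed.

(** Multiplication by x_a shifts m by one, after which the recursion of h applies termwise. Stated
    without division, the relation also holds at the pole x_a = -1. *)
Lemma Hsum_rel tau z n : (0 < Im tau)%R ->
  (1 + Q tau z (half n) 1 0) * Sum (Hterm tau z n) =
  (Q tau z (half n) 1 0 - 1) * (Q tau z (- half n ^ 2 / 2) (- half n) 0 * vartheta 0 0 tau z).
Proof.
move=> H. rewrite -Sum_Eterm //.
have sh (g : Z -> C) : absum (fun m => g m * Q tau z (half m * half n) (half m) 0) ->
    absum (fun m => g (m - 1)%Z * Q tau z (half m * half n) (half m) 0) /\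
    Q tau z (half n) 1 0 * Sum (fun m => g m * Q tau z (half m * half n) (half m) 0) =
    Sum (fun m => g (m - 1)%Z * Q tau z (half m * half n) (half m) 0).
  move=> A.
  have E m : Q tau z (half n) 1 0 * (g (m + -1)%Z * Q tau z (half (m + -1) * half n) (half (m + -1)) 0) =
      g (m - 1)%Z * Q tau z (half m * half n) (half m) 0.
    rewrite (_ : (m + -1 = m - 1)%Z) //.
    rewrite Cmult_assoc (Cmult_comm (Q _ _ _ _ _)) -Cmult_assoc Q_mult. congr (_ * _).
    congr Q; rewrite /half ?minus_IZR ?plus_IZR; field.
  have A' := absum_shift _ (-1) A. split.
    by apply: absum_ext (absum_scal (Q tau z (half n) 1 0) _ A') => m.
  rewrite (Sum_shift _ (-1) A) -Sum_scal //. by apply: Sum_ext.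
have [A1 E1] := sh _ (absum_Hterm tau z n H). have [A2 E2] := sh _ (absum_Eterm tau z n H).
have AH := absum_Hterm tau z n H. have AE := absum_Eterm tau z n H.
rewrite !Cmult_plus_distr_r Cmult_1_l E2. rewrite [Q _ _ _ _ _ * _]E1 -Sum_plus //.
rewrite -Sum_scal // -Sum_plus //; last exact: absum_scal.
apply: Sum_ext => m.
rewrite /Hterm. have := hcoef_rec tau m H => E.
transitivity ((hcoef tau (m - 1) + hcoef tau m) * Q tau z (half m * half n) (half m) 0); first ring.
rewrite E. ring.
Qed.

(** The expansion h_m x_a^c of the quotient, times q^{a^2} e(2 a z) from the Appell sum and
    q^{a^2/2} e(a z), which undoes the factor of [Sum_Eterm]. *)
Definition double_term (tau z : C) (p : Z * Z) : C :=
  hcoef tau (snd p) *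
  Q tau z (3 / 2 * half (fst p) ^ 2 + half (fst p) * half (snd p)) (3 * half (fst p) + half (snd p)) 0.

Lemma double_term_Hterm tau z n m :
  double_term tau z (n, m) = Q tau z (3 / 2 * half n ^ 2) (3 * half n) 0 * Hterm tau z n m.
Proof.
rewrite /double_term /Hterm /= Cmult_assoc (Cmult_comm (Q _ _ _ _ _)) -Cmult_assoc Q_mult.
congr (_ * _). congr Q; ring.
Qed.

(* 3a^2/2 + ac + c^2/2 >= a^2/2 + c^2/4 *)
Lemma absum_double_term tau z : (0 < Im tau)%R -> absum (double_term tau z).
Proof.
move=> H. have [K [K0 HK]] := hcoef_bound tau H. have HP := PI_RGT_0.
pose f n := Q tau z (1 / 2 * half n ^ 2) (3 * half n) 0.
pose g n := Q tau z (1 / 4 * half n ^ 2) (half n) 0.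
have Af : absum f.
  apply: absum_ext (absum_Q tau z (1 / 2) (1 / 2) (1 / 8) 3 (3 / 2) (fun _ => 0%R) H ltac:(lra)) => m.
  rewrite /f /half. congr Q; field.
have Ag : absum g.
  apply: absum_ext (absum_Q tau z (1 / 4) (1 / 4) (1 / 16) 1 (1 / 2) (fun _ => 0%R) H ltac:(lra)) => m.
  rewrite /g /half. congr Q; field.
apply: (absum_le _ _ K K0 (absum_prod f g Af Ag)) => -[n m].
rewrite /double_term /f /g Cmod_mult. cbn [fst snd].
apply: Rle_trans (Rmult_le_compat_r _ _ _ (Cmod_ge_0 _) (HK m)) _.
rewrite Rmult_assoc. apply: Rmult_le_compat_l => //.
rewrite /ecoef -!Cmod_mult (Q_z0 tau z) !Q_mult !Cmod_Q. apply: exp_le_compat.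
rewrite -/(half m). set a := half n. set c := half m. set y := Im tau in H *. set v := Im z.
have : (0 <= PI * y * (a + c / 2) ^ 2)%R.
  apply: Rmult_le_pos; last exact: pow2_ge_0. apply: Rmult_le_pos; lra.
lra.
Qed.

Definition double_sum (tau z : C) : C := Sum (double_term tau z).

Lemma double_sum_fibres tau z : (0 < Im tau)%R ->
  absum (fun n => Q tau z (3 / 2 * half n ^ 2) (3 * half n) 0 * Sum (Hterm tau z n)) /\
  double_sum tau z = Sum (fun n => Q tau z (3 / 2 * half n ^ 2) (3 * half n) 0 * Sum (Hterm tau z n)).
Proof.
move=> H. have A := absum_double_term tau z H.
have E n : Sum (fun m => double_term tau z (n, m)) = Q tau z (3 / 2 * half n ^ 2) (3 * half n) 0 * Sum (Hterm tau z n).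
  rewrite -Sum_scal; last exact: absum_Hterm. apply: Sum_ext => m. exact: double_term_Hterm.
split; first by apply: absum_ext (absum_fibre_Sum _ A).
rewrite /double_sum Sum_fubini //. by apply: Sum_ext.
Qed.

Definition appell_term (tau z : C) (n : Z) : C :=
  Q tau z (half n ^ 2) (2 * half n) 0 *
  ((Q tau z (half n) 1 0 - 1) / (Q tau z (half n) 1 0 + 1)).

Lemma appell_term_Hterm tau z n : (0 < Im tau)%R -> Q tau z (half n) 1 0 + 1 <> 0 ->
  Q tau z (3 / 2 * half n ^ 2) (3 * half n) 0 * Sum (Hterm tau z n) = vartheta 0 0 tau z * appell_term tau z n.
Proof.
move=> H Hn. have E := Hsum_rel tau z n H.
have -> : Sum (Hterm tau z n) = (1 + Q tau z (half n) 1 0) * Sum (Hterm tau z n) / (Q tau z (half n) 1 0 + 1) by field.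
rewrite E /appell_term.
have -> : Q tau z (half n ^ 2) (2 * half n) 0 = Q tau z (3 / 2 * half n ^ 2) (3 * half n) 0 * Q tau z (- half n ^ 2 / 2) (- half n) 0.
  rewrite Q_mult. congr Q; field.
by field.
Qed.

(** Summability of the Appell sum is inherited from the fibre sums of the double series, so the
    denominators 1 + x_a are never estimated. *)
Lemma double_sum_appell_term tau z : (0 < Im tau)%R -> vartheta 0 0 tau z <> 0 ->
  (forall n, Q tau z (half n) 1 0 + 1 <> 0) ->
  absum (appell_term tau z) /\ double_sum tau z = vartheta 0 0 tau z * Sum (appell_term tau z).
Proof.
move=> H Ht Hn. have [A E] := double_sum_fibres tau z H.
have AA : absum (appell_term tau z).
  apply: absum_ext (absum_scal (/ vartheta 0 0 tau z) _ A) => n. rewrite appell_term_Hterm //. by field.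
split=> //. rewrite E -Sum_scal //. apply: Sum_ext => n. exact: appell_term_Hterm.
Qed.

(** The reflection k -> 2n + 1 - k multiplies the k-th term by an odd power of x_a = -1, so the
    theta series equals its own opposite. Conversely, vartheta_00 nonzero excludes all poles. *)
Lemma vartheta00_zero tau z n : (0 < Im tau)%R -> Q tau z (half n) 1 0 + 1 = 0 -> vartheta 0 0 tau z = 0.
Proof.
move=> H E. rewrite vartheta00 //. apply: (Sum_odd _ (2 * n + 1)); first exact: absum_theta0.
move=> k. have E1 : Q tau z (half n) 1 0 = Q tau z 0 0 (1 / 2).
  rewrite Q_half_phase. transitivity (Q tau z (half n) 1 0 + 1 - 1); [ring | rewrite E; ring].
have key m : Q tau z (half n) 1 0 ^ m = Q tau z 0 0 (INR m / 2).
  rewrite E1 Q_pow. congr Q; field.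
have keyZ (j : Z) : Q tau z (IZR j * half n) (IZR j) 0 = Q tau z 0 0 (IZR j / 2).
  have P m : Q tau z (INR m * half n) (INR m) 0 = Q tau z 0 0 (INR m / 2).
    rewrite -key Q_pow. congr Q; ring.
  case: (Z_lt_le_dec j 0) => Hj; last first.
    rewrite -(Z2Nat.id j) // -INR_IZR_INZ. exact: P.
  have Ej : IZR j = (- INR (Z.to_nat (- j)))%R by rewrite INR_IZR_INZ Z2Nat.id ?opp_IZR; [ring | lia].
  rewrite Ej. set m := Z.to_nat _.
  have -> : Q tau z (- INR m * half n) (- INR m) 0 = / Q tau z (INR m * half n) (INR m) 0.
    rewrite Q_inv. congr Q; ring.
  rewrite P Q_inv. congr Q; field.
have -> : Q tau z (IZR (2 * n + 1 - k) ^ 2 / 2) (IZR (2 * n + 1 - k)) 0 =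
  Q tau z (IZR (2 * n + 1 - 2 * k) * half n) (IZR (2 * n + 1 - 2 * k)) 0 * Q tau z (IZR k ^ 2 / 2) (IZR k) 0.
  rewrite Q_mult /half. congr Q; rewrite ?minus_IZR ?plus_IZR ?mult_IZR; field.
rewrite keyZ Q_mult. apply: (Q_opp (n - k)); rewrite ?minus_IZR ?plus_IZR ?mult_IZR; field.
Qed.

(** * Reduction to a single theta series modulo 3 *)

(** The coefficient W_N of q^{N^2/6} e(N z) in the double series: N = 3a + c means m = N - 3n - 2,
    and 3a^2/2 + a c = N^2/6 - c^2/6. *)
Definition Wcoef (tau : C) (N : Z) : C :=
  Sum (fun n => hcoef tau (N - 3 * n - 2) * Q tau 0 (- half (N - 3 * n - 2) ^ 2 / 6) 0 0).

(** The nontrivial Dirichlet character modulo 3, up to a scalar the only odd 3-periodic function on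
    Z. *)
Definition chi3 (N : Z) : C :=
  match (N mod 3)%Z with 0%Z => 0 | 1%Z => 1 | _ => - (1) end.

Lemma chi3_periodic_odd (W : Z -> C) : (forall N, W (N + 3)%Z = W N) -> (forall N, W (- N)%Z = - W N) ->
  forall N, W N = chi3 N * W 1%Z.
Proof.
move=> Hp Ho N.
have Hp2 (k : nat) M : W (M + 3 * Z.of_nat k)%Z = W M.
  elim: k => [|k IH]; first by rewrite Z.add_0_r.
  have -> : (M + 3 * Z.of_nat (S k) = (M + 3 * Z.of_nat k) + 3)%Z by lia. by rewrite Hp.
have Hp3 (k : Z) M : W (M + 3 * k)%Z = W M.
  case: (Z_lt_le_dec k 0) => Hk.
    rewrite -(Hp2 (Z.to_nat (- k)) (M + 3 * k)%Z). congr W. lia.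
  rewrite -(Hp2 (Z.to_nat k) M). congr W. lia.
have E0 : W 0%Z = 0.
  have E := Ho 0%Z. simpl in E. have E2 : W 0%Z + W 0%Z = 0 by rewrite {1}E; ring.
  have -> : W 0%Z = / 2 * (W 0%Z + W 0%Z) by field. rewrite E2; ring.
have E2 : W 2%Z = - W 1%Z by rewrite -(Ho 1%Z) -(Hp (- (1))%Z).
rewrite {1}(Z.div_mod N 3) // Z.add_comm Hp3 /chi3.
have := Z.mod_pos_bound N 3 ltac:(lia). move: (N mod 3)%Z => r Hr.
have [->|[->|->]] : (r = 0 \/ r = 1 \/ r = 2)%Z by lia.
- rewrite E0; ring.
- ring.
- rewrite E2; ring.
Qed.

Definition Theta3 (tau z : C) : C := Sum (fun N => chi3 N * Q tau z (IZR N ^ 2 / 6) (IZR N) 0).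

Lemma absum_Theta3 tau z : (0 < Im tau)%R -> absum (fun N => chi3 N * Q tau z (IZR N ^ 2 / 6) (IZR N) 0).
Proof.
move=> H. apply: (absum_le _ (fun N => Q tau z (1 / 6 * IZR N ^ 2 + 0 * IZR N + 0) (1 * IZR N + 0) 0) 1); first lra.
  apply: absum_Q => //; lra.
move=> N. rewrite Cmod_mult. have -> : Q tau z (1 / 6 * IZR N ^ 2 + 0 * IZR N + 0) (1 * IZR N + 0) 0 = Q tau z (IZR N ^ 2 / 6) (IZR N) 0.
  congr Q; field.
apply: Rmult_le_compat_r; first exact: Cmod_ge_0.
rewrite /chi3. case: (N mod 3)%Z => [|[p|p|]|p]; rewrite ?Cmod_opp ?Cmod_1 ?Cmod_0; lra.
Qed.

(* Collecting the terms of [F] on the lines [phi N] in powers of z. *)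
Lemma collect_Theta3 tau z (F : Z * Z -> C) (phi : Z -> Z -> Z) (psi : Z -> Z -> Z)
    (G : Z -> Z -> C) : (0 < Im tau)%R ->
  absum F -> (forall N n, psi n (phi N n) = N) -> (forall n m, phi (psi n m) n = m) ->
  (forall N n, F (n, phi N n) = Q tau z (IZR N ^ 2 / 6) (IZR N) 0 * G N n) ->
  (forall N n, G (N + 3)%Z (n + 1)%Z = G N n) -> (exists k, forall N n, G (- N)%Z (k - n)%Z = - G N n) ->
  Sum F = Sum (G 1%Z) * Theta3 tau z.
Proof.
move=> H A K1 K2 E Hp [k Ho].
have AG N : absum (G N).
  have A1 : absum (fun n => F (n, phi N n)).
    apply: (absum_inj (fun n => (n, phi N n)) F) => // x y [] //.
  apply: absum_ext (absum_scal (/ Q tau z (IZR N ^ 2 / 6) (IZR N) 0) _ A1) => n.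
  rewrite E. have K := Q_nz tau z (IZR N ^ 2 / 6) (IZR N) 0. by field.
have A' : absum (fun p : Z * Z => F (snd p, phi (fst p) (snd p))).
  apply: (absum_inj (fun p => (snd p, phi (fst p) (snd p))) F) => // -[N n] [N' n'] /= [E1].
  rewrite E1 => E2. rewrite -(K1 N n') E2 K1. by [].
rewrite (Sum_reindex (fun p => (snd p, phi (fst p) (snd p))) (fun p => (psi (fst p) (snd p), fst p))) //; first last.
- move=> [n m] /=. by rewrite K2.
- move=> [N n] /=. by rewrite K1.
rewrite Sum_fubini // /Theta3 -Sum_scal; last exact: absum_Theta3.
apply: Sum_ext => N. cbn [fst snd].
rewrite (Sum_ext (fun b => F (b, phi N b)) (fun b => Q tau z (IZR N ^ 2 / 6) (IZR N) 0 * G N b)) //.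
rewrite Sum_scal //.
rewrite (chi3_periodic_odd (fun N => Sum (G N)) _ _ N).
- ring.
- move=> M. rewrite (Sum_shift (G (M + 3)%Z) 1) //. apply: Sum_ext => n. exact: Hp.
- move=> M. rewrite (Sum_neg (G (- M)%Z) k) //.
  rewrite (Sum_ext _ (fun n => (-1) * G M n)); last by move=> n; rewrite Ho; ring.
  rewrite Sum_scal //. ring.
Qed.

(** m = N - 3n - 2 is fixed by (N, n) -> (N + 3, n + 1) and becomes -m - 1 under (N, n) -> (-N, -1 -
    n), where h changes sign and c^2 does not. *)
Lemma double_sum_Theta3 tau : (0 < Im tau)%R -> exists w, forall z, double_sum tau z = w * Theta3 tau z.
Proof.
move=> H.
exists (Wcoef tau 1) => z.
apply: (collect_Theta3 tau z (double_term tau z) (fun N n => (N - 3 * n - 2)%Z) (fun n m => (3 * n + m + 2)%Z)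
  (fun N n => hcoef tau (N - 3 * n - 2) * Q tau 0 (- half (N - 3 * n - 2) ^ 2 / 6) 0 0)) => //.
- exact: absum_double_term.
- move=> N n; lia.
- move=> n m; lia.
- move=> N n. rewrite /double_term. cbn [fst snd].
  rewrite (Cmult_comm (Q tau z (IZR N ^ 2 / 6) (IZR N) 0)) -Cmult_assoc. congr (_ * _).
  rewrite (Q_z0 tau z) Q_mult. congr Q; rewrite /half ?minus_IZR ?mult_IZR; field.
- move=> N n. have -> : (N + 3 - 3 * (n + 1) - 2 = N - 3 * n - 2)%Z by lia. by [].
- exists (-1)%Z => N n. have -> : (- N - 3 * (-1 - n) - 2 = - (N - 3 * n - 2) - 1)%Z by lia.
  rewrite hcoef_odd // (_ : half (- (N - 3 * n - 2) - 1) = - half (N - 3 * n - 2))%R.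
    rewrite (_ : (- half (N - 3 * n - 2)) ^ 2 = half (N - 3 * n - 2) ^ 2)%R; last ring. ring.
  rewrite /half minus_IZR opp_IZR. field.
Qed.

Definition theta_product (tau z : C) : C := Ci * (vartheta 1 1 tau z * vartheta 1 0 tau z * vartheta 0 1 tau z).

(** The right side is vartheta_11(2 tau, 2 z) vartheta_01(2 tau, 0). The odd sublattice contributes
    nothing: its factor free of z changes sign under p -> -1 - p. *)
Lemma vartheta10_11 tau z : (0 < Im tau)%R ->
  vartheta 1 0 tau z * vartheta 1 1 tau z =
  Sum (fun p => Q tau z (half p ^ 2) (2 * half p) (half p / 2)) * Sum (fun r => Q tau z (IZR r ^ 2) 0 (- IZR r / 2)).
Proof.
move=> H. rewrite vartheta10 // vartheta11 // Sum_parity; [|exact: absum_theta..].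
have A1 : absum (fun p => Q tau z (half p ^ 2) (2 * half p) (half p / 2)).
  apply: absum_ext (absum_sq tau z (1 / 2) 2 1 (fun p => half p / 2)%R H) => n. rewrite /half; congr Q; field.
have A2 : absum (fun p => Q tau z (IZR p ^ 2) 0 (- IZR p / 2)).
  apply: absum_ext (absum_sq tau z 0 0 0 (fun p => - IZR p / 2)%R H) => n. congr Q; field.
have A3 : absum (fun p => Q tau z (half p ^ 2) 0 (- IZR p / 2)).
  apply: absum_ext (absum_sq tau z (1 / 2) 0 0 (fun p => - IZR p / 2)%R H) => n. rewrite /half. congr Q; field.
have A4 : absum (fun p => Q tau z ((IZR p + 1) ^ 2) (2 * IZR p + 2) (half p / 2)).
  exact: absum_sq.
have -> : Sum (fun p : Z * Z =>
    Q tau z ((IZR (fst p + snd p + 1) + 1 / 2) ^ 2 / 2) (IZR (fst p + snd p + 1) + 1 / 2) 0 *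
    Q tau z ((IZR (fst p - snd p) + 1 / 2) ^ 2 / 2) (IZR (fst p - snd p) + 1 / 2) ((IZR (fst p - snd p) + 1 / 2) / 2)) =
  Sum (fun p => Q tau z ((IZR p + 1) ^ 2) (2 * IZR p + 2) (half p / 2)) *
  Sum (fun p => Q tau z (half p ^ 2) 0 (- IZR p / 2)).
  rewrite Sum_prod //. apply: Sum_ext => -[p r]. cbn [fst snd]. rewrite !Q_mult /half.
  congr Q; rewrite ?minus_IZR ?plus_IZR; field.
rewrite (Sum_odd (fun p => Q tau z (half p ^ 2) 0 (- IZR p / 2)) (-1)) //; last first.
  move=> n. apply: (Q_opp n); rewrite /half ?minus_IZR; field.
rewrite Cmult_0_r Cplus_0_r Sum_prod //. apply: Sum_ext => -[p r]. cbn [fst snd]. rewrite !Q_mult /half.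
congr Q; rewrite ?minus_IZR ?plus_IZR; field.
Qed.

(** Here N = 2a + k with a = [half p] and k the index of vartheta_01, and a^2 + k^2/2 = N^2/6 + 3 (a
    - N/3)^2, which is invariant under (N, p) -> (N + 3, p + 1). *)
Lemma theta_product_Theta3 tau : (0 < Im tau)%R -> exists w, forall z, theta_product tau z = w * Theta3 tau z.
Proof.
move=> H. set kap := Sum (fun r => Q tau 0 (IZR r ^ 2) 0 (- IZR r / 2)).
pose G (N p : Z) := Q tau 0 (3 * (half p - IZR N / 3) ^ 2) 0 ((IZR N - half p) / 2).
exists (Ci * kap * Sum (G 1%Z)) => z.
have -> : theta_product tau z = Ci * kap * (Sum (fun p => Q tau z (half p ^ 2) (2 * half p) (half p / 2)) * vartheta 0 1 tau z).
  rewrite /theta_product (Cmult_comm (vartheta 1 1 tau z)) vartheta10_11 //.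
  rewrite (Sum_ext (fun r => Q tau z (IZR r ^ 2) 0 (- IZR r / 2)) (fun r => Q tau 0 (IZR r ^ 2) 0 (- IZR r / 2))) -/kap; first ring.
  move=> r. by rewrite -Q_z0.
rewrite -[in RHS]Cmult_assoc. congr (_ * _).
have A1 : absum (fun p => Q tau z (half p ^ 2) (2 * half p) (half p / 2)).
  apply: absum_ext (absum_sq tau z (1 / 2) 2 1 (fun p => half p / 2)%R H) => n. rewrite /half; congr Q; field.
have A2 := absum_theta0 tau z (fun n => IZR n / 2)%R H.
rewrite vartheta01 // Sum_prod //.
apply: (collect_Theta3 tau z _ (fun N p => (N - 2 * p - 1)%Z) (fun p k => (2 * p + 1 + k)%Z) G) => //.
- exact: (absum_prod _ _ A1 A2).
- move=> N n; lia.
- move=> N n; lia.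
- move=> N n. cbn [fst snd]. rewrite /G (Q_z0 tau z) !Q_mult /half. congr Q; rewrite ?minus_IZR ?mult_IZR; field.
- move=> N n. rewrite /G. apply: (Q_eq 1); rewrite /half ?plus_IZR; field.
- exists (-1)%Z => N n. rewrite /G. apply: (Q_opp (n - N)); rewrite /half ?minus_IZR ?opp_IZR; field.
Qed.

(** * The value at z = (1 + tau) / 2 *)

Definition zhalf (tau : C) : C := (1 + tau) / 2.

Lemma Q_zhalf tau A B D : Q tau (zhalf tau) A B D = Q tau 0 (A + B / 2) 0 (D + B / 2).
Proof.
rewrite /Q /zhalf. congr Cexp. rewrite !RtoC_plus RtoC_div; last lra. field.
Qed.

Lemma absum_ecoef_phase tau : (0 < Im tau)%R ->
  absum (fun m => IZR m * (ecoef tau m * Q tau 0 0 0 (IZR m / 2))) /\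
  absum (fun m => ecoef tau m * Q tau 0 0 0 (IZR m / 2)).
Proof.
move=> H. have [A1 A2] := absum_lin_Q tau 0 (1 / 2) (1 / 2) (1 / 8) 0 0 (fun m => IZR m / 2)%R H ltac:(lra).
have E m : Q tau 0 (1 / 2 * IZR m ^ 2 + 1 / 2 * IZR m + 1 / 8) (0 * IZR m + 0) (IZR m / 2) =
   ecoef tau m * Q tau 0 0 0 (IZR m / 2).
  rewrite /ecoef Q_mult. congr Q; field.
split; [apply: absum_ext A1 | apply: absum_ext A2] => m; by rewrite E.
Qed.

(* Abel summation of the recursion of [hcoef] against (-1)^m. *)
Lemma Sum_hcoef_alternating tau : (0 < Im tau)%R ->
  Sum (fun m => hcoef tau m * Q tau 0 0 0 (IZR m / 2)) = 2 * Q tau 0 (1 / 8) 0 0 * qinf (nome tau) ^ 3.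
Proof.
move=> H. have [AE1 AE0] := absum_ecoef_phase tau H. have [K [K0 HK]] := hcoef_bound tau H.
pose ep m := ecoef tau m * Q tau 0 0 0 (IZR m / 2).
pose k m := hcoef tau m * Q tau 0 0 0 (IZR m / 2).
have Bk m : (Cmod (k m) <= K * Cmod (ep m))%R.
  rewrite /k /ep !Cmod_mult -Rmult_assoc. apply: Rmult_le_compat_r; [exact: Cmod_ge_0 | exact: HK].
have AK0 : absum k by apply: (absum_le _ _ K K0 AE0).
have AK1 : absum (fun m => IZR m * k m).
  apply: (absum_le _ _ K K0 AE1) => m. rewrite !(Cmod_mult (IZR m)).
  have := Rmult_le_compat_l _ _ _ (Cmod_ge_0 (IZR m)) (Bk m). rewrite /ep; lra.
have sh (g : Z -> C) m : g (m - 1)%Z * Q tau 0 0 0 (IZR m / 2) = - (g (m - 1)%Z * Q tau 0 0 0 (IZR (m - 1) / 2)).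
  rewrite (Q_opp 0 tau 0 0 0 (IZR m / 2) 0 0 (IZR (m - 1) / 2)) //; first ring.
  rewrite minus_IZR. field.
have rec m : k m - k (m - 1)%Z = - ep m - ep (m - 1)%Z.
  rewrite /k /ep.
  transitivity ((hcoef tau (m - 1) + hcoef tau m) * Q tau 0 0 0 (IZR m / 2)).
    rewrite Cmult_plus_distr_r (sh (hcoef tau)). ring.
  rewrite hcoef_rec // /Cminus Cmult_plus_distr_r (sh (ecoef tau)). ring.
have shift1 (g : Z -> C) : absum g -> absum (fun m => IZR m * g m) ->
   absum (fun m => IZR m * g (m - 1)%Z) /\ Sum (fun m => IZR m * g (m - 1)%Z) = Sum (fun m => IZR m * g m) + Sum g.
  move=> G0 G1. have G2 := absum_plus _ _ G1 G0.
  have E m : IZR (m + -1) * g (m + -1)%Z + g (m + -1)%Z = IZR m * g (m - 1)%Z.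
    rewrite plus_IZR RtoC_plus (_ : (m + -1 = m - 1)%Z) //. ring.
  split; first by apply: absum_ext (absum_shift _ (-1) G2).
  rewrite -Sum_plus // (Sum_shift _ (-1) G2). apply: Sum_ext => m. by rewrite -E.
have [S1 E1] := shift1 k AK0 AK1. have [S2 E2] := shift1 ep AE0 AE1.
(* The recursion weighted by m: on the left, summation by parts of m (k_m - k_{m-1}) leaves -
   [Sum k]; on the right it leaves minus the sum of (2m + 1) [ep m], a multiple of Jacobi's
   series. *)
have T : Sum (fun m => IZR m * k m) = Sum (fun m => IZR m * k (m - 1)%Z) +
   ((-1) * Sum (fun m => IZR m * ep m) + (-1) * Sum (fun m => IZR m * ep (m - 1)%Z)).
  rewrite -Sum_scal // -Sum_scal // -Sum_plus; [|exact: absum_scal..].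
  rewrite -Sum_plus //; last by apply: absum_plus; exact: absum_scal.
  apply: Sum_ext => m.
  transitivity (IZR m * (k m - k (m - 1)%Z) + IZR m * k (m - 1)%Z); first ring. rewrite rec. ring.
have E3 : Sum k = 2 * Sum (fun m => IZR m * ep m) + Sum ep.
  transitivity (Sum (fun m => IZR m * k m) + Sum k - Sum (fun m => IZR m * k m)); first ring.
  rewrite {2}T -E1 E2. ring.
change (Sum k = 2 * Q tau 0 (1 / 8) 0 0 * qinf (nome tau) ^ 3).
rewrite E3 -Sum_scal // -Sum_plus //; last exact: absum_scal.
transitivity (Q tau 0 (1 / 8) 0 0 * Sum (fun n => jacobi_coef tau n * (2 * IZR n + 1))); last first.
  rewrite jacobi_identity //. ring.
rewrite -Sum_scal; last first.
  apply: absum_ext (absum_scal (Q tau 0 (- (1 / 8)) 0 0) _ (absum_plus _ _ (absum_scal 2 _ AE1) AE0)) => m.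
  have -> : jacobi_coef tau m = Q tau 0 (- (1 / 8)) 0 0 * (ecoef tau m * Q tau 0 0 0 (IZR m / 2)).
    rewrite /jacobi_coef /ecoef !Q_mult. congr Q; field.
  ring.
apply: Sum_ext => m. rewrite /ep.
have -> : ecoef tau m * Q tau 0 0 0 (IZR m / 2) = Q tau 0 (1 / 8) 0 0 * jacobi_coef tau m.
  rewrite /jacobi_coef /ecoef !Q_mult. congr Q; field.
ring.
Qed.

Lemma vartheta00_zhalf tau : (0 < Im tau)%R -> vartheta 0 0 tau (zhalf tau) = 0.
Proof.
move=> H. apply: (vartheta00_zero _ _ (-1)) => //.
rewrite Q_zhalf (Q_opp 0 tau 0 _ _ _ 0 0 0); rewrite /half; try field.
rewrite Q_0. ring.
Qed.

Lemma double_sum_zhalf tau : (0 < Im tau)%R ->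
  double_sum tau (zhalf tau) = - (2) * Q tau 0 (- (1 / 4)) 0 0 * qinf (nome tau) ^ 3.
Proof.
move=> H. have [_ ->] := double_sum_fibres tau (zhalf tau) H.
rewrite (Sum_finsupp _ ((-1)%Z :: nil)); first last.
- move=> n Hn. have E := Hsum_rel tau (zhalf tau) n H.
  rewrite vartheta00_zhalf // !Cmult_0_r in E.
  (* At this point 1 + x_a = 1 - q^{n+1}, which vanishes only for n = -1. *)
  have N1 : 1 + Q tau (zhalf tau) (half n) 1 0 <> 0.
    rewrite Q_zhalf (Q_opp 0 tau 0 _ _ _ (half n + 1 / 2) 0 0); try ring.
    move=> E0. have E1 : Q tau 0 (half n + 1 / 2) 0 0 = 1.
      transitivity (1 - (1 + - Q tau 0 (half n + 1 / 2) 0 0)); [ring | rewrite E0; ring].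
    have := Cmod_Q tau 0 (half n + 1 / 2) 0 0. rewrite E1 Cmod_1 => E2.
    have E3 : (- (2 * PI) * ((half n + 1 / 2) * Im tau + 0 * Im 0) = 0)%R.
      apply: exp_inv. by rewrite -E2 exp_0.
    have HP := PI_RGT_0.
    have E4 : ((IZR n + 1) * (PI * Im tau) = 0)%R by move: E3; rewrite /half; lra.
    case: (Rmult_integral _ _ E4) => [E5|E5].
      case: Hn. left. apply: eq_IZR. lra.
    have : (0 < PI * Im tau)%R by apply: Rmult_lt_0_compat; lra. lra.
  have -> : Sum (Hterm tau (zhalf tau) n) = / (1 + Q tau (zhalf tau) (half n) 1 0) *
     ((1 + Q tau (zhalf tau) (half n) 1 0) * Sum (Hterm tau (zhalf tau) n)) by field.
  rewrite E. ring.
- constructor => //. by constructor.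
rewrite /csum; cbn [fold_right].
(* x_{-1/2} = -1 at this point, and its power c = m + 1/2 is the monomial e(c/2) = i (-1)^m. *)
have -> : Sum (Hterm tau (zhalf tau) (-1)) = Ci * Sum (fun m => hcoef tau m * Q tau 0 0 0 (IZR m / 2)).
  have A : absum (fun m => hcoef tau m * Q tau 0 0 0 (IZR m / 2)).
    have [K [K0 HK]] := hcoef_bound tau H.
    apply: (absum_le _ _ K K0 (proj2 (absum_ecoef_phase tau H))) => m.
    rewrite !Cmod_mult -Rmult_assoc. apply: Rmult_le_compat_r; [exact: Cmod_ge_0 | exact: HK].
  rewrite -Sum_scal //. apply: Sum_ext => m. rewrite /Hterm Q_zhalf -(Q_quarter_phase tau 0).
  transitivity (hcoef tau m * (Q tau 0 0 0 (1 / 4) * Q tau 0 0 0 (IZR m / 2))); last ring.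
  rewrite Q_mult. congr (_ * _). congr Q; rewrite /half; field.
rewrite Sum_hcoef_alternating // Q_zhalf.
have -> : Q tau 0 (3 / 2 * half (-1) ^ 2 + 3 * half (-1) / 2) 0 (0 + 3 * half (-1) / 2) =
   Q tau 0 (- (3 / 8)) 0 0 * Q tau 0 0 0 (1 / 4).
  rewrite Q_mult. apply: (Q_eq (-1)); rewrite /half; field.
have -> : Q tau 0 (- (1 / 4)) 0 0 = Q tau 0 (- (3 / 8)) 0 0 * Q tau 0 (1 / 8) 0 0.
  rewrite Q_mult. congr Q; field.
rewrite Q_quarter_phase. have E : Ci * Ci = - (1) by apply: injective_projections => /=; ring.
transitivity ((Ci * Ci) * (2 * (Q tau 0 (- (3 / 8)) 0 0 * Q tau 0 (1 / 8) 0 0) * qinf (nome tau) ^ 3)); first ring.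
rewrite E. ring.
Qed.

(** Translation by the half period (1 + tau)/2 turns vartheta_01, vartheta_11 and vartheta_10 into
    multiples of the constants of vartheta_10, vartheta_00 and vartheta_01, to which Jacobi's
    relation applies. *)
Lemma theta_product_zhalf tau : (0 < Im tau)%R ->
  theta_product tau (zhalf tau) = - (2) * Q tau 0 (- (1 / 4)) 0 0 * qinf (nome tau) ^ 3.
Proof.
move=> H. have E := theta_null_product tau H.
set T00 := Sum _ in E. set T01 := Sum (fun n => Q tau 0 (IZR n ^ 2 / 2) 0 (IZR n / 2)) in E.
set T10 := Sum (fun n => Q tau 0 ((IZR n + 1 / 2) ^ 2 / 2) 0 0) in E.
have A10 : absum (fun n => Q tau 0 ((IZR n + 1 / 2) ^ 2 / 2) 0 0).
  apply: absum_ext (absum_Q tau 0 (1 / 2) (1 / 2) (1 / 8) 0 0 (fun _ => 0%R) H ltac:(lra)) => n. congr Q; field.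
have A0 D : absum (fun n => Q tau 0 (IZR n ^ 2 / 2) 0 (D n)).
  apply: absum_ext (absum_Q tau 0 (1 / 2) 0 0 0 0 D H ltac:(lra)) => n. congr Q; field.
have E01 : vartheta 0 1 tau (zhalf tau) = Q tau 0 (- (1 / 8)) 0 0 * T10.
  rewrite vartheta01 // /T10 -Sum_scal //. apply: Sum_ext => n. rewrite Q_zhalf Q_mult.
  apply: (Q_eq n); field.
have E11 : vartheta 1 1 tau (zhalf tau) = - Q tau 0 (- (1 / 8)) 0 0 * T00.
  rewrite vartheta11 // /T00 (Sum_shift _ 1 (A0 (fun _ => 0%R))) -Sum_scal; last exact: (absum_shift _ 1 (A0 (fun _ => 0%R))).
  apply: Sum_ext => n. rewrite Q_zhalf (_ : forall x y : C, - x * y = - (x * y)) ?Q_mult; last by move=> x y; ring.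
  apply: (Q_opp n); rewrite ?plus_IZR; field.
have E10 : vartheta 1 0 tau (zhalf tau) = Q tau 0 (- (1 / 8)) 0 (- (1 / 4)) * T01.
  rewrite vartheta10 // /T01 (Sum_shift _ 1 (A0 (fun n => IZR n / 2)%R)) -Sum_scal; last exact: (absum_shift _ 1 (A0 (fun n => IZR n / 2)%R)).
  apply: Sum_ext => n. rewrite Q_zhalf Q_mult. congr Q; rewrite ?plus_IZR; field.
rewrite /theta_product E01 E10 E11.
transitivity (- (Q tau 0 (- (1 / 8)) 0 0 * Q tau 0 (- (1 / 8)) 0 (- (1 / 4)) * Q tau 0 (- (1 / 8)) 0 0 * Ci * (T00 * T01 * T10))); first ring.
rewrite E -(Q_quarter_phase tau 0).
transitivity (- (2) * (Q tau 0 (- (1 / 8)) 0 0 * Q tau 0 (- (1 / 8)) 0 (- (1 / 4)) * Q tau 0 (- (1 / 8)) 0 0 * Q tau 0 0 0 (1 / 4) * Q tau 0 (1 / 8) 0 0) * qinf (nome tau) ^ 3); first ring.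
rewrite !Q_mult. congr (_ * _). congr (_ * _). congr Q; field.
Qed.

(** The common value at [zhalf] is nonzero, hence so is [Theta3] there, and the two constants of
    proportionality agree. *)
Lemma double_sum_theta_product tau z : (0 < Im tau)%R -> double_sum tau z = theta_product tau z.
Proof.
move=> H. have [w Hw] := double_sum_Theta3 tau H. have [v Hv] := theta_product_Theta3 tau H.
have E : (w - v) * Theta3 tau (zhalf tau) = 0.
  transitivity (w * Theta3 tau (zhalf tau) - v * Theta3 tau (zhalf tau)); first ring.
  rewrite -Hw -Hv double_sum_zhalf // theta_product_zhalf //. ring.
have N : Theta3 tau (zhalf tau) <> 0.
  move=> E0. have := theta_product_zhalf tau H. rewrite Hv E0 Cmult_0_r => K.
  have [_ Nq] := poch_cv _ (Cmod_nome tau H).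
  have : - (2) * Q tau 0 (- (1 / 4)) 0 0 * qinf (nome tau) ^ 3 <> 0.
    apply: Cmult_neq_0; last exact: Cpow_nz. apply: Cmult_neq_0; last exact: Q_nz.
    rewrite -RtoC_opp => /RtoC_inj; lra.
  by rewrite -K.
have -> : double_sum tau z = theta_product tau z + (w - v) * Theta3 tau (zhalf tau) * / Theta3 tau (zhalf tau) * Theta3 tau z.
  rewrite Hw Hv. by field.
rewrite E. ring.
Qed.

Lemma appell_theta_product tau z : (0 < Im tau)%R -> vartheta 0 0 tau z <> 0 ->
  absum (appell_term tau z) /\
  Sum (appell_term tau z) = Ci * (vartheta 1 1 tau z * vartheta 1 0 tau z * vartheta 0 1 tau z) / vartheta 0 0 tau z.
Proof.
move=> H N. have [|A E] := double_sum_appell_term tau z H N.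
  move=> n E0. apply: N. exact: (vartheta00_zero tau z n).
split=> //. rewrite -/(theta_product tau z) -double_sum_theta_product // E. by field.
Qed.

(** * The functions Phi *)

(** The summand in the shape in which Phi produces it; (x - 1) / (x + 1) = 1 - 2 / (1 + x) relates
    it to [appell_term]. *)
Definition polar_term (tau z : C) (n : Z) : C :=
  Q tau z (half n ^ 2) (2 * half n) 0 / (1 + Q tau z (half n) 1 0).

Lemma absum_Q2 tau z : (0 < Im tau)%R -> absum (fun n => Q tau z (half n ^ 2) (2 * half n) 0).
Proof.
move=> H. apply: absum_ext (absum_sq tau z (1 / 2) 2 1 (fun _ => 0%R) H) => n.
rewrite /half; congr Q; field.
Qed.

Lemma denominators_nz tau z : (0 < Im tau)%R -> vartheta 0 0 tau z <> 0 ->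
  forall n, 1 + Q tau z (half n) 1 0 <> 0.
Proof. move=> H N n E. apply: N. apply: (vartheta00_zero tau z n) => //. by rewrite Cplus_comm. Qed.

Lemma polar_term_appell_term tau z n : 1 + Q tau z (half n) 1 0 <> 0 ->
  appell_term tau z n = Q tau z (half n ^ 2) (2 * half n) 0 - 2 * polar_term tau z n.
Proof.
move=> N. have N' : Q tau z (half n) 1 0 + 1 <> 0 by rewrite Cplus_comm.
rewrite /appell_term /polar_term. by field.
Qed.

Lemma absum_polar_term tau z : (0 < Im tau)%R -> vartheta 0 0 tau z <> 0 -> absum (polar_term tau z).
Proof.
move=> H N. have [A _] := appell_theta_product tau z H N.
apply: absum_ext (absum_plus _ _ (absum_scal (1 / 2) _ (absum_Q2 tau z H)) (absum_scal (- (1) / 2) _ A)) => n.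
rewrite polar_term_appell_term; last exact: denominators_nz. field.
Qed.

(* The arguments of Phi in ch^+ are these with (N1, N2) = (-1, 0), and those in ch^-
   are these with (N1, N2) = (-1, -1) and z + 1/2 in place of z. *)
Definition shifted_z1 (tau z : C) (N1 : Z) : C := z + tau / 2 + 1 / 2 + IZR N1.
Definition shifted_z2 (tau z : C) (N2 : Z) : C := z - tau / 2 + 1 / 2 + IZR N2.

Lemma half_shape n : RtoC (half n) = IZR n + 1 / 2.
Proof. rewrite /half RtoC_plus RtoC_div //; lra. Qed.

Lemma prefactor tau z : Cexp (- (2 * PI * Ci * 2 * (tau / 8))) = Q tau z (- (1 / 4)) 0 0.
Proof. rewrite /Q. congr Cexp. rewrite RtoC_opp RtoC_div; last lra. field. Qed.

(** The j-th denominator is 1 + x_a with a = 2j + 1/2, so the first half of Phi gives the even n.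
    The numerator carries q^{1/4}, which cancels the prefactor. *)
Lemma Phi1_polar_term tau z N1 N2 : (0 < Im tau)%R -> vartheta 0 0 tau z <> 0 ->
  Phi1 2 1 (2 * tau) (shifted_z1 tau z N1) (shifted_z2 tau z N2) (tau / 8) = - Sum (fun j => polar_term tau z (2 * j)).
Proof.
move=> H N. rewrite /Phi1 (prefactor tau z).
have A : absum (fun j => polar_term tau z (2 * j)).
  apply: (absum_inj (fun j => 2 * j)%Z (polar_term tau z)); [lia | exact: absum_polar_term].
rewrite (ZSeries_ext _ (fun j => - Q tau z (1 / 4) 0 0 * polar_term tau z (2 * j))).
  rewrite ZSeries_Sum; last exact: absum_scal. rewrite Sum_scal //.
  transitivity (- (Q tau z (- (1 / 4)) 0 0 * Q tau z (1 / 4) 0 0) * Sum (fun j => polar_term tau z (2 * j))); first ring.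
  rewrite Q_mult (_ : Q tau z (- (1 / 4) + 1 / 4) (0 + 0) (0 + 0) = 1); first ring.
  rewrite -(Q_0 tau z). congr Q; ring.
move=> j.
have -> : Cexp (2 * PI * Ci * shifted_z1 tau z N1) * Cexp (2 * PI * Ci * IZR j * (2 * tau)) =
   - Q tau z (half (2 * j)) 1 0.
  rewrite -Cexp_plus.
  transitivity (Q tau z (half (2 * j)) 1 (1 / 2 + IZR N1)); last by apply: (Q_opp N1); ring.
  rewrite /Q /shifted_z1 half_shape mult_IZR. congr Cexp. rewrite RtoC_mult RtoC_plus RtoC_div; last lra. field.
rewrite -Cexp_plus.
have -> : Cexp (2 * PI * Ci * 2 * IZR j * (shifted_z1 tau z N1 + shifted_z2 tau z N2) + 2 * PI * Ci * 1 * shifted_z1 tau z N1 +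
    2 * PI * Ci * (2 * tau) * (2 * IZR j ^ 2 + 1 * IZR j)) =
   - (Q tau z (1 / 4) 0 0 * Q tau z (half (2 * j) ^ 2) (2 * half (2 * j)) 0).
  rewrite Q_mult.
  transitivity (Q tau z (1 / 4 + half (2 * j) ^ 2) (2 * half (2 * j)) (1 / 2 + IZR N1 + 2 * IZR j * (1 + IZR N1 + IZR N2))).
    rewrite /Q /shifted_z1 /shifted_z2. congr Cexp. rewrite (RtoC_plus (1 / 4)) RtoC_pow (RtoC_mult 2 (half _)) !half_shape mult_IZR !RtoC_plus !RtoC_div; try lra. rewrite !RtoC_mult !RtoC_plus. field.
  apply: (Q_opp (N1 + 2 * j * (1 + N1 + N2))); rewrite ?plus_IZR ?mult_IZR ?plus_IZR; ring.
have K := denominators_nz tau z H N (2 * j). rewrite /polar_term.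
have -> : 1 - - Q tau z (half (2 * j)) 1 0 = 1 + Q tau z (half (2 * j)) 1 0 by ring.
by field.
Qed.

(** Here the denominator is 1 + 1/x_a with a = -(2j + 1/2), that is n = -2j - 1: the odd n.
    Rewriting 1 / (1 + 1/x) as 1 - 1 / (1 + x) produces the second sum. *)
Lemma Phi2_polar_term tau z N1 N2 : (0 < Im tau)%R -> vartheta 0 0 tau z <> 0 ->
  Phi2 2 1 (2 * tau) (shifted_z1 tau z N1) (shifted_z2 tau z N2) (tau / 8) =
  Sum (fun j => polar_term tau z (2 * j + 1)) - Sum (fun j => Q tau z (half (2 * j + 1) ^ 2) (2 * half (2 * j + 1)) 0).
Proof.
move=> H N. rewrite /Phi2 (prefactor tau z).
pose d n := polar_term tau z n - Q tau z (half n ^ 2) (2 * half n) 0.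
have Ag := absum_polar_term tau z H N. have AQ := absum_Q2 tau z H.
have i1 x y : (2 * x + 1 = 2 * y + 1)%Z -> x = y by lia.
have A1 := absum_inj (fun j => 2 * j + 1)%Z _ i1 Ag. have A2 := absum_inj (fun j => 2 * j + 1)%Z _ i1 AQ.
have A : absum (fun j => d (2 * j + 1)%Z).
  apply: absum_ext (absum_plus _ _ A1 (absum_scal (- (1)) _ A2)) => j. rewrite /d. ring.
have -> : Sum (fun j => polar_term tau z (2 * j + 1)) - Sum (fun j => Q tau z (half (2 * j + 1) ^ 2) (2 * half (2 * j + 1)) 0)
   = Sum (fun j => d (2 * j + 1)%Z).
  rewrite (Sum_ext (fun j => d (2 * j + 1)%Z) (fun j => polar_term tau z (2 * j + 1) + - (1) * Q tau z (half (2 * j + 1) ^ 2) (2 * half (2 * j + 1)) 0)); last by move=> j; rewrite /d; ring.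
  rewrite Sum_plus //; last exact: absum_scal. rewrite Sum_scal //. ring.
rewrite (Sum_neg _ (-1) A).
have A' := absum_neg _ (-1) A.
rewrite (ZSeries_ext _ (fun j => Q tau z (1 / 4) 0 0 * d (2 * (-1 - j) + 1)%Z)).
  rewrite ZSeries_Sum; last exact: absum_scal. rewrite Sum_scal // Cmult_assoc.
  rewrite Q_mult (_ : Q tau z (- (1 / 4) + 1 / 4) (0 + 0) (0 + 0) = 1); first ring.
  rewrite -(Q_0 tau z). congr Q; ring.
move=> j. set n := (2 * (-1 - j) + 1)%Z.
have En : half n = (- (2 * IZR j + 1 / 2))%R by rewrite /half /n plus_IZR mult_IZR minus_IZR; field.
have K := denominators_nz tau z H N n. have Nx := Q_nz tau z (half n) 1 0.
have -> : Cexp (- (2 * PI * Ci * shifted_z2 tau z N2)) * Cexp (2 * PI * Ci * IZR j * (2 * tau)) =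
   - / Q tau z (half n) 1 0.
  rewrite -Cexp_plus Q_inv.
  transitivity (Q tau z (- half n) (- (1)) (- (1 / 2 + IZR N2))); last by apply: (Q_opp (- N2 - 1)); rewrite ?minus_IZR ?opp_IZR; field.
  rewrite En /Q /shifted_z2. congr Cexp. rewrite !RtoC_opp !RtoC_plus !RtoC_div; try lra. rewrite !RtoC_mult. field.
rewrite -Cexp_plus.
have -> : Cexp (- (2 * PI * Ci * 2 * IZR j * (shifted_z1 tau z N1 + shifted_z2 tau z N2)) - 2 * PI * Ci * 1 * shifted_z2 tau z N2 +
    2 * PI * Ci * (2 * tau) * (2 * IZR j ^ 2 + 1 * IZR j)) =
   - (Q tau z (1 / 4) 0 0 * Q tau z (half n ^ 2) (2 * half n) 0).
  rewrite Q_mult.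
  transitivity (Q tau z (1 / 4 + half n ^ 2) (2 * half n) (- (1 / 2 + IZR N2 + 2 * IZR j * (1 + IZR N1 + IZR N2)))).
    rewrite En /Q /shifted_z1 /shifted_z2. congr Cexp.
    rewrite (RtoC_plus (1 / 4)) RtoC_pow (RtoC_mult 2 (- _)) !RtoC_opp !RtoC_plus !RtoC_div; try lra. rewrite !RtoC_mult !RtoC_plus. field.
  apply: (Q_opp (- (N2 + 2 * j * (1 + N1 + N2)) - 1)); rewrite ?minus_IZR ?opp_IZR ?plus_IZR ?mult_IZR ?plus_IZR; field.
rewrite /d /polar_term.
have K2 : 1 - - / Q tau z (half n) 1 0 <> 0.
  move=> E0. apply: K. transitivity (Q tau z (half n) 1 0 * (1 - - / Q tau z (half n) 1 0)); first by field. rewrite E0; ring.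
have K3 : Q tau z (half n) 1 0 + 1 <> 0 by rewrite Cplus_comm.
field. split => //.
Qed.

Lemma Phi_polar_term tau z N1 N2 : (0 < Im tau)%R -> vartheta 0 0 tau z <> 0 ->
  Phi 2 1 (2 * tau) (shifted_z1 tau z N1) (shifted_z2 tau z N2) (tau / 8) =
  - Sum (polar_term tau z) + Sum (fun j => Q tau z (half (2 * j + 1) ^ 2) (2 * half (2 * j + 1)) 0).
Proof.
move=> H N. rewrite /Phi Phi1_polar_term // Phi2_polar_term //.
rewrite (Sum_split (fun j => 2 * j)%Z (fun j => 2 * j + 1)%Z (polar_term tau z)); try lia.
- ring.
- exact: absum_polar_term.
- move=> b. have := Z.div_mod b 2 ltac:(lia). have := Z.mod_pos_bound b 2 ltac:(lia). move=> K1 K2.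
  have [K|K] : (b mod 2 = 0 \/ b mod 2 = 1)%Z by lia.
    left. exists (b / 2)%Z. lia.
  right. exists (b / 2)%Z. lia.
Qed.

(** * The correction term *)

(** The sign in R_{j;2} at n = j + 4l is that of 4l + 7/2, hence +1 already at l = 0. *)
Definition zsgn (l : Z) : R := if (l <? 0)%Z then (-1)%R else 1%R.

Lemma sign_shape l : sign (4 * IZR l + 7 / 2) = zsgn l.
Proof.
rewrite /zsgn. case: Z.ltb_spec => K.
  apply: sign_eq_m1. have : (IZR l <= -1)%R by apply: IZR_le; lia. lra.
apply: sign_eq_1. have : (0 <= IZR l)%R by apply: IZR_le. lra.
Qed.

Lemma erf_tail_bound l x : (0 <= x)%R ->
  (Rabs (zsgn l - E (IZR l * x)) <= exp (- PI * (IZR l * x) ^ 2))%R.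
Proof.
move=> Hx. rewrite /zsgn. case: Z.ltb_spec => K.
  have P : (0 <= - IZR l * x)%R.
    apply: Rmult_le_pos => //. have : (IZR l <= 0)%R by apply: IZR_le; lia. lra.
  have [B1 B2] := E_bounds _ P.
  have -> : E (IZR l * x) = (- E (- IZR l * x))%R by rewrite -E_opp; congr E; ring.
  have -> : ((IZR l * x) ^ 2 = (- IZR l * x) ^ 2)%R by ring.
  rewrite -Rabs_Ropp Rabs_pos_eq; lra.
have P : (0 <= IZR l * x)%R by apply: Rmult_le_pos => //; apply: IZR_le.
have [B1 B2] := E_bounds _ P. rewrite Rabs_pos_eq; lra.
Qed.

(** The l-th term of R_{1;2} at (2 tau, w), up to a common monomial: for n = 1 + 4l the argument of
    E is 4 l sqrt(Im tau), and - n^2/4 + n/2 = 1/4 - 4 l^2. *)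
Definition erf_term (tau : C) (l : Z) : C :=
  RtoC (zsgn l - E (4 * IZR l * sqrt (Im tau))) * Q tau 0 (- 4 * IZR l ^ 2) 0 0.

(** The tail of E is at most exp(-16 pi l^2 Im tau), against the growth exp(8 pi l^2 Im tau) of the
    monomial. *)
Lemma absum_erf_term tau : (0 < Im tau)%R -> absum (erf_term tau).
Proof.
move=> H. have HP := PI_RGT_0.
apply: (absum_gauss _ (8 * PI * Im tau) 0 0).
  by repeat apply: Rmult_lt_0_compat => //; lra.
move=> l. rewrite /erf_term Cmod_mult Cmod_R Cmod_Q.
have -> : (4 * IZR l * sqrt (Im tau) = IZR l * (4 * sqrt (Im tau)))%R by ring.
have S0 := sqrt_pos (Im tau).
have := erf_tail_bound l (4 * sqrt (Im tau)) ltac:(lra) => B.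
apply: Rle_trans (Rmult_le_compat_r _ _ _ (Rlt_le _ _ (exp_pos _)) B) _.
rewrite -exp_plus.
have -> : ((IZR l * (4 * sqrt (Im tau))) ^ 2 = 16 * IZR l ^ 2 * Im tau)%R.
  have S2 := sqrt_sqrt (Im tau) (Rlt_le _ _ H).
  transitivity (16 * IZR l ^ 2 * (sqrt (Im tau) * sqrt (Im tau)))%R; first ring. by rewrite S2.
set a := exp _. set b := exp _. have -> : a = b by rewrite /a /b; congr exp; ring.
have : (0 < b)%R by exact: exp_pos. have := Rabs_pos (IZR l) => P1 P2.
have := Rmult_le_pos _ _ P1 (Rlt_le _ _ P2). lra.
Qed.

(* All the terms cancel in pairs except the one at l = 0. *)
Lemma Sum_erf_term tau : (0 < Im tau)%R -> Sum (erf_term tau) = 1.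
Proof.
move=> H. have A := absum_erf_term tau H.
(* The term at l = 0 equals 1, because [zsgn 0] = 1 and E 0 = 0; removing it leaves an odd
   family. *)
pose d (l : Z) := if Z.eq_dec l 0 then RtoC 1 else 0.
have Sd l : ~ In l (0%Z :: nil) -> d l = 0.
  rewrite /d => Hl. case: Z.eq_dec => // E0. case: Hl. by left.
have ND : NoDup (0%Z :: nil) by constructor => //; constructor.
have Ad := absum_finsupp d _ ND Sd.
have A' : absum (fun l => erf_term tau l + (-1) * d l) by apply: absum_plus => //; apply: absum_scal.
have E0 : E 0 = 0%R by rewrite /E RInt_point /zero /=; ring.
have S0 : Sum (fun l => erf_term tau l + (-1) * d l) = 0.
  apply: (Sum_odd _ 0) => // l. rewrite Z.sub_0_l /erf_term /d /zsgn.
  case: (Z.eq_dec l 0) => [->|K].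
    rewrite /= !Rmult_0_r Rmult_0_l E0 Rminus_0_r.
    have -> : Q tau 0 (- 4 * (0 * (0 * 1))) 0 0 = 1 by rewrite -(Q_0 tau 0); congr Q; ring. ring.
  case: (Z.eq_dec (- l) 0) => K'; first lia.
  rewrite opp_IZR. have -> : (4 * - IZR l * sqrt (Im tau) = - (4 * IZR l * sqrt (Im tau)))%R by ring.
  rewrite E_opp. have -> : ((- IZR l) ^ 2 = IZR l ^ 2)%R by ring.
  case: Z.ltb_spec => K1; case: Z.ltb_spec => K2; try lia; rewrite !RtoC_minus RtoC_opp; ring.
have : Sum (erf_term tau) + (-1) * Sum d = 0 by rewrite -Sum_scal // -Sum_plus //; exact: absum_scal.
rewrite (Sum_finsupp d _ ND Sd) /csum /= => E1.
transitivity (Sum (erf_term tau) + (-1) * (d 0%Z + 0) + d 0%Z); first ring. rewrite E1 /d /=. ring.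
Qed.

Lemma Rfun_exponent tau N1 N2 z n :
  Cexp (- (PI * Ci * RtoC n ^ 2 * (2 * tau) / (2 * 2)) + 2 * PI * Ci * RtoC n * ((shifted_z1 tau z N1 - shifted_z2 tau z N2) / 2)) =
  Q tau 0 (- n ^ 2 / 4 + n / 2) 0 (n * (IZR N1 - IZR N2) / 2).
Proof.
rewrite /Q /shifted_z1 /shifted_z2. congr Cexp.
rewrite !RtoC_plus !RtoC_div; try lra. rewrite RtoC_opp RtoC_pow RtoC_mult RtoC_minus. field.
Qed.

(** z1 - z2 = tau + N1 - N2. With m = 2 the value 1/4 centres the argument of E at n = 1, a point of
    symmetry of both n = 1 + 4l and n = 3 + 4l. *)
Lemma Im_quotient tau z N1 N2 : (0 < Im tau)%R ->
  (Im ((shifted_z1 tau z N1 - shifted_z2 tau z N2) / 2) / Im (2 * tau) = 1 / 4)%R.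
Proof.
move=> H. rewrite Im_double.
have -> : (shifted_z1 tau z N1 - shifted_z2 tau z N2) / 2 = RtoC (/ 2) * (tau + RtoC (IZR N1 - IZR N2)).
  rewrite /shifted_z1 /shifted_z2 RtoC_inv; last lra. rewrite RtoC_minus. field.
rewrite im_scal_l. have -> : Im (tau + RtoC (IZR N1 - IZR N2)) = Im tau.
  case: tau {H} => a b /=. ring.
field. lra.
Qed.

Lemma Rfun1 tau z N1 N2 : (0 < Im tau)%R ->
  Rfun 1 2 (2 * tau) ((shifted_z1 tau z N1 - shifted_z2 tau z N2) / 2) = Q tau 0 (1 / 4) 0 ((IZR N1 - IZR N2) / 2).
Proof.
move=> H. have A := absum_erf_term tau H.
rewrite /Rfun (ZSeries_ext _ (fun l => Q tau 0 (1 / 4) 0 ((IZR N1 - IZR N2) / 2) * erf_term tau l)).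
  rewrite ZSeries_Sum; last exact: absum_scal. rewrite Sum_scal // Sum_erf_term //. ring.
move=> l. cbv zeta. rewrite Rfun_exponent.
have -> : (1 + 2 * 2 * IZR l - 1 / 2 - 1 + 2 * 2 = 4 * IZR l + 7 / 2)%R by field.
rewrite sign_shape Im_double.
have -> : (2 * Im tau / 2 = Im tau)%R by field.
have -> : ((1 + 2 * 2 * IZR l - 2 * 2 * (Im ((shifted_z1 tau z N1 - shifted_z2 tau z N2) / 2) / (2 * Im tau))) = 4 * IZR l)%R.
  have := Im_quotient tau z N1 N2 H. rewrite Im_double => ->. field.
rewrite /erf_term. rewrite Cmult_assoc (Cmult_comm (Q _ _ _ _ _)) -Cmult_assoc Q_mult. congr (_ * _).
apply: (Q_eq (2 * l * (N1 - N2))); rewrite ?mult_IZR ?minus_IZR; field.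
Qed.

(* Each half of [ZSeries] is the opposite of the other, so convergence plays no role. *)
Lemma Rfun3 tau z N1 N2 : (0 < Im tau)%R ->
  Rfun 3 2 (2 * tau) ((shifted_z1 tau z N1 - shifted_z2 tau z N2) / 2) = 0.
Proof.
move=> H. rewrite /Rfun.
have odd (f : Z -> C) : (forall l, f (- l - 1)%Z = - f l) -> ZSeries f = 0.
  move=> Hf. rewrite /ZSeries.
  have -> : CSeries (fun n => f (- Z.of_nat n - 1)%Z) = - CSeries (fun n => f (Z.of_nat n)).
    rewrite /CSeries. apply: injective_projections => /=; rewrite -Series_opp; apply: Series_ext => n; by rewrite Hf.
  ring.
apply: odd => l. cbv zeta. rewrite !Rfun_exponent.
have S k : (3 + 2 * 2 * IZR k - 1 / 2 - 3 + 2 * 2 = 4 * IZR k + 7 / 2)%R by field.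
rewrite !S !sign_shape Im_double.
have -> : (2 * Im tau / 2 = Im tau)%R by field.
have I := Im_quotient tau z N1 N2 H. rewrite Im_double in I.
have -> k : ((3 + 2 * 2 * IZR k - 2 * 2 * (Im ((shifted_z1 tau z N1 - shifted_z2 tau z N2) / 2) / (2 * Im tau))) = 4 * IZR k + 2)%R.
  rewrite I. field.
have -> k : ((3 + 2 * 2 * IZR k - 2 * 2 * (Im ((shifted_z1 tau z N1 - shifted_z2 tau z N2) / 2) / (2 * Im tau))) = 4 * IZR k + 2)%R.
  rewrite I. field.
have -> : ((4 * IZR (- l - 1) + 2) * sqrt (Im tau) = - ((4 * IZR l + 2) * sqrt (Im tau)))%R.
  rewrite minus_IZR opp_IZR. ring.
rewrite E_opp.
have -> : zsgn (- l - 1) = (- zsgn l)%R.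
  rewrite /zsgn. case: Z.ltb_spec => K1; case: Z.ltb_spec => K2; try lia; lra.
have -> : Q tau 0 (- (3 + 2 * 2 * IZR (- l - 1)) ^ 2 / 4 + (3 + 2 * 2 * IZR (- l - 1)) / 2) 0
    ((3 + 2 * 2 * IZR (- l - 1)) * (IZR N1 - IZR N2) / 2) =
  Q tau 0 (- (3 + 2 * 2 * IZR l) ^ 2 / 4 + (3 + 2 * 2 * IZR l) / 2) 0 ((3 + 2 * 2 * IZR l) * (IZR N1 - IZR N2) / 2).
  apply: (Q_eq (- (2 + 4 * l) * (N1 - N2))); rewrite ?mult_IZR ?opp_IZR ?plus_IZR ?mult_IZR ?minus_IZR ?opp_IZR; field.
rewrite !RtoC_minus !RtoC_opp. ring.
Qed.

Lemma theta_Sum k tau z : (0 < Im tau)%R ->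
  absum (fun j => Q tau z (2 * (IZR j + k / 4) ^ 2) (2 * (IZR j + k / 4)) 0) /\
  theta k 2 tau z = Sum (fun j => Q tau z (2 * (IZR j + k / 4) ^ 2) (2 * (IZR j + k / 4)) 0).
Proof.
move=> H.
have A : absum (fun j => Q tau z (2 * (IZR j + k / 4) ^ 2) (2 * (IZR j + k / 4)) 0).
  apply: absum_ext (absum_Q tau z 2 k (k ^ 2 / 8) 2 (k / 2) (fun _ => 0%R) H ltac:(lra)) => j.
  congr Q; field.
split=> //. rewrite /theta -ZSeries_Sum //. apply: ZSeries_ext => j.
rewrite -Cexp_plus /Q. congr Cexp. rewrite (RtoC_mult 2 (_ ^ 2)) (RtoC_mult 2 (_ + _)) RtoC_pow !RtoC_plus !RtoC_div; try lra. field.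
Qed.

(** Periodicity modulo 2m = 4 identifies theta_2 with theta_{-2} and theta_4 with theta_{-4}, so the
    even k drop out of the correction term. *)
Lemma theta_period k k' (d : Z) tau z : (0 < Im tau)%R -> (k' = k + 4 * IZR d)%R ->
  theta k' 2 tau z = theta k 2 tau z.
Proof.
move=> H ->. have [A ->] := theta_Sum k tau z H. have [A' ->] := theta_Sum (k + 4 * IZR d) tau z H.
rewrite (Sum_shift _ d A). apply: Sum_ext => j. congr Q; rewrite ?plus_IZR; field.
Qed.

(** theta_1 collects the even n and theta_{-1} the odd n of the Gaussian part of the Appell sum. *)
Lemma theta_Q2 (k d : Z) tau z N1 N2 : (0 < Im tau)%R -> (k = 1 - 2 * d)%Z -> (d = 0 \/ d = 1)%Z ->
  theta (IZR k) 2 (2 * tau) (shifted_z1 tau z N1 + shifted_z2 tau z N2) =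
  Q tau 0 0 0 ((1 + IZR N1 + IZR N2) / 2) *
  Sum (fun j => Q tau z (half (2 * j - d) ^ 2) (2 * half (2 * j - d)) 0).
Proof.
move=> H Hk Hd. have H2 : (0 < Im (2 * tau))%R by rewrite Im_double; lra.
have [_ ->] := theta_Sum (IZR k) _ (shifted_z1 tau z N1 + shifted_z2 tau z N2) H2.
rewrite -Sum_scal; last first.
  apply: (absum_inj (fun j => 2 * j - d)%Z (fun n => Q tau z (half n ^ 2) (2 * half n) 0)); [lia | exact: absum_Q2].
apply: Sum_ext => j. rewrite (Q_z0 tau z) Q_mult.
transitivity (Q tau z (half (2 * j - d) ^ 2) (2 * half (2 * j - d)) (half (2 * j - d) * (1 + IZR N1 + IZR N2))).
  have Eh : half (2 * j - d) = (2 * (IZR j + IZR k / 4))%R.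
    rewrite /half Hk !minus_IZR !mult_IZR. field.
  rewrite Eh /Q /shifted_z1 /shifted_z2. congr Cexp.
  rewrite RtoC_pow !(RtoC_mult 2 (IZR j + _)) (RtoC_mult 2 (_ ^ 2)) (RtoC_mult 2 (2 * _)) (RtoC_mult (2 * _)) RtoC_pow ?(RtoC_mult 2 (IZR j + _)) !RtoC_plus !RtoC_div; try lra. field.
apply: (Q_eq ((2 * j - d) * (1 + N1 + N2))); rewrite /half ?mult_IZR ?plus_IZR ?minus_IZR ?mult_IZR; field.
Qed.

Lemma Phi_add_theta tau z N1 N2 : (0 < Im tau)%R ->
  Phi_add 4 2 (2 * tau) (shifted_z1 tau z N1) (shifted_z2 tau z N2) (tau / 8) =
  1 / 2 * (Sum (fun j => Q tau z (half (2 * j) ^ 2) (2 * half (2 * j)) 0) -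
           Sum (fun j => Q tau z (half (2 * j + 1) ^ 2) (2 * half (2 * j + 1)) 0)).
Proof.
move=> H. have H2 : (0 < Im (2 * tau))%R by rewrite Im_double; lra.
rewrite /Phi_add. cbv zeta.
have -> : (INR 4 / 2 = 2)%R by rewrite /=; field.
have -> : (IZR 2 / 2 = 1)%R by field.
rewrite /Csum. cbn [seq map fold_right].
have -> : (1 + INR 0 = 1)%R by rewrite /=; ring.
have -> : (1 + INR 1 = 2)%R by rewrite /=; ring.
have -> : (1 + INR 2 = 3)%R by rewrite /=; ring.
have -> : (1 + INR 3 = 4)%R by rewrite /=; ring.
rewrite Rfun1 // Rfun3 //.
rewrite (theta_period (- (2)) 2 1) //; last lra.
rewrite (theta_period (- (4)) 4 2) //; last lra.
rewrite (theta_Q2 1 0) //; last by left.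
rewrite (theta_Q2 (-1) 1) //; last by right.
rewrite (prefactor tau 0).
rewrite (Sum_ext (fun j => Q tau z (half (2 * j - 0) ^ 2) (2 * half (2 * j - 0)) 0) (fun j => Q tau z (half (2 * j) ^ 2) (2 * half (2 * j)) 0)); last by move=> j; rewrite Z.sub_0_r.
have A1 : absum (fun j => Q tau z (half (2 * j + 1) ^ 2) (2 * half (2 * j + 1)) 0).
  apply: (absum_inj (fun j => 2 * j + 1)%Z (fun n => Q tau z (half n ^ 2) (2 * half n) 0)); [lia | exact: absum_Q2].
rewrite (Sum_shift _ (-1) A1).
rewrite (Sum_ext (fun j => Q tau z (half (2 * j - 1) ^ 2) (2 * half (2 * j - 1)) 0) (fun j => Q tau z (half (2 * (j + -1) + 1) ^ 2) (2 * half (2 * (j + -1) + 1)) 0)); last first.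
  by move=> j; have -> : (2 * (j + -1) + 1 = 2 * j - 1)%Z by lia.
set Se := Sum (fun j => Q tau z (half (2 * j) ^ 2) _ _). set So := Sum _.
transitivity (- (1 / 2) * (Q tau 0 (- (1 / 4)) 0 0 * Q tau 0 (1 / 4) 0 ((IZR N1 - IZR N2) / 2) * Q tau 0 0 0 ((1 + IZR N1 + IZR N2) / 2)) * (Se - So)); first ring.
(* The powers of q cancel and the phases add up to N1 + 1/2; the resulting sign turns -1/2 into
   1/2. *)
rewrite !Q_mult (Q_opp N1 tau 0 _ _ _ 0 0 0); try field.
rewrite Q_0. ring.
Qed.

(** Phi contains the Gaussian sum over odd n only; half of (even minus odd) replaces it by half the
    sum over all n, and with the polar part this is half of [appell_term]. *)
Lemma Phi_mod_appell_term tau z N1 N2 : (0 < Im tau)%R -> vartheta 0 0 tau z <> 0 ->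
  Phi_mod 4 2 (2 * tau) (shifted_z1 tau z N1) (shifted_z2 tau z N2) (tau / 8) = 1 / 2 * Sum (appell_term tau z).
Proof.
move=> H N. rewrite /Phi_mod Phi_add_theta //.
have -> : (INR 4 / 2 = 2)%R by rewrite /=; field.
have -> : (IZR 2 / 2 = 1)%R by field.
rewrite Phi_polar_term //.
have Ag := absum_polar_term tau z H N. have AQ := absum_Q2 tau z H.
rewrite (Sum_ext (appell_term tau z) (fun n => Q tau z (half n ^ 2) (2 * half n) 0 + - (2) * polar_term tau z n)); last first.
  move=> n. rewrite polar_term_appell_term; first ring. exact: denominators_nz.
rewrite Sum_plus //; last exact: absum_scal. rewrite Sum_scal //.
rewrite (Sum_split (fun j => 2 * j)%Z (fun j => 2 * j + 1)%Z (fun n => Q tau z (half n ^ 2) (2 * half n) 0)) //; try lia.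
- field.
- move=> b. have := Z.div_mod b 2 ltac:(lia). have := Z.mod_pos_bound b 2 ltac:(lia). move=> K1 K2.
  have [K|K] : (b mod 2 = 0 \/ b mod 2 = 1)%Z by lia.
    left. exists (b / 2)%Z. lia.
  right. exists (b / 2)%Z. lia.
Qed.

(** * Eta quotients and the characters *)

Lemma eta_qinf tau : (0 < Im tau)%R -> eta tau = Q tau 0 (1 / 24) 0 0 * qinf (nome tau).
Proof.
move=> H. rewrite /eta. congr (_ * _).
  rewrite /Q. congr Cexp. rewrite RtoC_div; last lra. field.
apply: CLim_seq_clim. have [L _] := poch_cv _ (Cmod_nome tau H).
apply: clim_ext L => N.
have aux (f : nat -> C) M : cprod f M = fold_right Cmult 1 (map f (seq 1 M)).
  have app (l : list C) x : fold_right Cmult 1 (l ++ x :: nil) = fold_right Cmult 1 l * x.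
    elim: l => [|y l IH] /=; [ring | rewrite IH; ring].
  elim: M => [|M IH] //. rewrite seq_S map_app /= app -IH. by [].
rewrite -aux. apply: cprod_ext => k _. rewrite nome_pow /Q. congr (1 - Cexp _). ring.
Qed.

Lemma eta_nz tau : (0 < Im tau)%R -> eta tau <> 0.
Proof.
move=> H. rewrite eta_qinf //. have [_ N] := poch_cv _ (Cmod_nome tau H).
apply: Cmult_neq_0 => //. exact: Q_nz.
Qed.

Lemma Q_scale (c : R) tau A B D : Q (c * tau) 0 A B D = Q tau 0 (c * A) 0 D.
Proof. rewrite /Q. congr Cexp. rewrite RtoC_mult. ring. Qed.

Lemma theta00_null_eta tau : (0 < Im tau)%R ->
  Sum (fun n => Q (2 * tau) 0 (IZR n ^ 2 / 2) 0 0) = eta (2 * tau) ^ 5 / (eta tau ^ 2 * eta (4 * tau) ^ 2).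
Proof.
move=> H. have H2 : (0 < Im (2 * tau))%R by rewrite Im_double; lra.
have E4 : 4 * tau = 2 * (2 * tau) by ring.
have H4 : (0 < Im (2 * (2 * tau)))%R by rewrite 2!Im_double; lra.
rewrite theta00_null_sum // (_ : 2 * tau / 2 = tau); last by field.
rewrite !eta_qinf ?E4 //. rewrite !Cpow_mult_l !Q_pow !Q_scale.
have [_ N1] := poch_cv _ (Cmod_nome _ H). have [_ N4] := poch_cv _ (Cmod_nome _ H4).
rewrite !Rmult_0_r.
(* The powers of q^{1/24} balance: 5 times 2 equals 2 times 1 plus 2 times 4. *)
have -> : Q tau 0 (2 * (INR 5 * (1 / 24))) 0 0 = Q tau 0 (INR 2 * (1 / 24)) 0 0 * Q tau 0 (2 * (2 * (INR 2 * (1 / 24)))) 0 0.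
  rewrite Q_mult. congr Q; rewrite /=; field.
have M1 := Q_nz tau 0 (INR 2 * (1 / 24)) 0 0. have M2 := Q_nz tau 0 (2 * (2 * (INR 2 * (1 / 24)))) 0 0.
field. by split.
Qed.

Lemma theta10_null_eta tau : (0 < Im tau)%R ->
  Sum (fun n => Q (2 * tau) 0 ((IZR n + 1 / 2) ^ 2 / 2) 0 0) = 2 * (eta (4 * tau) ^ 2 / eta (2 * tau)).
Proof.
move=> H. have H2 : (0 < Im (2 * tau))%R by rewrite Im_double; lra.
have E4 : 4 * tau = 2 * (2 * tau) by ring.
have H4 : (0 < Im (2 * (2 * tau)))%R by rewrite 2!Im_double; lra.
rewrite theta10_null_sum //.
rewrite !eta_qinf ?E4 //. rewrite !Cpow_mult_l !Q_pow !Q_scale.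
have [_ N2] := poch_cv _ (Cmod_nome _ H2).
rewrite !Rmult_0_r.
have -> : Q tau 0 (2 * (2 * (INR 2 * (1 / 24)))) 0 0 = Q tau 0 (2 * (1 / 8)) 0 0 * Q tau 0 (2 * (1 / 24)) 0 0.
  rewrite Q_mult. congr Q; rewrite /=; field.
have M := Q_nz tau 0 (2 * (1 / 24)) 0 0.
field. by split.
Qed.

Lemma Q_shift_half tau z A B D : Q tau (z + 1 / 2) A B D = Q tau z A B (D + B / 2).
Proof. rewrite /Q. congr Cexp. rewrite RtoC_plus RtoC_div; last lra. field. Qed.

Lemma vartheta_shift_half tau z : (0 < Im tau)%R ->
  vartheta 0 0 tau (z + 1 / 2) = vartheta 0 1 tau z /\
  vartheta 0 1 tau (z + 1 / 2) = vartheta 0 0 tau z /\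
  vartheta 1 0 tau (z + 1 / 2) = vartheta 1 1 tau z /\
  vartheta 1 1 tau (z + 1 / 2) = - vartheta 1 0 tau z.
Proof.
move=> H. rewrite !vartheta00 // !vartheta01 // !vartheta10 // !vartheta11 //.
split; [|split; [|split]].
- apply: Sum_ext => n. rewrite Q_shift_half. congr Q; field.
- apply: Sum_ext => n. rewrite Q_shift_half. apply: (Q_eq n); field.
- apply: Sum_ext => n. rewrite Q_shift_half. congr Q; field.
- transitivity (- (1) * Sum (fun n => Q tau z ((IZR n + 1 / 2) ^ 2 / 2) (IZR n + 1 / 2) 0)); last ring.
  rewrite -Sum_scal; last exact: absum_theta.
  apply: Sum_ext => n. rewrite Q_shift_half (Q_opp n tau z _ _ _ ((IZR n + 1 / 2) ^ 2 / 2) (IZR n + 1 / 2) 0); try field.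
Qed.

Lemma theta01_square tau z : (0 < Im tau)%R ->
  eta (2 * tau) ^ 5 / (eta tau ^ 2 * eta (4 * tau) ^ 2) * vartheta 0 0 (2 * tau) (2 * z)
  - 2 * (eta (4 * tau) ^ 2 / eta (2 * tau)) * vartheta 1 0 (2 * tau) (2 * z) = vartheta 0 1 tau z ^ 2.
Proof.
move=> H. rewrite -theta00_null_eta // -theta10_null_eta // (vartheta01 tau) //.
rewrite (Sum_ext (fun n => Q tau z (IZR n ^ 2 / 2) (IZR n) (IZR n / 2))
  (fun n => Q tau z (IZR n ^ 2 / 2) (IZR n) (IZR 1 * IZR n / 2))); last by move=> n; congr Q; field.
rewrite theta_square // Q_half_phase. ring.
Qed.

Lemma theta00_square tau z : (0 < Im tau)%R ->
  eta (2 * tau) ^ 5 / (eta tau ^ 2 * eta (4 * tau) ^ 2) * vartheta 0 0 (2 * tau) (2 * z)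
  + 2 * (eta (4 * tau) ^ 2 / eta (2 * tau)) * vartheta 1 0 (2 * tau) (2 * z) = vartheta 0 0 tau z ^ 2.
Proof.
move=> H. rewrite -theta00_null_eta // -theta10_null_eta // (vartheta00 tau) //.
rewrite (Sum_ext (fun n => Q tau z (IZR n ^ 2 / 2) (IZR n) 0)
  (fun n => Q tau z (IZR n ^ 2 / 2) (IZR n) (IZR 0 * IZR n / 2))); last by move=> n; congr Q; field.
rewrite theta_square // (_ : Q tau z 0 0 (IZR 0 / 2) = 1); first ring.
rewrite -(Q_0 tau z). congr Q; field.
Qed.

(* Equality of meromorphic functions is equality at every (tau, z) where all
   the quotients are defined, i.e. where the three theta functions occurring
   in denominators do not vanish. *)
Theorem proposition8p2 :
  forall tau z : C,
    (0 < Im tau)%R ->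
    vartheta 0 0 tau z <> 0 ->
    vartheta 0 1 tau z <> 0 ->
    vartheta 1 1 tau z <> 0 ->
    ch_plus 4 1 tau z =
      Ci / 2 * (1 / (eta (tau / 2) * eta (2 * tau)))
      * (vartheta 1 0 tau z / vartheta 0 1 tau z)
      * (eta (2 * tau) ^ 5 / (eta tau ^ 2 * eta (4 * tau) ^ 2)
           * vartheta 0 0 (2 * tau) (2 * z)
         - 2 * (eta (4 * tau) ^ 2 / eta (2 * tau))
           * vartheta 1 0 (2 * tau) (2 * z))
    /\
    ch_minus 4 1 tau z =
      - (Ci / 2) * (eta (tau / 2) / eta tau ^ 3)
      * (vartheta 1 0 tau z / vartheta 0 0 tau z)
      * (eta (2 * tau) ^ 5 / (eta tau ^ 2 * eta (4 * tau) ^ 2)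
           * vartheta 0 0 (2 * tau) (2 * z)
         + 2 * (eta (4 * tau) ^ 2 / eta (2 * tau))
           * vartheta 1 0 (2 * tau) (2 * z)).
Proof.
move=> tau z H N00 N01 N11.
have Nh := eta_nz (tau / 2) ltac:(rewrite Im_half; lra).
have N1 := eta_nz tau H.
have N2 := eta_nz (2 * tau) ltac:(rewrite Im_double; lra).
rewrite theta01_square // theta00_square //. split.
- rewrite /ch_plus /denom_plus. change (Z.of_nat 1 + 1)%Z with 2%Z.
  have -> : z + tau / 2 - 1 / 2 = shifted_z1 tau z (-1) by rewrite /shifted_z1; field.
  have -> : z - tau / 2 + 1 / 2 = shifted_z2 tau z 0 by rewrite /shifted_z2; ring.
  rewrite Phi_mod_appell_term //. have [_ ->] := appell_theta_product tau z H N00.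
  field. by repeat split.
- rewrite /ch_minus /denom_minus. change (Z.of_nat 1 + 1)%Z with 2%Z.
  have [E00 [E01 [E10 E11]]] := vartheta_shift_half tau z H.
  have -> : z + tau / 2 = shifted_z1 tau (z + 1 / 2) (-1) by rewrite /shifted_z1; field.
  have -> : z - tau / 2 = shifted_z2 tau (z + 1 / 2) (-1) by rewrite /shifted_z2; field.
  (* The poles at z + 1/2 are excluded because vartheta_00 there is vartheta_01 at z. *)
  rewrite -E00 in N01.
  rewrite Phi_mod_appell_term //. have [_ ->] := appell_theta_product tau (z + 1 / 2) H N01.
  rewrite -E00 E01 E10 E11. field. by repeat split.
Qed.
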